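(* Let $G$ be a sequentially complete Hausdorff topological Abelian group with completion $\widetilde G$ such that $G^\omega$ is minimal. Then for every prime $p$ there exists $k_p\in\mathbb N^*$ such that $G$ contains the compact subgroup $N=\overline{\langle p^{k_p} td_p(\widetilde G): p\in\mathbb P\rangle}$ (closure taken in $\widetilde G$), and $G/N$ is topologically isomorphic to $\prod_{p\in\mathbb P}B_p$, where for every prime $p$ the group $B_p$ is a bounded $p$-torsion minimal topological group.
   Context: $\mathbb P$ is the set of primes, $\mathbb N^*=\{1,2,\dots\}$. For a prime $p$, an element $x$ of a topological Abelian group $H$ is quasi-$p$-torsion if either $x$ has order a power of $p$, or $\langle x\rangle$ is topologically isomorphic to $\mathbb Z$ with the $p$-adic topology; $td_p(H)$ is the subgroup of quasi-$p$-torsion elements. A Hausdorff topological group is minimal if there is no strictly coarser Hausdorff group topology on it. A topological Abelian group is sequentially complete if it is sequentially closed in its completion (equivalently, every Cauchy sequence converges). A group $B$ is bounded if $nB=0$ for some $n\geq1$. *)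

(* Defs.v *)
From HB Require Import structures.
From mathcomp Require Import all_boot all_order all_algebra.
From mathcomp Require Import all_classical.
From mathcomp Require Import topology tvs.

Set Implicit Arguments.
Unset Strict Implicit.
Unset Printing Implicit Defensive.

Import GRing.Theory.
Local Open Scope classical_set_scope.
Local Open Scope ring_scope.

Section TopProd.
Variables (I : eqType) (X : I -> topologicalZmodType).

Definition topprod : Type := prod_topology (fun i => X i).

HB.instance Definition _ := Topological.on topprod.

Let addf (f g : topprod) : topprod := fun i => f i + g i.
Let oppf (f : topprod) : topprod := fun i => - f i.
Let zerof : topprod := fun i => 0.

Lemma topprod_addA : associative addf.
Proof. by move=> f g h; apply: functional_extensionality_dep => i; exact: addrA. Qed.
Lemma topprod_addC : commutative addf.
Proof. by move=> f g; apply: functional_extensionality_dep => i; exact: addrC. Qed.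
Lemma topprod_add0 : left_id zerof addf.
Proof. by move=> f; apply: functional_extensionality_dep => i; exact: add0r. Qed.
Lemma topprod_addN : left_inverse zerof oppf addf.
Proof. by move=> f; apply: functional_extensionality_dep => i; exact: addNr. Qed.

HB.instance Definition _ := GRing.isZmodule.Build topprod
  topprod_addA topprod_addC topprod_add0 topprod_addN.

Lemma topprod_sub_continuous :
  continuous (fun x : topprod * topprod => x.1 - x.2).
Proof.
move=> /= x; apply/cvg_sup => i A /=.
rewrite (@nbhsE (initial_topology (fun f : topprod => f i))).
move=> [_ [[B oB <-] Bx] sBA].
have pc : continuous (fun f : topprod => f i).
  exact: (@proj_continuous _ (fun i => X i : topologicalType) i).
have c : (fun z : topprod * topprod => z.1 i - z.2 i) @ x --> x.1 i - x.2 i.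
  apply: (@continuous_comp _ _ _ (fun z : topprod * topprod => (z.1 i, z.2 i))
    (fun z => z.1 - z.2)); last exact: sub_continuous.
  apply: cvg_pair.
    by apply: (@continuous_comp _ _ _ fst (fun f : topprod => f i));
      [exact: cvg_fst|exact: pc].
  by apply: (@continuous_comp _ _ _ snd (fun f : topprod => f i));
    [exact: cvg_snd|exact: pc].
apply: (@filterS _ (nbhs x) _ _ _ _ (c _ (open_nbhs_nbhs (conj oB Bx)))).
by move=> z Bz; apply: sBA.
Qed.

HB.instance Definition _ :=
  PreTopologicalNmodule_isTopologicalZmodule.Build topprod
    topprod_sub_continuous.

End TopProd.

Section TopQuot.
Variables (G : topologicalZmodType) (N : zmodClosed G).
Local Open Scope quotient_scope.

Definition topquot : Type := quotient_topology {ideal_quot N}.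

HB.instance Definition _ := Topological.on topquot.
HB.instance Definition _ := GRing.isZmodule.Build topquot
  (@Quotient.addqA G N) (@Quotient.addqC G N)
  (@Quotient.add0q G N) (@Quotient.addNq G N).

Definition topquot_pi (x : G) : topquot := \pi_{ideal_quot N} x.

Lemma topquot_piB x y : topquot_pi (x - y) = topquot_pi x - topquot_pi y.
Proof.
rewrite /topquot_pi (Quotient.pi_add N x (- y)); congr Quotient.add.
exact: (Quotient.pi_opp N y).
Qed.

Lemma topquot_pi_surj (q : topquot) : exists x, topquot_pi x = q.
Proof. by exists (repr (q : {ideal_quot N})); exact: reprK. Qed.

Lemma topquot_pi_eq x y : topquot_pi x = topquot_pi y -> x - y \in N.
Proof. by move=> xy; rewrite (Quotient.idealrBE N); apply/eqP. Qed.

Lemma topquot_openE (U : set topquot) : open U = open (topquot_pi @^-1` U).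
Proof. by []. Qed.

Lemma topquot_pi_eqP x y : x - y \in N -> topquot_pi x = topquot_pi y.
Proof. by rewrite (Quotient.idealrBE N) => /eqP. Qed.

Lemma topquot_pi_open (U : set G) : open U -> open (topquot_pi @` U).
Proof.
move=> oU; rewrite topquot_openE.
have -> : topquot_pi @^-1` (topquot_pi @` U) =
    \bigcup_(n in [set n | n \in N]) ((fun x => x - n) @^-1` U).
  rewrite eqEsubset; split=> x.
    move=> [y Uy /esym/topquot_pi_eq xy]; exists (x - y) => //=.
    by rewrite opprB addrC subrK.
  move=> [n /= Nn Ux]; exists (x - n) => //; apply: topquot_pi_eqP.
  by rewrite addrAC subrr add0r rpredN.
apply: bigcup_open => n _; apply: open_comp => // x _.
apply: (@continuous_comp _ _ _ (fun x => (x, n)) (fun z : G * G => z.1 - z.2)).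
  by apply: cvg_pair; [exact: cvg_id|exact: cvg_cst].
exact: sub_continuous.
Qed.

Lemma topquot_sub_continuous :
  continuous (fun x : topquot * topquot => x.1 - x.2).
Proof.
move=> [q1 q2]; have [x <-] := topquot_pi_surj q1.
have [y <-] := topquot_pi_surj q2.
move=> A; rewrite nbhsE => -[O [oO Oxy] sOA].
move: Oxy => /=; rewrite -topquot_piB => Oxy.
have nO : nbhs (x - y) (topquot_pi @^-1` O) by exact: open_nbhs_nbhs.
have /= := @sub_continuous G (x, y) _ nO.
move=> [[P Q] /= [Px Qy] sPQ].
move: Px Qy; rewrite (nbhsE x) (nbhsE y).
move=> -[P' [oP P'x] sP] [Q' [oQ Q'y] sQ].
exists (topquot_pi @` P', topquot_pi @` Q') => /=.
  by split; apply: open_nbhs_nbhs; split;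
     [exact: topquot_pi_open|exists x|exact: topquot_pi_open|exists y].
move=> [_ _] [/= [a Pa <-] [b Qb <-]]; apply: sOA.
rewrite -topquot_piB; apply: (sPQ (a, b)); split; [exact: sP|exact: sQ].
Qed.

HB.instance Definition _ :=
  PreTopologicalNmodule_isTopologicalZmodule.Build topquot
    topquot_sub_continuous.
End TopQuot.

Definition padic_int (p : nat) : Type := int.

Section PadicInt.
Variable p : nat.
Local Notation padic_int := (padic_int p).

HB.instance Definition _ := GRing.Zmodule.on padic_int.

Definition padic_open (A : set padic_int) := forall x : int, A x ->
  exists n : nat, forall y : int, ((p ^ n)%N%:Z %| y - x)%Z -> A y.

Lemma padic_openT : padic_open setT.
Proof. by move=> x _; exists 0%N. Qed.

Lemma padic_openI : setI_closed padic_open.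
Proof.
move=> A B oA oB x [/oA[m Am] /oB[n Bn]]; exists (m + n)%N => y.
rewrite expnD PoszM => h; split.
  by apply: Am; apply: dvdz_trans h; exact: dvdz_mulr.
by apply: Bn; apply: dvdz_trans h; exact: dvdz_mull.
Qed.

Lemma padic_open_bigU (I : Type) (f : I -> set padic_int) :
  (forall i, padic_open (f i)) -> padic_open (\bigcup_i f i).
Proof.
move=> of_ x [i _ fx]; have [n fn] := of_ i x fx.
by exists n => y /fn fy; exists i.
Qed.

HB.instance Definition _ := isOpenTopological.Build padic_int
  padic_openT padic_openI padic_open_bigU.

Lemma padic_sub_continuous :
  continuous (fun x : padic_int * padic_int => x.1 - x.2).
Proof.
move=> [x y] A /=; rewrite nbhsE => -[O [oO Oxy] sOA].
have [n On] := oO _ Oxy.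
pose V (z : int) : set padic_int := [set t : int | ((p ^ n)%N%:Z %| t - z)%Z].
have nV z : nbhs (z : padic_int) (V z).
  apply: open_nbhs_nbhs; split; last by rewrite /V /= subrr dvdz0.
  move=> t Vt; exists n => u h; rewrite /V /=.
  by rewrite -(subrK t u) -addrA; apply: rpredD.
exists (V x, V y) => //= -[a b] [/= Va Vb]; apply: sOA; apply: On.
have -> : ((a : int) - b - ((x : int) - y) = (a - x) - (b - y) :> int)%R.
  by rewrite !opprB addrACA [RHS]addrACA [- (b : int) - x]addrC.
exact: rpredB.
Qed.

HB.instance Definition _ :=
  PreTopologicalNmodule_isTopologicalZmodule.Build padic_int
    padic_sub_continuous.
End PadicInt.


Section Subgroups.
Variable X : zmodType.

Definition subgroup (S : set X) : Prop :=
  S 0 /\ forall x y, S x -> S y -> S (x - y).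

Definition generated_subgroup (A : set X) : set X := smallest subgroup A.

Definition has_order (x : X) (m : nat) : Prop :=
  [/\ (0 < m)%N, x *+ m = 0 & forall j, (0 < j < m)%N -> x *+ j <> 0].

Definition prime_power_order (p : nat) (x : X) : Prop :=
  exists n : nat, has_order x (p ^ n).

Definition ptorsion_group (p : nat) : Prop :=
  forall x : X, prime_power_order p x.

Definition bounded_group : Prop :=
  exists2 n : nat, (1 <= n)%N & forall x : X, x *+ n = 0.

End Subgroups.
Arguments ptorsion_group : clear implicits.

Section GroupTopologies.
Variable X : zmodType.

(* Group topologies are given here by their families of open sets, so that
   several of them can be compared on one group. *)
Record group_topology (tau : set (set X)) : Prop := GroupTopology {
  gtop_setT : tau setT ;
  gtop_setI : setI_closed tau ;
  gtop_bigU : forall (I : Type) (f : I -> set X),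
    (forall i, tau (f i)) -> tau (\bigcup_i f i) ;
  gtop_add : forall x y U, tau U -> U (x + y) ->
    exists V W, [/\ tau V, tau W, V x, W y &
      forall a b, V a -> W b -> U (a + b)] ;
  gtop_opp : forall U, tau U -> tau (-%R @^-1` U)
}.

Definition hausdorff_topology (tau : set (set X)) : Prop :=
  forall x y, x <> y -> exists U V, [/\ tau U, tau V, U x, V y & U `&` V = set0].

End GroupTopologies.

Definition minimal_group (X : topologicalZmodType) : Prop :=
  hausdorff_space X /\
  forall tau : set (set X), group_topology tau -> hausdorff_topology tau ->
    tau `<=` open -> tau = open.

Definition top_embedding (X Y : topologicalZmodType) (f : {additive X -> Y}) :
    Prop :=
  injective f /\
  forall A : set X, open A <-> exists2 B : set Y, open B & A = f @^-1` B.

Definition top_isomorphic (X Y : topologicalZmodType) : Prop :=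
  exists (f : {additive X -> Y}) (g : Y -> X),
    [/\ cancel f g, cancel g f, continuous f & continuous g].

Definition cauchy_filter (X : topologicalZmodType) (F : set_system X) : Prop :=
  forall U : set X, nbhs (0 : X) U ->
    exists2 A, F A & forall x y, A x -> A y -> U (x - y).

Definition complete_group (X : topologicalZmodType) : Prop :=
  forall F : set_system X, ProperFilter F -> cauchy_filter F ->
    exists l : X, F --> l.

(* The completion is characterized, not constructed: a dense topological
   embedding i into a complete Hausdorff group H, which determines (H, i) up to
   topological isomorphism. *)
Definition is_completion (G H : topologicalZmodType) (i : {additive G -> H}) :
    Prop :=
  [/\ hausdorff_space H, complete_group H, top_embedding i & dense (range i)].

Definition sequentially_closed (T : topologicalType) (A : set T) : Prop :=
  forall (u : nat -> T) (l : T), (forall n, A (u n)) -> u @ \oo --> l -> A l.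

(* Here i is the embedding of G into its completion H. *)
Definition sequentially_complete (G H : topologicalZmodType)
    (i : {additive G -> H}) : Prop :=
  sequentially_closed (range i).

(* The second alternative says that <x> with the subspace topology is
   topologically isomorphic to the integers with the p-adic topology. *)
Definition quasi_p_torsion (H : topologicalZmodType) (p : nat) (x : H) : Prop :=
  prime_power_order p x \/
  exists f : {additive padic_int p -> H},
    top_embedding f /\ range f = generated_subgroup [set x].

Definition td (H : topologicalZmodType) (p : nat) : set H :=
  [set x | quasi_p_torsion p x].
Arguments td : clear implicits.

Definition primeT : Type := {p : nat | prime p}.
HB.instance Definition _ := Choice.on primeT.

(* Main.v *)
Require Import Defs.
From HB Require Import structures.
From mathcomp Require Import Rstruct.
From mathcomp Require Import all_boot all_order all_algebra all_fingroup archimedean.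
From mathcomp Require Import ring lra zify.
From mathcomp Require Import all_classical.
From mathcomp Require Import reals topology normedtype tvs sequences trigo.

(* Write K for the completion.  Minimality of G^omega passes to K and makes the
   diagonal powers of cyclic subgroups meet G^omega nontrivially, which gives
   K[p] <= G and p^k td_p(K) <= G for some k = k_p.

   K is compact.  If no multiple mK were precompact for some neighbourhood, one
   could pick a sequence a_n so spread out that making a_n - a_m small along a
   filter defines a strictly coarser Hausdorff group topology.  Hence the
   intersection D of the closures of the dK is compact and divisible.  A closed
   subgroup L minimal with L + D = K satisfies dL -> 0: a character of the
   divisible part of L extends to L up to a multiple, and its kernel would be a
   smaller supplement.  The same coarsening argument applied to the p-components
   of L shows that L, hence K = L + D, is precompact.

   D lies in G.  Take a maximal family of characters mapping D onto a torus, with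
   kernel Z; then dZ -> 0.  Every x in D is a limit of elements x - e_n with
   n (x - e_n) in Z, these are convergent sums of their p-components, and the
   p-components are divisible by p^k inside D, so they belong to G.

   It follows that N is the intersection of the p^{k_p} K, that G / N is the
   product of the groups B_p = G / (G n p^{k_p} K), and that each B_p is minimal:
   the closure in K of a coarser topology's zero-neighbourhoods, if larger than
   p^{k_p} K, would contain an element of K[p] + p^{k_p - 1} K <= G + p^{k_p} K
   outside p^{k_p} K. *)

Set Implicit Arguments.
Unset Strict Implicit.
Unset Printing Implicit Defensive.

Import Order.TTheory GRing.Theory Num.Theory numFieldNormedType.Exports.
Local Open Scope classical_set_scope.
Local Open Scope ring_scope.

(** * Equalities in abelian groups *)

(** The power G^omega matters because one filter of integers then serves countably many elements at
    once. If p^k x_k were outside G for every k, the closure in K^omega of the cyclic group of the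
    sequence (x_k) would still contain a nonzero point of G^omega; a nonzero coordinate of it bounds
    the power of p dividing the integers of the filter, and sequential closedness of G then puts
    some p^t x_t into G. A single copy of G would only give an exponent depending on the element.

    Characters of a precompact subgroup are obtained without an invariant measure: the subgroup is
    replaced by a finite group (Z/N)^S and integrals by finite sums.

    The coarser topology is built from sums of c_n a_n whose coefficients have sum zero. The
    delicate point is that it stays Hausdorff: the sequence must be so independent that a small sum
    has all its coefficients divisible by a certain integer, while sums with such coefficients are
    small. *)

Inductive zexpr := ZVar of nat | ZZero | ZAdd of zexpr & zexpr | ZOpp of zexpr.

Fixpoint zeval (X : zmodType) (env : seq X) (e : zexpr) : X :=
  match e with
  | ZVar n => nth 0 env n
  | ZZero => 0
  | ZAdd e1 e2 => zeval env e1 + zeval env e2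
  | ZOpp e1 => - zeval env e1
  end.

Fixpoint zcoef (e : zexpr) (i : nat) : int :=
  match e with
  | ZVar n => if n == i then 1 else 0
  | ZZero => 0
  | ZAdd e1 e2 => zcoef e1 i + zcoef e2 i
  | ZOpp e1 => - zcoef e1 i
  end.

(** Normal form: an expression depends only on the integer coefficients of its atoms, and these are
    what [zmod] compares. *)
Lemma zevalE (X : zmodType) (env : seq X) e :
  zeval env e = \sum_(i < size env) env`_i *~ zcoef e i.
Proof.
elim: e => [n||e1 IH1 e2 IH2|e IH] /=.
- have [ln|ln] := ltnP n (size env).
    rewrite (bigD1 (Ordinal ln)) //= eqxx mulr1z big1 ?addr0 // => j.
    by rewrite eq_sym -val_eqE /= => /negbTE ->; rewrite mulr0z.
  rewrite nth_default // big1 // => j _; case: eqP => [e|_]; last exact: mulr0z.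
  by have := ltn_ord j; rewrite -e ltnNge ln.
- by rewrite big1 // => j _; rewrite mulr0z.
- by rewrite IH1 IH2 -big_split; apply: eq_bigr => j _; rewrite mulrzDr.
- by rewrite IH -sumrN; apply: eq_bigr => j _; rewrite mulrNz.
Qed.

(* The number n of atoms is kept apart from env, so that computing the boolean
   test never evaluates the atoms themselves. *)
Lemma zeval_eq (X : zmodType) (n : nat) (env : seq X) e1 e2 : size env = n ->
  all (fun i => zcoef e1 i == zcoef e2 i) (iota 0 n) ->
  zeval env e1 = zeval env e2.
Proof.
move=> <- /allP h; rewrite !zevalE; apply: eq_bigr => i _.
by rewrite (eqP (h i _)) // mem_iota /= add0n ltn_ord.
Qed.

Ltac zlength l :=
  match l with
  | nil => constr:(0%N)
  | cons _ ?l' => let n := zlength l' in constr:(S n)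
  end.
Ltac zlookup_syn x l :=
  match l with
  | cons ?y ?l' => match constr:(tt) with
     | _ => let _ := match constr:(tt) with _ => constr_eq x y end in constr:(0%N)
     | _ => let n := zlookup_syn x l' in constr:(S n) end
  end.
(* The same operation may be reached through different inheritance paths, hence
   atoms are compared up to conversion when they are not syntactically equal. *)
Ltac zlookup_conv x l :=
  match l with
  | cons ?y ?l' => match constr:(tt) with
     | _ => let _ := match constr:(tt) with _ => unify x y end in constr:(0%N)
     | _ => let n := zlookup_conv x l' in constr:(S n) end
  end.
Ltac zlookup x l :=
  match constr:(tt) with
  | _ => zlookup_syn x l
  | _ => zlookup_conv x l
  end.
Ltac zinsert x l :=
  match constr:(tt) with
  | _ => let _ := zlookup x l in l
  | _ => let T := type of x in constr:(@cons T x l)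
  end.
Ltac zatoms l t :=
  match t with
  | @GRing.add _ ?a ?b => let l1 := zatoms l a in zatoms l1 b
  | @GRing.opp _ ?a => zatoms l a
  | @GRing.zero _ => l
  | _ => zinsert t l
  end.
Ltac zreify l t :=
  match t with
  | @GRing.add _ ?a ?b => let x := zreify l a in let y := zreify l b in
      constr:(ZAdd x y)
  | @GRing.opp _ ?a => let x := zreify l a in constr:(ZOpp x)
  | @GRing.zero _ => constr:(ZZero)
  | _ => let n := zlookup t l in constr:(ZVar n)
  end.
Ltac zmod :=
  match goal with
  | |- @eq ?T ?a ?b =>
    let l0 := zatoms (@nil T) a in
    let l := zatoms l0 b in
    let e1 := zreify l a in
    let e2 := zreify l b in
    let n := zlength l in
    refine (@zeval_eq _ n l e1 e2 erefl _); by vm_compute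
  end.

(** * The norm on the circle *)

Section CircleNorm.
Variable R : realType.
Implicit Types (s t : R).

(** The representative of t modulo 1 in [-1/2, 1/2). The circle R/Z is never formed: its points are
    reals, and equality in it reads [tnorm (s - t) = 0]. *)
Definition centered t : R := t - (Num.floor (t + 2^-1))%:~R.
Definition tnorm t : R := `|centered t|.

Lemma centered_bound t : - 2^-1 <= centered t < 2^-1.
Proof.
have /andP[h1 h2] := floor_itv (t + 2^-1).
rewrite /centered; move: h2; rewrite intrD; lra.
Qed.

Lemma centered_int t : t - centered t \is a Num.int.
Proof. by rewrite /centered opprB addrC subrK. Qed.

Lemma tnorm_ge0 t : 0 <= tnorm t. Proof. exact: normr_ge0. Qed.

Lemma tnorm_le_half t : tnorm t <= 2^-1.
Proof. by rewrite /tnorm ler_norml; have := centered_bound t; lra. Qed.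

Lemma tnorm_le t (z : int) : tnorm t <= `|t - z%:~R|.
Proof.
have /andP[b1 b2] := centered_bound t.
have [e|ne] := eqVneq z (Num.floor (t + 2^-1)); first by rewrite e.
have : (1 <= `|z - Num.floor (t + 2^-1)|)%R.
  by rewrite -gtz0_ge1 normr_gt0 subr_eq0.
rewrite -(ler_int R) intr_norm intrB.
rewrite /tnorm; move: b1 b2; rewrite /centered.
set F := (Num.floor _)%:~R; set Z := z%:~R => b1 b2 h.
have : `|Z - F| <= `|t - F| + `|t - Z|.
  have -> : Z - F = (t - F) - (t - Z) by ring.
  exact: ler_normB.
have : `|t - F| <= 2^-1 by rewrite ler_norml; lra.
move: h; set A := `|Z - F|; set B := `|t - F|; set D := `|t - Z|.
have -> : (1%:~R : R) = 1 by [].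
lra.
Qed.

Lemma tnorm_eq0 t : (tnorm t == 0) = (t \is a Num.int).
Proof.
apply/idP/idP => [|/intrP[z ->]].
  by rewrite normr_eq0 => /eqP e; have := centered_int t; rewrite e subr0.
by rewrite eq_le tnorm_ge0 andbT (le_trans (tnorm_le _ z)) // subrr normr0.
Qed.

Lemma tnorm_ex t : exists z : int, tnorm t = `|t - z%:~R|.
Proof. by eexists. Qed.

Lemma tnorm0 : tnorm 0 = 0.
Proof. by apply/eqP; rewrite tnorm_eq0. Qed.

Lemma tnormN t : tnorm (- t) = tnorm t.
Proof.
have h u : tnorm (- u) <= tnorm u.
  have [z ->] := tnorm_ex u.
  by rewrite (le_trans (tnorm_le _ (- z))) // intrN -opprD normrN.
by apply/eqP; rewrite eq_le h -{1}(opprK t) h.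
Qed.

Lemma tnormD s t : tnorm (s + t) <= tnorm s + tnorm t.
Proof.
have [z ->] := tnorm_ex s; have [y ->] := tnorm_ex t.
rewrite (le_trans (tnorm_le _ (z + y))) // intrD.
have -> : s + t - (z%:~R + y%:~R) = (s - z%:~R) + (t - y%:~R) by ring.
exact: ler_normD.
Qed.

Lemma tnormB s t : tnorm (s - t) <= tnorm s + tnorm t.
Proof. by rewrite -(tnormN t) tnormD. Qed.

Lemma tnormC s t : tnorm (s - t) = tnorm (t - s).
Proof. by rewrite -opprB tnormN. Qed.

Lemma tnorm_intD s t : tnorm t = 0 -> tnorm (s + t) = tnorm s.
Proof.
move=> h; apply/eqP; rewrite eq_le (le_trans (tnormD _ _)) ?h ?addr0 //=.
have {1}-> : s = (s + t) - t by ring.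
by rewrite (le_trans (tnormB _ _)) // h addr0.
Qed.

Lemma tnorm_eqB s t : tnorm (s - t) = 0 -> tnorm s = tnorm t.
Proof. by move=> h; rewrite -(tnorm_intD t h) addrC subrK. Qed.

Lemma tnorm_small t : `|t| <= 2^-1 -> tnorm t = `|t|.
Proof.
move=> h; apply/eqP; rewrite eq_le; apply/andP; split.
  by rewrite (le_trans (tnorm_le _ 0)) // subr0.
have [z ->] := tnorm_ex t.
have [->|nz] := eqVneq z 0; first by rewrite subr0.
have : (1 <= `|z|)%R by rewrite -gtz0_ge1 normr_gt0.
rewrite -(ler_int R) intr_norm.
have : `|z%:~R| <= `|t| + `|t - z%:~R|.
  have {1}-> : (z%:~R : R) = t - (t - z%:~R) by ring.
  exact: ler_normB.
have -> : (1%:~R : R) = 1 by [].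
lra.
Qed.

Lemma tnorm_mulrn n t : tnorm t = 0 -> tnorm (t *+ n) = 0.
Proof.
by move=> /eqP; rewrite tnorm_eq0 => h; apply/eqP; rewrite tnorm_eq0 rpredMn.
Qed.

Lemma tnorm_le_abs t : tnorm t <= `|t|.
Proof. by rewrite (le_trans (tnorm_le _ 0)) // subr0. Qed.

Lemma tnorm_double t : tnorm t <= 4^-1 -> tnorm (t *+ 2) = tnorm t *+ 2.
Proof.
move=> h; have e : tnorm (t *+ 2 - centered t *+ 2) = 0.
  by apply/eqP; rewrite tnorm_eq0 -mulrnBl rpredMn // centered_int.
rewrite (tnorm_eqB e) tnorm_small; last first.
  by rewrite normrMn; move: h; rewrite /tnorm; lra.
by rewrite normrMn.
Qed.

Lemma tnorm_pow2 n t : (forall j, (j < n)%N -> tnorm (t *+ (2 ^ j)) <= 4^-1) ->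
  tnorm (t *+ (2 ^ n)) = tnorm t *+ (2 ^ n).
Proof.
elim: n => // n IH h.
rewrite expnSr !mulrnA tnorm_double; last exact: h.
by rewrite IH // => j jn; apply: h; exact: ltnW.
Qed.

(** The circle has no small subgroups: a nonzero distance to the integers doubles as long as it is
    at most 1/4, so it eventually exceeds 1/4. *)
Lemma tnorm_pow2_eq0 t : (forall j, tnorm (t *+ (2 ^ j)) <= 4^-1) -> tnorm t = 0.
Proof.
move=> h; apply/eqP; rewrite eq_le tnorm_ge0 andbT leNgt; apply/negP => t0.
pose m := (Num.truncn ((tnorm t)^-1)).+1.
have hm : (tnorm t)^-1 < m%:R by exact: truncnS_gt.
have e : tnorm t *+ (2 ^ m) <= 4^-1.
  by rewrite -(@tnorm_pow2 m) // => j _; exact: h.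
have l : 1 < tnorm t *+ m by rewrite -mulr_natr mulrC -ltr_pdivrMr // mul1r.
have : tnorm t *+ m <= tnorm t *+ (2 ^ m).
  by rewrite ler_wpMn2l ?tnorm_ge0 // ltnW // ltn_expl.
lra.
Qed.

End CircleNorm.

(** * Stability of approximate homomorphisms into the circle *)

Section Hyers.
Variables (R : realType) (X : zmodType) (C : set X) (F : X -> R) (eps : R).
Hypothesis CD : forall x y, C x -> C y -> C (x + y).
Hypothesis epsle : eps <= 32^-1.
Hypothesis FD : forall x y, C x -> C y -> tnorm (F (x + y) - F x - F y) <= eps.

(** Halving is ambiguous on the circle, so the usual limit of F (2^j x) / 2^j makes no sense.
    Instead the defect of doubling is lifted to the small real [c x], and only such lifts are
    divided; the series [b] is made so that H = F - b satisfies H (2 x) = 2 H (x) modulo 1. *)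
Let c x : R := centered (F x *+ 2 - F (x *+ 2)).
Let u x (j : nat) : R := c (x *+ (2 ^ j)) / (2 ^+ j.+1).
Let b x : R := lim (series (u x) @ \oo).

Let C2 x j : C x -> C (x *+ (2 ^ j)).
Proof.
by move=> Cx; elim: j => // j IH; rewrite expnSr mulrnA mulr2n; apply: CD.
Qed.

Let cle x : C x -> `|c x| <= eps.
Proof.
move=> Cx; have := FD Cx Cx; rewrite -tnormN; congr (tnorm _ <= _).
by rewrite -mulr2n mulr2n; ring.
Qed.

Let eps0 x : C x -> 0 <= eps.
Proof. by move=> Cx; apply: le_trans (FD Cx Cx); exact: tnorm_ge0. Qed.

Let ule x j : C x -> `|u x j| <= geometric (eps / 2) (2^-1) j.
Proof.
move=> Cx; rewrite /geometric /= exprVn -mulrA -invfM -exprS.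
rewrite /u normrM (ger0_norm (_ : 0 <= (2 ^+ j.+1)^-1)) ?invr_ge0 ?exprn_ge0 //.
by rewrite ler_wpM2r ?invr_ge0 ?exprn_ge0 //; apply: cle; exact: C2.
Qed.

Let ucvg x : C x -> cvgn (series (u x)).
Proof.
move=> Cx; apply: normed_cvg; apply: (series_le_cvg _ _ (fun j => ule j Cx)).
- by move=> n; exact: normr_ge0.
- move=> n; rewrite /geometric /= mulr_ge0 ?exprn_ge0 ?invr_ge0 //.
  by rewrite divr_ge0 // (eps0 Cx).
- by apply: is_cvg_geometric_series; rewrite ger0_norm ?invr_ge0 //; lra.
Qed.

Let sum_le x n : C x -> `|series (u x) n| <= eps.
Proof.
move=> Cx; have e0 := eps0 Cx.
suff : `|series (u x) n| <= eps * (1 - 2^-1 ^+ n).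
  move/le_trans; apply; rewrite -[leRHS]mulr1 ler_wpM2l //.
  by rewrite gerBl exprn_ge0 // invr_ge0.
elim: n => [|n IH]; first by rewrite /series /= big_nil normr0 expr0 subrr mulr0.
have := ule n Cx; rewrite /geometric /=.
rewrite /series /= big_nat_recr //=; move: IH; rewrite /series /= exprS.
set S := \sum_(_ <= _ < _) _; set q := 2^-1 ^+ n => IH h.
rewrite (le_trans (ler_normD _ _)) // (le_trans (lerD IH h)) //.
by rewrite le_eqVlt; apply/orP; left; apply/eqP; field.
Qed.

Let b_le x : C x -> `|b x| <= eps.
Proof.
move=> Cx; have := ucvg Cx => h.
have : `|series (u x) n| @[n --> \oo] --> `|b x| by exact: cvg_norm.
move/cvg_lim => <- //; apply: limr_le; first exact: is_cvg_norm.
by near=> n; exact: sum_le.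
Unshelve. all: by end_near. Qed.

Let b2 x : C x -> b (x *+ 2) = b x *+ 2 - c x.
Proof.
move=> Cx; have h1 := ucvg Cx.
have h2 : cvgn (series (u (x *+ 2))) by apply: ucvg; have := C2 1 Cx.
have u0 : u x 0 *+ 2 = c x by rewrite /u expn0 mulr1n expr1 mulr2n -splitr.
have uS j : u (x *+ 2) j = u x j.+1 *+ 2.
  rewrite /u -mulrnA -expnS -[RHS]mulr_natr (exprS _ j.+1).
  by rewrite invfM [2^-1 * _]mulrC mulrA divfK ?pnatr_eq0.
have e n : series (u (x *+ 2)) n = series (u x) n.+1 *+ 2 - c x.
  rewrite /series /= [X in _ = X *+ 2 - _]big_nat_recl // mulrnDl u0 addrAC subrr add0r.
  by rewrite -sumrMnl; apply: eq_bigr => j _; exact: uS.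
rewrite /b; apply: cvg_lim => //.
have -> : series (u (x *+ 2)) = (fun n => series (u x) n.+1 *+ 2 - c x) by apply/funext.
apply: cvgB; last exact: cvg_cst.
by apply: (@cvgMn _ _ _ _ _ (fun n => series (u x) n.+1)); rewrite cvg_shiftS.
Qed.

Lemma hyers : exists H : X -> R,
  (forall x y, C x -> C y -> tnorm (H (x + y) - H x - H y) = 0) /\
  (forall x, C x -> tnorm (H x - F x) <= eps).
Proof.
pose H x := F x - b x; exists H.
have HF x : C x -> tnorm (H x - F x) <= eps.
  move=> Cx; rewrite (le_trans (tnorm_le_abs _)) //.
  by rewrite /H addrAC subrr add0r normrN b_le.
split=> // x y Cx Cy.
have H2 z : C z -> tnorm (H z *+ 2 - H (z *+ 2)) = 0.
  move=> Cz; rewrite /H b2 //; apply/eqP; rewrite tnorm_eq0.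
  have -> : (F z - b z) *+ 2 - (F (z *+ 2) - (b z *+ 2 - c z)) =
    (F z *+ 2 - F (z *+ 2)) - c z by rewrite !mulr2n; ring.
  exact: centered_int.
(* The additivity defect of H at the multiples by 2^j. It is at most 4 eps, hence at most 1/4, and
   modulo 1 it is 2^j times the defect at (x, y), which is therefore an integer. *)
pose eta j := H ((x + y) *+ 2 ^ j) - H (x *+ 2 ^ j) - H (y *+ 2 ^ j).
have eta_le j : tnorm (eta j) <= 4^-1.
  have Cx' := C2 j Cx; have Cy' := C2 j Cy; have Cxy := C2 j (CD Cx Cy).
  have -> : eta j = (H ((x + y) *+ 2 ^ j) - F ((x + y) *+ 2 ^ j))
     - (H (x *+ 2 ^ j) - F (x *+ 2 ^ j)) - (H (y *+ 2 ^ j) - F (y *+ 2 ^ j))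
     + (F (x *+ 2 ^ j + y *+ 2 ^ j) - F (x *+ 2 ^ j) - F (y *+ 2 ^ j)).
    by rewrite /eta -mulrnDl; ring.
  rewrite (le_trans (tnormD _ _)) //.
  have h1 := HF _ Cx'; have h2 := HF _ Cy'; have h3 := HF _ Cxy.
  have h4 := FD Cx' Cy'; have h5 := tnormB
    (H ((x + y) *+ 2 ^ j) - F ((x + y) *+ 2 ^ j) - (H (x *+ 2 ^ j) - F (x *+ 2 ^ j)))
    (H (y *+ 2 ^ j) - F (y *+ 2 ^ j)).
  have h6 := tnormB (H ((x + y) *+ 2 ^ j) - F ((x + y) *+ 2 ^ j))
    (H (x *+ 2 ^ j) - F (x *+ 2 ^ j)).
  move: h1 h2 h3 h4 h5 h6 epsle.
  lra.
have etaE j : tnorm ((H (x + y) - H x - H y) *+ 2 ^ j - eta j) = 0.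
  elim: j => [|j IH]; first by rewrite /eta !expn0 !mulr1n subrr tnorm0.
  rewrite expnSr mulrnA.
  have -> : (H (x + y) - H x - H y) *+ 2 ^ j *+ 2 - eta j.+1 =
    ((H (x + y) - H x - H y) *+ 2 ^ j - eta j) *+ 2
    + (eta j *+ 2 - eta j.+1) by rewrite !mulr2n; ring.
  rewrite tnorm_intD; first exact: tnorm_mulrn.
  have Cx' := C2 j Cx; have Cy' := C2 j Cy; have Cxy := C2 j (CD Cx Cy).
  have -> : eta j *+ 2 - eta j.+1 =
    (H ((x + y) *+ 2 ^ j) *+ 2 - H ((x + y) *+ 2 ^ j *+ 2))
    - (H (x *+ 2 ^ j) *+ 2 - H (x *+ 2 ^ j *+ 2))
    - (H (y *+ 2 ^ j) *+ 2 - H (y *+ 2 ^ j *+ 2)).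
    by rewrite /eta expnSr !mulrnA !mulrnBl; ring.
  apply/eqP; rewrite eq_le tnorm_ge0 andbT.
  rewrite (le_trans (tnormB _ _)) // H2 // addr0.
  by rewrite (le_trans (tnormB _ _)) // !H2 // addr0.
apply: tnorm_pow2_eq0 => j.
by rewrite (tnorm_eqB (etaE j)).
Qed.
End Hyers.

Section ApproximateHomomorphisms.
Variables (R : realType) (X : zmodType) (C : set X) (H : X -> R).
Hypothesis C0 : C 0.
Hypothesis CB : forall x y, C x -> C y -> C (x - y).
Hypothesis HD : forall x y, C x -> C y -> tnorm (H (x + y) - H x - H y) = 0.

Let CN x : C x -> C (- x). Proof. by move=> Cx; rewrite -sub0r; exact: CB. Qed.
Let CD x y : C x -> C y -> C (x + y).
Proof. by move=> Cx Cy; rewrite -[y]opprK; apply: CB => //; exact: CN. Qed.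

Lemma tchar0 : tnorm (H 0) = 0.
Proof. by have := HD C0 C0; rewrite addr0 subrr sub0r tnormN. Qed.

Lemma tcharMn x n : C x -> C (x *+ n) /\ tnorm (H (x *+ n) - H x *+ n) = 0.
Proof.
move=> Cx; elim: n => [|n [IH1 IH2]]; first by rewrite !mulr0n subr0 tchar0.
have Cn : C (x *+ n.+1) by rewrite mulrS; exact: CD.
split=> //; rewrite [_ *+ n.+1 in X in tnorm (_ - X)]mulrS.
have -> : H (x *+ n.+1) - (H x + H x *+ n) =
  (H (x + x *+ n) - H x - H (x *+ n)) + (H (x *+ n) - H x *+ n).
  by rewrite (mulrS x); move: (H x *+ n) => w; ring.
by rewrite tnorm_intD // HD.
Qed.

Lemma tcharB x y : C x -> C y -> tnorm (H (x - y) - (H x - H y)) = 0.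
Proof.
move=> Cx Cy; have Cxy := CB Cx Cy; have := HD Cxy Cy; rewrite subrK => h.
rewrite -tnormN; move: h; congr (tnorm _ = _); ring.
Qed.

Lemma tcharD x y : C x -> C y -> tnorm (H (x + y) - (H x + H y)) = 0.
Proof. by move=> Cx Cy; have := HD Cx Cy; congr (tnorm _ = _); ring. Qed.
End ApproximateHomomorphisms.

(** * Neighbourhoods, limits and precompactness *)

Section Ultrafilters.

Lemma filterI_ex (T : Type) (F : set_system T) (A B : set T) :
  ProperFilter F -> F A -> F B -> exists x, A x /\ B x.
Proof. by move=> PF FA FB; exact: (filter_ex (filterI FA FB)). Qed.

Lemma ultra_dichotomy (T : Type) (F : set_system T) : ProperFilter F ->
  (forall A, F A \/ F (~` A)) -> UltraFilter F.
Proof.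
move=> PF h; split=> // G PG FG; rewrite eqEsubset; split=> // A GA.
have [//|FA] := h A.
have : G (A `&` ~` A) by apply: filterI => //; exact: FG.
by rewrite setICr => /filter_not_empty.
Qed.

Lemma ultra_fmap (T U : Type) (f : T -> U) (F : set_system T) :
  UltraFilter F -> UltraFilter (f @ F).
Proof.
move=> UF; apply: ultra_dichotomy => A.
by have := in_ultra_setVsetC (f @^-1` A) UF.
Qed.

(** Pattern of the compactness arguments below: sets of approximate solutions, or of
    counterexamples, form a filter base, and the limit along an ultrafilter containing them is an
    exact solution or gives the contradiction. *)
Lemma ultra_from_base (T : Type) (B : set (set T)) : B !=set0 ->
  (forall A1 A2, B A1 -> B A2 -> exists2 A, B A & A `<=` A1 `&` A2) ->
  (forall A, B A -> A !=set0) ->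
  exists F : set_system T, UltraFilter F /\ (forall A, B A -> F A).
Proof.
move=> [A0 BA0] BI Bne.
have PF : ProperFilter (filter_from B id).
  apply: filter_from_proper => //; apply: filter_from_filter; first by exists A0.
  exact: BI.
have [F [UF sF]] := ultraFilterLemma PF.
by exists F; split=> // A BA; apply: sF; exists A.
Qed.

Lemma ultra_seq_cover (T : Type) (I : eqType) (F : set_system T) (s : seq I)
    (A : I -> set T) : UltraFilter F ->
  F [set t | exists2 i, i \in s & A i t] -> exists2 i, i \in s & F (A i).
Proof.
move=> UF; elim: s => [|i s IH] /= h.
  exfalso; apply: (@filter_not_empty _ F).
  by apply: filterS h => t [j].
have [FA|FA] := in_ultra_setVsetC (A i) UF.
  by exists i => //; rewrite mem_head.
have [j sj Fj] : exists2 j, j \in s & F (A j).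
  apply: IH; apply: filterS2 FA h => t nA [j].
  by rewrite inE => /orP[/eqP->//|sj] Aj; exists j.
by exists j => //; rewrite inE sj orbT.
Qed.

End Ultrafilters.

Section Toolkit.
Variable K : topologicalZmodType.
Implicit Types (x y z : K) (U V W A B : set K).

(** The n-fold sumset of W. One symmetric W with [fold W n] inside V replaces a chain of
    successively halved neighbourhoods. *)
Fixpoint fold W (n : nat) : set K :=
  if n is m.+1 then [set x | exists y z, [/\ W y, fold W m z & x = y + z]]
  else [set 0].

Lemma fold1 W x : W x -> fold W 1 x.
Proof. by move=> Wx; exists x, 0; rewrite addr0. Qed.

Lemma foldD W m n x y : fold W m x -> fold W n y -> fold W (m + n) (x + y).
Proof.
elim: m x => [|m IH] x /=; first by move=> ->; rewrite add0r.
move=> [a [b [Wa fb ->]]] fy; exists a, (b + y); split=> //; first exact: IH.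
by rewrite addrA.
Qed.

Lemma foldN W n x : (forall x, W x -> W (- x)) -> fold W n x -> fold W n (- x).
Proof.
move=> WN; elim: n x => [|n IH] x /=; first by move=> ->; rewrite oppr0.
move=> [a [b [Wa fb ->]]]; exists (- a), (- b); split; rewrite ?opprD //.
  exact: WN.
exact: IH.
Qed.

Lemma foldB W m n x y : (forall x, W x -> W (- x)) ->
  fold W m x -> fold W n y -> fold W (m + n) (x - y).
Proof. by move=> WN fx fy; apply: foldD => //; exact: foldN. Qed.

Lemma fold_mono W m n x : W 0 -> (m <= n)%N -> fold W m x -> fold W n x.
Proof.
move=> W0 mn fx; rewrite -(subnK mn) -[x]add0r; apply: foldD => //.
by elim: (n - m)%N => // k IH; exists 0, 0; rewrite addr0.
Qed.

Lemma fold_sub W W' n : W `<=` W' -> fold W n `<=` fold W' n.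
Proof.
move=> h; elim: n => // n IH x [a [b [Wa fb ->]]].
by exists a, b; split=> //; [exact: h|exact: IH].
Qed.

Lemma foldMn W n x : W x -> fold W n (x *+ n).
Proof. by move=> Wx; elim: n => // n IH; exists x, (x *+ n); rewrite mulrS. Qed.

Lemma nb0 V : nbhs (0 : K) V -> V 0. Proof. exact: nbhs_singleton. Qed.

Lemma nbD V : nbhs (0 : K) V ->
  exists2 W, nbhs (0 : K) W & forall x y, W x -> W y -> V (x + y).
Proof.
move=> nV; have := @add_continuous K (0, 0).
move=> /(_ V); rewrite /= addr0 => /(_ nV) [[P Q] /= [nP nQ] PQ].
exists (P `&` Q); first exact: filterI.
by move=> x y [Px _] [_ Qy]; exact: (PQ (x, y)).
Qed.

Lemma nbN V : nbhs (0 : K) V -> nbhs (0 : K) [set x | V (- x)].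
Proof. by move=> nV; apply: (@opp_continuous K 0); rewrite oppr0. Qed.

Lemma nb_sym V : nbhs (0 : K) V ->
  exists W, [/\ nbhs (0 : K) W, W `<=` V & forall x, W x -> W (- x)].
Proof.
move=> nV; exists (V `&` [set x | V (- x)]); split.
- by apply: filterI => //; exact: nbN.
- by move=> x [].
- by move=> x [Vx Vnx]; split=> //=; rewrite opprK.
Qed.

Lemma nb_fold n V : nbhs (0 : K) V -> exists W, [/\ nbhs (0 : K) W, W 0,
  (forall x, W x -> W (- x)) & fold W n `<=` V].
Proof.
elim: n V => [|n IH] V nV.
  have [W [nW WV WN]] := nb_sym nV; exists W; split=> //; first exact: nb0.
  by move=> x /= ->; exact: nb0.
have [W' nW' W'V] := nbD nV; have [W [nW W0 WN fW]] := IH _ nW'.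
have [U [nU UW UN]] := nb_sym (filterI nW' nW).
exists U; split=> //; first exact: nb0.
move=> x [a [b [Ua fb ->]]]; apply: W'V; first by have [] := UW _ Ua.
by apply: fW; apply: fold_sub fb => y /UW[].
Qed.

Lemma nbMn n V : nbhs (0 : K) V -> nbhs (0 : K) [set x | V (x *+ n)].
Proof.
move=> nV; have [W [nW W0 WN fW]] := nb_fold n nV.
by apply: filterS nW => x Wx; apply: fW; exact: foldMn.
Qed.

Lemma nb_shift x A : nbhs x A <-> nbhs (0 : K) [set y | A (x + y)].
Proof.
have c (z : K) : continuous (fun y : K => z + y).
  move=> y; apply: (@continuous_comp K (K * K)%type K (fun y => (z, y))
    (fun z : K * K => z.1 + z.2)).
    by apply: cvg_pair; [exact: cvg_cst|exact: cvg_id].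
  exact: (@add_continuous K).
split=> h; first by have := c x 0; move=> /(_ A); rewrite addr0 => /(_ h).
have := c (- x) x; move=> /(_ [set y | A (x + y)]); rewrite addNr => /(_ h) h'.
have {}h' : nbhs x [set y | A (x + (- x + y))] := h'.
by apply: filterS h' => y /=; rewrite addrA subrr add0r.
Qed.

Lemma nb_shiftB x A : nbhs x A <-> exists2 V, nbhs (0 : K) V & forall y, V (y - x) -> A y.
Proof.
rewrite nb_shift; split=> [h|[V nV VA]].
  by exists [set y | A (x + y)] => // y /=; rewrite addrC subrK.
by apply: filterS nV => y Vy; apply: VA; rewrite addrAC subrr add0r.
Qed.

Lemma open_interiorP A : open A <-> forall x, A x -> exists2 V, nbhs (0 : K) V & forall y, V (y - x) -> A y.
Proof.
rewrite openE; split=> h x Ax; first by apply/nb_shiftB; exact: h.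
by apply/nb_shiftB; exact: h.
Qed.

Lemma closureP A x : closure A x <->
  forall V, nbhs (0 : K) V -> exists2 a, A a & V (a - x).
Proof.
split=> [cA V nV|h B].
  have [a [Aa Va]] : A `&` [set y | V (y - x)] !=set0.
    by apply: cA; apply/nb_shiftB; exists V.
  by exists a.
by move=> /nb_shiftB[V nV VB]; have [a Aa Va] := h V nV; exists a; split=> //; exact: VB.
Qed.

Lemma closureBP A x : closure A x <->
  forall V, nbhs (0 : K) V -> exists2 a, A a & V (x - a).
Proof.
rewrite closureP; split=> h V nV; have [a Aa Va] := h _ (nbN nV); exists a => //.
  by move: Va => /=; rewrite opprB.
by move: Va => /=; rewrite opprB.
Qed.

Definition tolim (T : Type) (F : set_system T) (f : T -> K) l :=
  forall V, nbhs (0 : K) V -> F [set t | V (f t - l)].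

Lemma tolimP (T : Type) (F : set_system T) (f : T -> K) l : Filter F ->
  f @ F --> l <-> tolim F f l.
Proof.
move=> FF; split=> [h V nV|h A].
  apply: (h [set y | V (y - l)]); by apply/nb_shiftB; exists V.
move=> /nb_shiftB[V nV VA]; have h' := h V nV.
by apply: (@filterS _ F FF _ _ _ h') => t Vt; exact: VA.
Qed.

Lemma tolim_closure (T : Type) (F : set_system T) (f : T -> K) l A :
  ProperFilter F -> F [set t | A (f t)] -> tolim F f l -> closure A l.
Proof.
move=> PF FA h; apply/closureP => V nV.
by have [t [/= At Vt]] := filterI_ex PF FA (h V nV); exists (f t).
Qed.

Lemma tolim_closed (T : Type) (F : set_system T) (f : T -> K) l A :
  ProperFilter F -> closed A -> F [set t | A (f t)] -> tolim F f l -> A l.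
Proof. by move=> PF cA FA h; apply: cA; exact: tolim_closure h. Qed.

Lemma tolimD (T : Type) (F : set_system T) (f g : T -> K) l m : Filter F ->
  tolim F f l -> tolim F g m -> tolim F (fun t => f t + g t) (l + m).
Proof.
move=> FF hf hg V nV; have [W nW WV] := nbD nV.
apply: filterS2 (hf W nW) (hg W nW) => t /= h1 h2.
have -> : f t + g t - (l + m) = (f t - l) + (g t - m) by zmod.
exact: WV.
Qed.

Lemma tolimN (T : Type) (F : set_system T) (f : T -> K) l : Filter F ->
  tolim F f l -> tolim F (fun t => - f t) (- l).
Proof.
move=> FF hf V nV; apply: filterS (hf _ (nbN nV)) => t /=.
by have -> : - (f t - l) = - f t - - l by zmod.
Qed.

Lemma tolimB (T : Type) (F : set_system T) (f g : T -> K) l m : Filter F ->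
  tolim F f l -> tolim F g m -> tolim F (fun t => f t - g t) (l - m).
Proof. by move=> FF hf hg; apply: tolimD => //; exact: tolimN. Qed.

Lemma tolimMn (T : Type) (F : set_system T) (f : T -> K) l n : Filter F ->
  tolim F f l -> tolim F (fun t => f t *+ n) (l *+ n).
Proof.
by move=> FF hf V nV; apply: filterS (hf _ (nbMn n nV)) => t /=; rewrite mulrnBl.
Qed.

Lemma tolim_cst (T : Type) (F : set_system T) l : Filter F ->
  tolim F (fun=> l) l.
Proof.
move=> FF V nV; rewrite subrr; apply: filterS filterT => t _ /=; exact: nb0.
Qed.

Lemma tolim_ext (T : Type) (F : set_system T) (f g : T -> K) l : Filter F ->
  F [set t | f t = g t] -> tolim F f l -> tolim F g l.
Proof. by move=> FF h hf V nV; apply: filterS2 h (hf V nV) => t /= ->. Qed.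

Hypothesis hK : hausdorff_space K.

Lemma nb_separate x : (forall V, nbhs (0 : K) V -> V x) -> x = 0.
Proof.
move=> h; apply: hK => A B nA nB; exists 0; split; last exact: nb0.
move: nA => /nb_shiftB[V nV VA]; apply: VA; rewrite sub0r.
by apply: (h [set x | V (- x)]); exact: nbN.
Qed.

Lemma nb_avoid x : x <> 0 -> exists2 V, nbhs (0 : K) V & ~ V x.
Proof.
move=> x0; apply: contrapT => h; apply: x0; apply: nb_separate => V nV.
by apply: contrapT => nVx; apply: h; exists V.
Qed.

Lemma tolim_unique (T : Type) (F : set_system T) (f : T -> K) l m :
  ProperFilter F -> tolim F f l -> tolim F f m -> l = m.
Proof.
move=> PF hl hm; apply/eqP; rewrite -subr_eq0; apply/eqP; apply: nb_separate.
move=> V nV; have [t /=] := filter_ex (tolimB _ hm hl nV).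
by have -> : f t - f t - (m - l) = l - m by zmod.
Qed.

Lemma compact_lim A (T : Type) (F : set_system T) (f : T -> K) : compact A ->
  UltraFilter F -> F [set t | A (f t)] -> exists2 l, A l & tolim F f l.
Proof.
move=> cA UF FA; move: cA; rewrite compact_ultra => /(_ (f @ F)).
move=> /(_ (ultra_fmap f UF) FA) [l [Al hl]]; exists l => //.
have PF : ProperFilter F by exact: ultra_proper.
exact: (tolimP f l _).1 hl.
Qed.

Lemma compactI_lim A : (forall F : set_system K, UltraFilter F -> F A ->
  exists2 l, A l & tolim F id l) -> compact A.
Proof.
move=> h; rewrite compact_ultra => F UF FA; have [l Al hl] := h F UF FA.
have PF : ProperFilter F by exact: ultra_proper.
by exists l; split=> //; exact: (tolimP id l _).2 hl.
Qed.

Definition pc V A := exists s : seq K, forall x, A x -> exists2 y, y \in s & V (x - y).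

Lemma pc_sub V V' A A' : V `<=` V' -> A' `<=` A -> pc V A -> pc V' A'.
Proof.
move=> sV sA [s h]; exists s => x Ax; have [y ys Vy] := h x (sA _ Ax).
by exists y => //; exact: sV.
Qed.

(* The cover can be centred in the covered set, at the price of doubling V. *)
Lemma pc_in V A : (forall x, V x -> V (- x)) -> pc V A ->
  exists s : seq K, (forall y, y \in s -> A y) /\
    forall x, A x -> exists2 y, y \in s & fold V 2 (x - y).
Proof.
move=> VN [s]; elim: s A => [|a s IH] A h.
  by exists [::]; split=> // x /h[].
have [s' [s'A hs']] := IH (A `&` [set x | exists2 y, y \in s & V (x - y)])
  (fun x (h : _ /\ _) => h.2).
have [[b [Ab Vb]]|nb] := pselect (exists b, A b /\ V (b - a)); last first.
  exists s'; split=> [y /s'A[]//|x Ax]; have [y] := h x Ax.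
  rewrite inE => /orP[/eqP->|ys] Vy; first by case: nb; exists x.
  by apply: hs'; split=> //; exists y.
exists (b :: s'); split=> [y|x Ax].
  by rewrite inE => /orP[/eqP->//|/s'A[]].
have [y] := h x Ax; rewrite inE => /orP[/eqP->|ys] Vy.
  exists b; first by rewrite inE eqxx.
  have -> : x - b = (x - a) - (b - a) by zmod.
  by apply: (@foldB _ 1 1) => //; exact: fold1.
have [z zs hz] : exists2 z, z \in s' & fold V 2 (x - z).
  by apply: hs'; split=> //; exists y.
by exists z => //; rewrite inE zs orbT.
Qed.

Lemma pc_compact V A : compact A -> nbhs (0 : K) V -> pc V A.
Proof.
move=> cA nV; apply: contrapT => npc.
have [|||F [UF hF]] := @ultra_from_base K [set B | exists s : seq K,
   B = A `&` [set x | forall y, y \in s -> ~ V (x - y)]].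
- by exists (A `&` [set x | forall y, y \in [::] -> ~ V (x - y)]); exists [::].
- move=> _ _ [s1 ->] [s2 ->].
  exists (A `&` [set x | forall y, y \in s1 ++ s2 -> ~ V (x - y)]); first by exists (s1 ++ s2).
  move=> x [Ax h]; split; split=> //= y ys; apply: h; rewrite mem_cat ys ?orbT //.
- move=> _ [s ->]; apply: contrapT => h; apply: npc; exists s => x Ax.
  apply: contrapT => h'; apply: h; exists x; split=> // y ys Vy; apply: h'.
  by exists y.
have FA : F A.
  have := hF _ (ex_intro _ [::] erefl); by apply: filterS => x [].
have [l Al hl] := @compact_lim A _ F id cA UF FA.
have h1 := hF _ (ex_intro _ [:: l] erefl).
have [x [[_ h] h']] := filterI_ex _ h1 (hl _ nV).
by apply: (h l) => //; rewrite inE.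
Qed.

Hypothesis cK : complete_group K.

(** An ultrafilter containing a set covered by finitely many translates of W contains the trace of
    one of them, so f is Cauchy along F; the precompact set may change with V. *)
Lemma complete_lim (T : Type) (F : set_system T) (f : T -> K) : UltraFilter F ->
  (forall V, nbhs (0 : K) V -> exists2 A, F [set t | A (f t)] & pc V A) ->
  exists l, tolim F f l.
Proof.
move=> UF h.
have PF : ProperFilter F by exact: ultra_proper.
have [|l hl] := cK (F := f @ F).
  move=> V nV; have [W [nW W0 WN fW]] := nb_fold 2 nV.
  have [A FA [s hs]] := h W nW.
  have [y ys Fy] : exists2 y, y \in s & F [set t | W (f t - y)].
    apply: ultra_seq_cover; apply: filterS FA => t /hs[y ys Wy]; by exists y.
  exists [set z | W (z - y)] => // a b Wa Wb; apply: fW.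
  have -> : a - b = (a - y) - (b - y) by zmod.
  by apply: (@foldB _ 1 1) => //; exact: fold1.
by exists l; exact: (tolimP f l _).1 hl.
Qed.

Lemma complete_compact A : closed A -> (forall V, nbhs (0 : K) V -> pc V A) ->
  compact A.
Proof.
move=> cA hA; apply: compactI_lim => F UF FA.
have [l hl] := @complete_lim _ F id UF (fun V nV => ex_intro2 _ _ A FA (hA V nV)).
by exists l => //; apply: tolim_closed hl.
Qed.

Lemma complete_seq (u : nat -> K) : (forall V, nbhs (0 : K) V -> exists n0 : nat,
   forall m n, (n0 <= m)%N -> (n0 <= n)%N -> V (u m - u n)) ->
  exists l, tolim \oo u l.
Proof.
move=> h.
have [|l hl] := cK (F := u @ \oo).
  move=> V nV; have [n0 hn0] := h V nV.
  exists [set x | exists2 n, (n0 <= n)%N & x = u n].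
    by exists n0 => // n /= n0n; exists n.
  by move=> x y [m mn ->] [n nn ->]; exact: hn0.
by exists l; exact: (tolimP u l _).1 hl.
Qed.

End Toolkit.

(** * Finite Fourier analysis *)

Section CircleCosine.
Variable R : realType.
Implicit Types (s t : R).

Definition cosT t : R := cos (t * (pi *+ 2)).
Definition sinT t : R := sin (t * (pi *+ 2)).

Lemma cosTD s t : cosT (s + t) = cosT s * cosT t - sinT s * sinT t.
Proof. by rewrite /cosT mulrDl cosD. Qed.
Lemma sinTD s t : sinT (s + t) = sinT s * cosT t + cosT s * sinT t.
Proof. by rewrite /sinT mulrDl sinD. Qed.
Lemma cosTN t : cosT (- t) = cosT t. Proof. by rewrite /cosT mulNr cosN. Qed.
Lemma sinTN t : sinT (- t) = - sinT t. Proof. by rewrite /sinT mulNr sinN. Qed.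
Lemma cosT0 : cosT 0 = 1. Proof. by rewrite /cosT mul0r cos0. Qed.
Lemma cosTsinT t : cosT t ^+ 2 + sinT t ^+ 2 = 1. Proof. exact: cos2Dsin2. Qed.

Lemma cosT_le1 t : cosT t <= 1.
Proof. exact: cos_le1. Qed.
Lemma cosT_abs t : `|cosT t| <= 1.
Proof. by rewrite ler_norml cosT_le1 cos_geN1. Qed.
Lemma sinT_abs t : `|sinT t| <= 1.
Proof. by rewrite ler_norml sin_le1 sin_geN1. Qed.

Lemma cosT_int t : t \is a Num.int -> cosT t = 1 /\ sinT t = 0.
Proof.
have h n : cosT n%:R = 1 /\ sinT n%:R = 0.
  have := periodicn (@cosD2pi R) n 0; have := periodicn (@sinD2pi R) n 0.
  by rewrite !add0r cos0 sin0 -(mulr_natl (pi *+ 2) n) /cosT /sinT.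
move=> /intrP[[n|n] ->]; first exact: h.
by rewrite NegzE intrN cosTN sinTN; have [-> ->] := h n.+1; rewrite oppr0.
Qed.

Lemma cosT_eq s t : tnorm (s - t) = 0 -> cosT s = cosT t.
Proof.
move=> /eqP; rewrite tnorm_eq0 => /cosT_int[h1 h2].
by rewrite -(subrK t s) cosTD h1 h2 mul1r mul0r subr0.
Qed.

Lemma sinT_eq s t : tnorm (s - t) = 0 -> sinT s = sinT t.
Proof.
move=> /eqP; rewrite tnorm_eq0 => /cosT_int[h1 h2].
by rewrite -(subrK t s) sinTD h1 h2 mul1r mul0r add0r.
Qed.

Lemma cosT_tnorm t : cosT t = cosT (tnorm t).
Proof.
have -> : cosT t = cosT (centered t).
  by apply: cosT_eq; apply/eqP; rewrite tnorm_eq0 centered_int.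
by rewrite /tnorm; case: (ger0P (centered t)) => // _; rewrite cosTN.
Qed.

Lemma cosT_near1 (k : R) : 0 < k ->
  exists2 eta, 0 < eta & forall t, tnorm t < eta -> 1 - cosT t < k.
Proof.
move=> k0; have c : continuous (cosT : R -> R).
  move=> x; apply: (@continuous_comp _ _ _ (fun t => t * (pi *+ 2)) cos).
    exact: mulrr_continuous.
  exact: continuous_cos.
have /cvgrPdist_lt/(_ _ k0) := c 0.
move=> /nbhs_ballP[e /= e0 he]; exists e => // t te.
rewrite cosT_tnorm; have : ball 0 e (tnorm t).
  by rewrite /ball /= sub0r normrN ger0_norm // tnorm_ge0.
move/he; rewrite cosT0 => /(le_lt_trans _); apply; exact: ler_norm.
Qed.

Lemma cosT_far (e : R) : 0 < e ->
  exists2 k, 0 < k & forall t, 1 - cosT t <= k -> tnorm t <= e.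
Proof.
move=> e0; have [e2|e2] := lerP 2^-1 e.
  by exists 1 => // t _; rewrite (le_trans (tnorm_le_half t)).
have p0 : 0 < pi :> R by exact: pi_gt0.
have itv x : 0 <= x <= 2^-1 -> x * (pi *+ 2) \in `[0, (pi : R)].
  move=> /andP[x0 x1]; rewrite in_itv /=; apply/andP; split.
    by rewrite mulr_ge0 // mulrn_wge0 // ltW.
  by rewrite mulrnAr -mulrnAl ger_pMl //; lra.
have ce : cosT e < 1.
  rewrite -cosT0 /cosT ltr_cos; last 2 first.
  - by apply: itv; lra.
  - by apply: itv; lra.
  by rewrite mul0r mulr_gt0 // mulrn_wgt0.
exists ((1 - cosT e) / 2); first by rewrite divr_gt0 // subr_gt0.
move=> t ht; rewrite leNgt; apply/negP => et.
have : cosT t < cosT e.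
  rewrite cosT_tnorm /cosT ltr_cos; last 2 first.
  - by apply: itv; lra.
  - by apply: itv; rewrite tnorm_ge0 tnorm_le_half.
  by rewrite ltr_pM2r // mulrn_wgt0.
lra.
Qed.

End CircleCosine.

Section FiniteFourier.
Variables (R : realType) (T : finZmodType) (phi : T -> T -> R).
Hypothesis phiD : forall xi a b, tnorm (phi xi (a + b) - (phi xi a + phi xi b)) = 0.
Hypothesis orth : forall c, \sum_xi cosT (phi xi c) = if c == 0 then #|T|%:R else 0.
Variable g : T -> R.
Hypothesis g01 : forall c, 0 <= g c <= 1.

Let n : R := #|T|%:R.
Let P xi := \sum_c g c * cosT (phi xi c).
Let Q xi := \sum_c g c * sinT (phi xi c).
(** P and Q are the real and imaginary parts of the unnormalised Fourier coefficient of g at xi, so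
    this is its squared modulus. By [powerE] it is the Fourier transform of the autocorrelation
    [autocor]. *)
Definition power xi : R := P xi ^+ 2 + Q xi ^+ 2.
Definition autocor d : R := \sum_c g c * g (c + d).
Local Notation A := power.
Local Notation h := autocor.

Let cphiD xi a b : cosT (phi xi (a + b)) =
  cosT (phi xi a) * cosT (phi xi b) - sinT (phi xi a) * sinT (phi xi b).
Proof. by rewrite -cosTD; apply: cosT_eq. Qed.
Let sphiD xi a b : sinT (phi xi (a + b)) =
  sinT (phi xi a) * cosT (phi xi b) + cosT (phi xi a) * sinT (phi xi b).
Proof. by rewrite -sinTD; apply: sinT_eq. Qed.
Let phi0 xi : tnorm (phi xi 0) = 0.
Proof.
have := phiD xi 0 0; rewrite addr0 -tnormN => h0.
by rewrite -[RHS]h0; congr tnorm; ring.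
Qed.
Let cphi0 xi : cosT (phi xi 0) = 1.
Proof. by rewrite -(@cosT0 R); apply: cosT_eq; rewrite subr0 phi0. Qed.
Let phiN xi a : tnorm (phi xi (- a) - - phi xi a) = 0.
Proof.
have := phiD xi a (- a); rewrite subrr => h0.
have -> : phi xi (- a) - - phi xi a =
  phi xi 0 + - (phi xi 0 - (phi xi a + phi xi (- a))) by ring.
by rewrite tnorm_intD // tnormN.
Qed.
Let cphiB xi a b : cosT (phi xi (a - b)) =
  cosT (phi xi a) * cosT (phi xi b) + sinT (phi xi a) * sinT (phi xi b).
Proof. by rewrite cphiD (cosT_eq (phiN _ _)) (sinT_eq (phiN _ _)) cosTN sinTN; ring. Qed.
Let sphiB xi a b : sinT (phi xi (a - b)) =
  sinT (phi xi a) * cosT (phi xi b) - cosT (phi xi a) * sinT (phi xi b).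
Proof. by rewrite sphiD (cosT_eq (phiN _ _)) (sinT_eq (phiN _ _)) cosTN sinTN; ring. Qed.

Let sum_shift (F : T -> R) a : \sum_c F (c + a) = \sum_c F c.
Proof. by rewrite [RHS](reindex_inj (addIr a)). Qed.

Let autocor_sum (F : T -> R) :
  \sum_d h d * F d = \sum_s \sum_t g s * g t * F (t - s).
Proof.
under eq_bigr do rewrite mulr_suml; rewrite exchange_big /=.
apply: eq_bigr => s _; rewrite -[RHS](sum_shift _ s); apply: eq_bigr => d _.
by rewrite addrK [d + s]addrC.
Qed.

Lemma powerE xi : A xi = \sum_d h d * cosT (phi xi d).
Proof.
rewrite autocor_sum /A !expr2 /P /Q !mulr_suml -big_split /=.
apply: eq_bigr => s _; rewrite !mulr_sumr -big_split /=.
by apply: eq_bigr => t _; rewrite cphiB; ring.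
Qed.

Lemma autocor_sin xi : \sum_d h d * sinT (phi xi d) = 0.
Proof.
rewrite autocor_sum; transitivity (P xi * Q xi - Q xi * P xi); last by ring.
rewrite /P /Q !mulr_suml -sumrB.
apply: eq_bigr => s _; rewrite !mulr_sumr -sumrB /=.
by apply: eq_bigr => t _; rewrite sphiB; ring.
Qed.

Lemma sum_power : \sum_xi A xi = n * h 0.
Proof.
under eq_bigr do rewrite powerE; rewrite exchange_big /=.
under eq_bigr do rewrite -mulr_sumr orth.
rewrite (bigD1 0) //= eqxx big1 ?addr0 1?mulrC // => d /negbTE ->.
by rewrite mulr0.
Qed.

Lemma power_sq xi y : A xi ^+ 2 * cosT (phi xi y) =
  \sum_d \sum_e h d * h e * cosT (phi xi (d + y - e)).
Proof.
have hs := autocor_sin xi.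
have -> : A xi ^+ 2 * cosT (phi xi y) =
   (\sum_d h d * cosT (phi xi (d + y))) * A xi
   + (\sum_d h d * sinT (phi xi (d + y))) * (\sum_d h d * sinT (phi xi d)).
  rewrite hs mulr0 addr0.
  under eq_bigr do rewrite cphiD mulrBr !mulrA.
  by rewrite sumrB -!mulr_suml -powerE hs; ring.
rewrite powerE !mulr_suml -big_split /=; apply: eq_bigr => d _.
rewrite !mulr_sumr -big_split /=; apply: eq_bigr => e _.
by rewrite cphiB; ring.
Qed.

(** Parseval's identity for the autocorrelation and its translate by y. *)
Lemma sum_power_sq y : \sum_xi A xi ^+ 2 * cosT (phi xi y) =
  n * \sum_d h d * h (d + y).
Proof.
under eq_bigr do rewrite power_sq; rewrite exchange_big /= [RHS]mulr_sumr.
apply: eq_bigr => d _; rewrite exchange_big /=.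
rewrite (bigD1 (d + y)) //= [X in _ + X]big1 => [|e /negbTE ne].
  by rewrite addr0 -mulr_sumr orth subrr eqxx mulrC.
by rewrite -mulr_sumr orth subr_eq0 eq_sym ne mulr0.
Qed.

(** Translating g by s multiplies its Fourier coefficient by a number of modulus 1, whose squared
    distance to 1 is 2 (1 - cos). The real and imaginary parts E1 and E2 of the coefficient of the
    difference are each at most n dl. *)
Lemma power_shift xi s (dl : R) : (forall t, `|g (t - s) - g t| <= dl) ->
  (1 - cosT (phi xi s)) * A xi <= n ^+ 2 * dl ^+ 2.
Proof.
move=> hdl.
pose E1 := \sum_t (g (t - s) - g t) * cosT (phi xi t).
pose E2 := \sum_t (g (t - s) - g t) * sinT (phi xi t).
have b1 : `|E1| <= n * dl.
  rewrite (le_trans (ler_norm_sum _ _ _)) // /n mulr_natl -sumr_const ler_sum // => t _.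
  by rewrite normrM -[leRHS]mulr1 ler_pM ?normr_ge0 ?cosT_abs.
have b2 : `|E2| <= n * dl.
  rewrite (le_trans (ler_norm_sum _ _ _)) // /n mulr_natl -sumr_const ler_sum // => t _.
  by rewrite normrM -[leRHS]mulr1 ler_pM ?normr_ge0 ?sinT_abs.
have e1 : E1 = (cosT (phi xi s) - 1) * P xi - sinT (phi xi s) * Q xi.
  rewrite /E1; under eq_bigr do rewrite mulrBl.
  rewrite sumrB -(sum_shift (fun t => g (t - s) * _) s).
  rewrite /P /Q !mulr_sumr -!sumrB; apply: eq_bigr => t _.
  by rewrite addrK cphiD; ring.
have e2 : E2 = (cosT (phi xi s) - 1) * Q xi + sinT (phi xi s) * P xi.
  rewrite /E2; under eq_bigr do rewrite mulrBl.
  rewrite sumrB -(sum_shift (fun t => g (t - s) * _) s).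
  rewrite /P /Q !mulr_sumr -!sumrB -big_split /=; apply: eq_bigr => t _.
  by rewrite addrK sphiD; ring.
have e3 : E1 ^+ 2 + E2 ^+ 2 = 2 * ((1 - cosT (phi xi s)) * A xi).
  rewrite e1 e2 /A; have := cosTsinT (phi xi s).
  move: (cosT _) (sinT _) (P xi) (Q xi) => c si p q hc.
  transitivity (((c - 1) ^+ 2 + si ^+ 2) * (p ^+ 2 + q ^+ 2)); first by ring.
  have -> : (c - 1) ^+ 2 + si ^+ 2 = (c ^+ 2 + si ^+ 2) + 1 - 2 * c by ring.
  by rewrite hc; ring.
have sq z : `|z| <= n * dl -> z ^+ 2 <= n ^+ 2 * dl ^+ 2.
  by move=> hz; rewrite -exprMn -real_normK ?num_real // lerXn2r ?nnegrE ?(le_trans _ hz).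
have := sq _ b1; have := sq _ b2; lra.
Qed.

Lemma sum_autocor : \sum_d h d = (\sum_c g c) ^+ 2.
Proof.
have := autocor_sum (fun=> 1); under eq_bigr do rewrite mulr1.
move=> ->; rewrite expr2 mulr_suml; apply: eq_bigr => s _.
by rewrite mulr_sumr; apply: eq_bigr => t _; rewrite mulr1.
Qed.

Lemma autocor_ge0 d : 0 <= h d.
Proof.
apply: sumr_ge0 => c _; rewrite mulr_ge0 //.
  by have /andP[] := g01 c.
by have /andP[] := g01 (c + d).
Qed.

Let n_gt0 : 0 < n.
Proof. by rewrite ltr0n; apply/card_gt0P; exists 0. Qed.

Lemma autocor_CS : (\sum_d h d) ^+ 2 <= n * \sum_d h d ^+ 2.
Proof.
set S := \sum_d h d; have : 0 <= \sum_d (n * h d - S) ^+ 2.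
  by apply: sumr_ge0 => d _; exact: sqr_ge0.
have -> : \sum_d (n * h d - S) ^+ 2 = n * (n * \sum_d h d ^+ 2 - S ^+ 2).
  have e d : (n * h d - S) ^+ 2 = n ^+ 2 * h d ^+ 2 - 2 * n * S * h d + S ^+ 2 by ring.
  under eq_bigr do rewrite e.
  rewrite big_split sumrB -!mulr_sumr /= sumr_const -/S -mulr_natl -/n.
  by rewrite [X in _ = n * (X - _)]mulr_sumr; rewrite -mulr_sumr; ring.
by rewrite pmulr_rge0 // subr_ge0.
Qed.

(** By the last hypothesis the sum of A^2 cos vanishes, so the sum of A^2 (1 - cos) is that of A^2,
    which is n times the sum of h^2 and at least (n / k)^4 by Cauchy-Schwarz. With b = k^-4 / 4, if
    no xi had both A >= b n^2 and 1 - cos >= b, every term would be at most 2 b n^2 A, and the sum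
    of A being at most n^2 the total would be at most half of that. *)
Lemma large_power (k : R) y : 0 < k -> n <= k * \sum_c g c ->
  (forall d, h d * h (d + y) = 0) ->
  exists xi, (k ^- 4 / 4) * n ^+ 2 <= A xi /\ k ^- 4 / 4 <= 1 - cosT (phi xi y).
Proof.
move=> k0 hk hy; apply: contrapT => /forallNP nex; set b := k ^- 4 / 4 in nex.
have b0 : 0 < b by rewrite divr_gt0 // invr_gt0 exprn_gt0.
have A0 xi : 0 <= A xi by rewrite addr_ge0 // sqr_ge0.
have sg : \sum_c g c <= n.
  by rewrite /n -[leRHS]mulr_natl mulr1 -sumr_const ler_sum // => c _; have /andP[] := g01 c.
have sg0 : 0 <= \sum_c g c by apply: sumr_ge0 => c _; have /andP[] := g01 c.
have An xi : A xi <= n ^+ 2.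
  rewrite powerE (le_trans (_ : _ <= \sum_d h d)) //.
    by apply: ler_sum => d _; rewrite -[leRHS]mulr1 ler_wpM2l ?autocor_ge0 ?cosT_le1.
  by rewrite sum_autocor lerXn2r ?nnegrE // ltW.
have h0 : h 0 <= n.
  rewrite (le_trans _ sg) // ler_sum // => c _; have /andP[g0 g1] := g01 c.
  by rewrite addr0 -[leRHS]mulr1 ler_wpM2l.
have e1 : \sum_xi A xi ^+ 2 * (1 - cosT (phi xi y)) = n * \sum_d h d ^+ 2.
  under eq_bigr do rewrite mulrBr mulr1.
  rewrite sumrB sum_power_sq [X in _ - n * X]big1 // mulr0 subr0.
  have := sum_power_sq 0; under eq_bigr do rewrite cphi0 mulr1.
  by move=> ->; congr (_ * _); apply: eq_bigr => d _; rewrite addr0 expr2.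
have e2 : n * \sum_d h d ^+ 2 <= (2 * b * n ^+ 2) * (n * n).
  rewrite -e1 (le_trans (_ : _ <= \sum_xi A xi * (2 * b * n ^+ 2))) //.
    apply: ler_sum => xi _; rewrite expr2 -mulrA ler_wpM2l //.
    have c1 := cosT_le1 (phi xi y); have := cosT_abs (phi xi y).
    rewrite ler_norml => /andP[c2 _].
    have [bA|Ab] := lerP (b * n ^+ 2) (A xi).
      have bc : 1 - cosT (phi xi y) < b.
        by rewrite ltNge; apply/negP => hb; exact: (nex xi).
      rewrite (le_trans (_ : _ <= n ^+ 2 * b)) //.
        by rewrite ler_pM // ?subr_ge0 // ltW.
      have : 0 <= b * n ^+ 2 by rewrite mulr_ge0 ?exprn_ge0 // ltW.
      lra.
    have : A xi * (1 - cosT (phi xi y)) <= (b * n ^+ 2) * 2.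
      by rewrite ler_pM // ?subr_ge0 //; [exact: ltW|lra].
    lra.
  rewrite -mulr_suml sum_power mulrC ler_wpM2l //; last by rewrite ler_wpM2l // ltW.
  apply: mulr_ge0; last exact: (exprn_ge0 _ (ltW n_gt0)).
  by apply: mulr_ge0 => //; exact: (ltW b0).
have e3 : n ^+ 4 * k ^- 4 <= n * \sum_d h d ^+ 2.
  rewrite (le_trans _ autocor_CS) // sum_autocor -exprM ler_pdivrMr ?exprn_gt0 //.
  rewrite -[(2 * 2)%N]/4%N -exprMn (mulrC _ k) lerXn2r // nnegrE.
    exact: (ltW n_gt0).
  by apply: mulr_ge0 => //; exact: ltW.
have kb : k ^- 4 = 4 * b by rewrite /b; lra.
have : 0 < b * n ^+ 4 by rewrite mulr_gt0 ?exprn_gt0.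
have := le_trans e3 e2; rewrite kb.
have -> : n ^+ 4 * (4 * b) = 4 * (b * n ^+ 4) by ring.
have -> : 2 * b * n ^+ 2 * (n * n) = 2 * (b * n ^+ 4) by ring.
lra.
Qed.

End FiniteFourier.

(** * Characters of precompact groups *)

Section Subgroup.
Variables (X : zmodType) (C : set X).
Hypothesis sC : subgroup C.

Lemma subgroup0 : C 0. Proof. by case: sC. Qed.
Lemma subgroupB x y : C x -> C y -> C (x - y). Proof. by case: sC => _; exact. Qed.
Lemma subgroupN x : C x -> C (- x).
Proof. by move=> Cx; rewrite -sub0r; apply: subgroupB => //; exact: subgroup0. Qed.
Lemma subgroupD x y : C x -> C y -> C (x + y).
Proof. by move=> Cx Cy; rewrite -[y]opprK; apply: subgroupB => //; exact: subgroupN. Qed.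
Lemma subgroupMn x n : C x -> C (x *+ n).
Proof.
move=> Cx; elim: n => [|n IH]; first exact: subgroup0.
by rewrite mulrS; exact: subgroupD.
Qed.
Lemma subgroupMz x (n : int) : C x -> C (x *~ n).
Proof.
move=> Cx; case: n => n; first exact: subgroupMn.
by rewrite NegzE mulrNz; apply: subgroupN; exact: subgroupMn.
Qed.
Lemma subgroup_sum (I : Type) (r : seq I) (P : pred I) (F : I -> X) :
  (forall i, C (F i)) -> C (\sum_(i <- r | P i) F i).
Proof.
move=> CF; apply: (big_ind C) => //; first exact: subgroup0.
by move=> x y; exact: subgroupD.
Qed.
End Subgroup.

(** * Characters of the finite groups (Z/N)^k *)

Section Phase.
Variables (R : realType) (n k : nat).
Local Notation T := 'rV['I_n.+2]_k.
Local Notation N := n.+2.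

(** The pairing that identifies (Z/N)^k with its dual, lifted to the reals through the
    representatives in 0, ..., N - 1. *)
Definition phase (xi c : T) : R := (\sum_i (xi ord0 i * c ord0 i)%N)%:R / N%:R.

Lemma phaseC xi c : phase xi c = phase c xi.
Proof. by rewrite /phase; congr (_%:R / _); apply: eq_bigr => i _; rewrite mulnC. Qed.

Lemma phaseD xi a b : tnorm (phase xi (a + b) - (phase xi a + phase xi b)) = 0.
Proof.
apply/eqP; rewrite tnorm_eq0.
pose q := (\sum_i (xi ord0 i * ((a ord0 i + b ord0 i) %/ N))%N)%N.
have e : (\sum_i (xi ord0 i * a ord0 i) + \sum_i (xi ord0 i * b ord0 i) =
   \sum_i (xi ord0 i * (a + b)%R ord0 i) + N * q)%N.
  rewrite /q big_distrr /= -!big_split /=; apply: eq_bigr => i _.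
  rewrite mxE -mulnDr {1}(divn_eq (a ord0 i + b ord0 i)%N N) mulnDr addnC /=.
  by congr (_ + _)%N; rewrite mulnA mulnC.
have -> : phase xi (a + b) - (phase xi a + phase xi b) = - q%:R.
  rewrite /phase -mulrDl -natrD e natrD natrM mulrDl.
  rewrite [N%:R * _]mulrC mulfK ?pnatr_eq0 //; ring.
by rewrite rpredN natr_int.
Qed.

Lemma phaseB xi a b : tnorm (phase xi (a - b) - (phase xi a - phase xi b)) = 0.
Proof.
have := phaseD xi (a - b) b; rewrite subrK -tnormN => h.
by rewrite -[RHS]h; congr tnorm; ring.
Qed.

Lemma phase_orth c : \sum_xi cosT (phase xi c) = if c == 0 then #|{: T}|%:R else 0.
Proof.
case: eqP => [->|/eqP c0].
  under eq_bigr => xi _.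
    rewrite (_ : phase xi 0 = 0) ?cosT0; first over.
    by rewrite /phase big1 ?mul0r // => i _; rewrite mxE muln0.
  by rewrite sumr_const.
have [i ci] : exists i, c ord0 i != 0.
  apply: contrapT => /forallNP h; case/negP: c0; apply/eqP/rowP => i.
  by rewrite mxE; apply/eqP; apply: contrapT => /negP; exact: h.
(* Translating xi by the unit vector d turns every phase by th = c_i / N, which is not an integer.
   The sum is thus invariant under a nontrivial rotation and vanishes. *)
pose d : T := \row_j (if j == i then 1 else 0).
pose th : R := phase d c.
have eth : th = (c ord0 i)%:R / N%:R.
  rewrite /th /phase (bigD1 i) //= mxE eqxx mul1n big1 ?addn0 // => j /negbTE ji.
  by rewrite mxE ji.
have th1 : cosT th != 1.
  apply/eqP => h; have : tnorm th = 0.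
    apply/eqP; rewrite eq_le tnorm_ge0 andbT; apply/ler_addgt0Pl => e e0.
    by have [k' k0 hk] := cosT_far e0; rewrite addr0; apply: hk; rewrite h subrr ltW.
  move/eqP; rewrite tnorm_eq0 => /intrP[z hz].
  have l1 : 0 < th.
    rewrite eth divr_gt0 ?ltr0n // lt0n; apply: contra ci => /eqP h0.
    by apply/eqP/val_inj.
  have l2 : th < 1 by rewrite eth ltr_pdivrMr ?ltr0n // mul1r ltr_nat ltn_ord.
  move: l1 l2; rewrite hz -[0]/(0%:~R) -[1]/(1%:~R) !ltr_int; lia.
pose S := \sum_xi cosT (phase xi c); pose S' := \sum_xi sinT (phase xi c).
have hc xi : cosT (phase (xi + d) c) = cosT (phase xi c) * cosT th - sinT (phase xi c) * sinT th.
  by rewrite -cosTD; apply: cosT_eq; rewrite ![phase _ c]phaseC /th [phase d c]phaseC phaseD.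
have hs xi : sinT (phase (xi + d) c) = sinT (phase xi c) * cosT th + cosT (phase xi c) * sinT th.
  by rewrite -sinTD; apply: sinT_eq; rewrite ![phase _ c]phaseC /th [phase d c]phaseC phaseD.
have e1 : S = S * cosT th - S' * sinT th.
  rewrite {1}/S (reindex_inj (addIr d)) /=; under eq_bigr do rewrite hc.
  by rewrite sumrB -!mulr_suml.
have e2 : S' = S' * cosT th + S * sinT th.
  rewrite {1}/S' (reindex_inj (addIr d)) /=; under eq_bigr do rewrite hs.
  by rewrite big_split /= -!mulr_suml.
rewrite -/S; have := cosTsinT th; move: th1 e1 e2.
move: (cosT th) (sinT th) S S' => co si s s' co1 e1 e2 h.
have : 2 * (1 - co) * s = 0.
  have -> : 2 * (1 - co) * s = ((1 - co) ^+ 2 + si ^+ 2) * s.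
    have -> : (1 - co) ^+ 2 + si ^+ 2 = (co ^+ 2 + si ^+ 2) + 1 - 2 * co by ring.
    by rewrite h; ring.
  have -> : ((1 - co) ^+ 2 + si ^+ 2) * s =
     (1 - co) * (s - (s * co - s' * si)) - si * (s' - (s' * co + s * si)) by ring.
  by rewrite -e1 -e2 !subrr !mulr0 subrr.
move/eqP; rewrite !mulf_eq0 pnatr_eq0 /= subr_eq0 => /orP[/eqP h1|/eqP//].
by case/eqP: co1.
Qed.

End Phase.

Section PeterWeyl.
Variables (R : realType) (K : topologicalZmodType).
Variable C : set K.
Hypothesis sC : subgroup C.

Lemma fold_sum (W : set K) (I : Type) (r : seq I) (F : I -> K) :
  (forall i, W (F i)) -> fold W (size r) (\sum_(i <- r) F i).
Proof.
move=> WF; elim: r => [|i r IH]; first by rewrite big_nil.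
by rewrite big_cons /=; exists (F i), (\sum_(j <- r) F j).
Qed.

(** If the multiples of x by 1, 2, 4, ..., 2^n all lie in U, no doubling of H x wraps around the
    circle, so 2^n times [tnorm (H x)] is still at most 1/4. *)
Lemma tchar_continuous (H : K -> R) U :
  (forall x y, C x -> C y -> tnorm (H (x + y) - H x - H y) = 0) ->
  nbhs (0 : K) U -> (forall x, C x -> U x -> tnorm (H x) <= 4^-1) ->
  forall e : R, 0 < e ->
    exists2 V, nbhs (0 : K) V & forall x, C x -> V x -> tnorm (H x) <= e.
Proof.
move=> HD nU HU e e0; pose n := (Num.truncn e^-1).+1.
have [W [nW W0 WN fW]] := nb_fold (2 ^ n) nU.
exists W => // x Cx Wx.
have h j : (j <= n)%N -> tnorm (H x *+ 2 ^ j) <= 4^-1.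
  move=> jn; have [Cj] := tcharMn (subgroup0 sC) (subgroupB sC) HD (2 ^ j) Cx.
  rewrite tnormC => /tnorm_eqB ->; apply: HU => //; apply: fW.
  by apply: (fold_mono W0 _ (foldMn (2 ^ j) Wx)); rewrite leq_exp2l.
have e1 : tnorm (H x) *+ 2 ^ n <= 4^-1.
  by rewrite -tnorm_pow2; [exact: h|move=> j jn; apply: h; exact: ltnW].
have e2 : e^-1 < n%:R by exact: truncnS_gt.
have e3 : tnorm (H x) *+ n <= 4^-1.
  by rewrite (le_trans _ e1) // ler_wpMn2l ?tnorm_ge0 // ltnW // ltn_expl.
have n0 : 0 < n%:R :> R by rewrite ltr0n.
have e4 : 1 < e * n%:R by rewrite mulrC -ltr_pdivrMr // mul1r.
rewrite -(ler_pM2r n0) mulr_natr; lra.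
Qed.

Hypothesis pC : forall V, nbhs (0 : K) V -> pc V C.

(** Pigeonhole on the cells containing the multiples m s, for all s in S simultaneously. The
    difference m2 - m1 is doubled so that the resulting modulus is at least 2. *)
Lemma recurrence (S : seq K) W : (forall s, s \in S -> C s) -> nbhs (0 : K) W ->
  exists N : nat, forall s, s \in S -> W (s *+ N.+2).
Proof.
move=> SC nW; have [W' [nW' W'0 W'N fW]] := nb_fold 4 nW.
have [s0 hs0] := pC nW'.
have /choice[f hf] : forall mi : nat * 'I_(size S), exists j : 'I_(size s0),
    W' (S`_mi.2 *+ mi.1 - s0`_j).
  move=> [m i] /=; have [y ys Wy] := hs0 (S`_i *+ m)
    (subgroupMn sC _ (SC _ (mem_nth _ (ltn_ord i)))).
  have ly : (index y s0 < size s0)%N by rewrite index_mem.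
  by exists (Ordinal ly); rewrite /= nth_index.
have [m1 [m2 [lt12 e12]]] : exists m1 m2 : nat,
    (m1 < m2)%N /\ forall i, f (m1, i) = f (m2, i).
  pose E : finType := {ffun 'I_(size S) -> 'I_(size s0)}.
  pose F (m : 'I_(#|E|.+1)) : E := [ffun i => f (nat_of_ord m, i)].
  apply: contrapT => h; have : (#|'I_(#|E|.+1)| <= #|E|)%N.
    apply: (@leq_card _ _ F) => a b Fab; apply: contrapT => ab.
    have e i : f (nat_of_ord a, i) = f (nat_of_ord b, i).
      by have := congr1 (fun g : {ffun _ -> _} => g i) Fab; rewrite !ffunE.
    have [l|l|/val_inj//] := ltngtP a b; apply: h.
      by exists (nat_of_ord a), (nat_of_ord b).
    by exists (nat_of_ord b), (nat_of_ord a); split=> // i; rewrite e.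
  by rewrite card_ord ltnn.
have h i : (i < size S)%N -> fold W' 2 (S`_i *+ (m2 - m1)).
  move=> li; have -> : S`_i *+ (m2 - m1) = (S`_i *+ m2 - s0`_(f (m2, Ordinal li)))
     - (S`_i *+ m1 - s0`_(f (m1, Ordinal li))).
    by rewrite e12 (mulrnBr _ (ltnW lt12)); zmod.
  by apply: (@foldB _ _ 1 1) => //; apply: fold1;
    [exact: (hf (m2, Ordinal li))|exact: (hf (m1, Ordinal li))].
exists ((m2 - m1) * 2 - 2)%N => s /(nthP 0)[i li <-]; apply: fW.
have -> : (((m2 - m1) * 2 - 2).+2 = (m2 - m1) * 2)%N by lia.
rewrite mulrnA mulr2n; apply: (@foldD _ _ 2 2); exact: h.
Qed.

Hypothesis hK : hausdorff_space K.

(** * Approximation of a precompact group by a finite one *)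

Section Approximation.
Variables (S : seq K) (n : nat) (U : set K).
Local Notation k := (size S).
Local Notation T := 'rV['I_n.+2]_k.
Hypothesis U0 : U 0.
Hypothesis UN : forall x, U x -> U (- x).
Variable W : set K.
Hypothesis W0 : W 0.
Hypothesis fW : fold W k `<=` U.
Hypothesis SW : forall s, s \in S -> W (s *+ n.+2).

(** Additive up to U, by [approxD]: a carry in coordinate i costs the n.+2-fold multiple of the i-th
    point of S, which is in W. *)
Definition approx (c : T) : K := \sum_(i < k) S`_i *+ c ord0 i.

Lemma approxD a b : U (approx a + approx b - approx (a + b)).
Proof.
rewrite /approx -big_split -sumrB /=; apply: fW.
have ek : size (index_enum 'I_k) = k.
  by rewrite [index_enum _]unlock -enumT size_enum_ord.
rewrite -[X in fold W X]ek.
apply: fold_sum => i; rewrite mxE -mulrnDr /=.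
set x := (a ord0 i + b ord0 i)%N; have lx : (x %/ n.+2 <= 1)%N.
  rewrite -ltnS ltn_divLR // /x.
  by have := ltn_ord (a ord0 i); have := ltn_ord (b ord0 i); lia.
rewrite {1}(divn_eq x n.+2) mulrnDr addrK mulnC mulrnA.
case: (x %/ _)%N lx => [|[|//]] _; first by rewrite mulr0n.
by rewrite mulr1n; apply: SW; exact: mem_nth.
Qed.

Definition basis (i : 'I_k) : T := \row_j (if j == i then 1 else 0).

Lemma approx_basis i : approx (basis i) = S`_i.
Proof.
rewrite /approx (bigD1 i) //= mxE eqxx mulr1n big1 ?addr0 // => j /negbTE ji.
by rewrite mxE ji mulr0n.
Qed.

Lemma approxB a b : U (approx a - approx b - approx (a - b)).
Proof.
have := approxD (a - b) b; rewrite subrK => /UN.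
by congr U; zmod.
Qed.

Variables (V0 : set K) (J : nat).
Hypothesis J0 : (0 < J)%N.

(** [bump] averages the indicators of the layers V0, V0 + U, ..., V0 + (J - 1) U: it is 1 on V0, 0
    off V0 + J U, and moving the argument by q elements of U changes it by at most q / J. *)
Definition layer j (x : K) := exists v u, [/\ V0 v, fold U j u & x = v + u].
Definition bump (x : K) : R := (\sum_(j < J) (`[< layer j x >] : nat))%N%:R / J%:R.

Lemma bump01 x : 0 <= bump x <= 1.
Proof.
rewrite /bump divr_ge0 //= ler_pdivrMr ?ltr0n // mul1r ler_nat.
rewrite (leq_trans (_ : _ <= \sum_(j < J) 1)%N) //; last by rewrite sum1_card card_ord.
by apply: leq_sum => j _; exact: leq_b1.
Qed.

Lemma bump_in x : V0 x -> bump x = 1.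
Proof.
move=> Vx; rewrite /bump (eq_bigr (fun=> 1%N)).
  by rewrite sum1_card card_ord divff // pnatr_eq0 -lt0n.
move=> j _; rewrite asboolT //; exists x, 0; rewrite addr0; split=> //.
by apply: (@fold_mono _ _ 0) => //; exact: leq0n.
Qed.

Lemma bump_out x : bump x != 0 -> exists2 v, V0 v & fold U J (x - v).
Proof.
move=> h; apply: contrapT => nex; case/negP: h; apply/eqP.
rewrite /bump big1 ?mul0r // => j _; rewrite asboolF // => -[v [u [Vv fu e]]].
apply: nex; exists v => //; rewrite e addrAC subrr add0r.
by apply: fold_mono fu => //; exact: ltnW.
Qed.

Lemma bump_lip_nat q x x' : fold U q (x' - x) ->
  (\sum_(j < J) (`[< layer j x >] : nat) <= \sum_(j < J) (`[< layer j x' >] : nat) + q)%N.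
Proof.
move=> f; pose F j := (`[< layer j x' >] : nat).
rewrite (leq_trans (_ : _ <= \sum_(j < J) F (j + q))%N) //.
  apply: leq_sum => j _; rewrite /F; case: asboolP => // -[v [u [Vv fu e]]].
  rewrite asboolT //; exists v, (u + (x' - x)); split=> //; first exact: foldD.
  by rewrite e; zmod.
have -> : (\sum_(j < J) F (j + q) = \sum_(q <= j < J + q) F j)%N.
  by rewrite -{2}[q]add0n big_addn addnK big_mkord.
have -> : (\sum_(j < J) (`[< layer j x' >] : nat) = \sum_(0 <= j < J) F j)%N.
  by rewrite big_mkord.
rewrite (leq_trans (_ : _ <= \sum_(0 <= j < J + q) F j)%N) //.
  by rewrite [leqRHS](@big_cat_nat _ _ _ q) //= ?leq_addl // leq_addl.
rewrite [leqLHS](@big_cat_nat _ _ _ J) //= ?leq_addr // leq_add2l.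
rewrite (leq_trans (_ : _ <= \sum_(J <= j < J + q) 1)%N) //; last by rewrite sum_nat_const_nat muln1 addnC addnK.
by apply: leq_sum => j _; exact: leq_b1.
Qed.

Lemma bump_lip q x x' : fold U q (x' - x) -> `|bump x' - bump x| <= q%:R / J%:R.
Proof.
move=> f; have f' : fold U q (x - x') by rewrite -opprB; exact: foldN.
rewrite /bump -mulrBl normrM (ger0_norm (_ : 0 <= J%:R^-1)) ?invr_ge0 //.
rewrite ler_wpM2r ?invr_ge0 // ler_norml.
have := bump_lip_nat f; have := bump_lip_nat f'.
rewrite -!(ler_nat R) !natrD; lra.
Qed.

End Approximation.

(* The characters of a finite approximation of C by (Z/n)^S are only approximately
   continuous homomorphisms on C; Hyers' theorem corrects them. *)
Theorem peter_weyl y : C y -> y <> 0 -> exists th : K -> R,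
  [/\ forall x x', C x -> C x' -> tnorm (th (x + x') - th x - th x') = 0,
      forall e : R, 0 < e ->
        exists2 V, nbhs (0 : K) V & forall x, C x -> V x -> tnorm (th x) <= e &
      tnorm (th y) <> 0].
Proof.
move=> Cy y0; have [V nV Vy] := nb_avoid hK y0.
(* 16 leaves room for the 12 elements of V0 into which [hy] decomposes y. *)
have [V0 [nV0 V00 V0N fV0]] := nb_fold 16 nV.
have [V1 [nV1 V10 V1N fV1]] := nb_fold 5 nV0.
have [s0 [s0C hs0]] := pc_in V1N (pC nV1).
pose k := size s0.
have k_gt0 : (0 < k)%N by have [z] := hs0 0 (subgroup0 sC); rewrite /k; case: (s0).
have kR0 : 0 < k%:R :> R by rewrite ltr0n.
(* The bound of [large_power], where k is the number of translates of V1 + V1 that cover C. *)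
pose kap : R := k%:R ^- 4 / 4.
have kap0 : 0 < kap by rewrite divr_gt0 // invr_gt0 exprn_gt0.
have [eta eta0 heta] := cosT_near1 kap0.
(* 1/32 is what [hyers] requires. The bound eta / 2 makes [tnorm (F y)] less than eta should the
   corrected character vanish at y, which contradicts the lower bound kap at y. *)
pose e : R := Num.min 32^-1 (eta / 2).
have e32 : e <= 32^-1 by rewrite ge_min lexx.
have eeta : e <= eta / 2 by rewrite ge_min lexx orbT.
have e0 : 0 < e by rewrite lt_min invr_gt0 ltr0n /= divr_gt0.
have [kp kp0 hkp] := cosT_far e0.
pose mm : R := Num.min 1 (kap * kp).
have mm0 : 0 < mm by rewrite lt_min ltr01 mulr_gt0.
(* Enough layers for the square of 7 / J to be at most kap * kp; 7 counts an element of [fold U 6]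
   and one additivity error of [approx]. *)
pose J := (Num.truncn (8 / mm)).+1.
have J_gt0 : (0 < J)%N by [].
have JR0 : 0 < J%:R :> R by rewrite ltr0n.
have hJ : 8 / J%:R <= mm.
  have : 8 / mm < J%:R by exact: truncnS_gt.
  by rewrite ltr_pdivrMr // => h; rewrite ler_pdivrMr // mulrC ltW.
have hJ2 : (7 / J%:R) ^+ 2 <= kap * kp.
  have mmle : mm <= kap * kp by rewrite ge_min lexx orbT.
  have mm1 : mm <= 1 by rewrite ge_min lexx.
  rewrite (le_trans _ mmle) // (le_trans (_ : _ <= mm ^+ 2)) //.
    have a0 : 0 <= 7 / J%:R :> R by apply: divr_ge0.
    have a1 : 7 / J%:R <= mm.
      by rewrite (le_trans _ hJ) // ler_wpM2r ?invr_ge0 // ler_nat.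
    by rewrite lerXn2r ?nnegrE // ltW.
  by rewrite expr2 ger_pMr.
have [U [nU U0 UN fU]] := nb_fold (J + 10) nV1.
have [U' [nU' U'0 U'N fU']] := nb_fold 2 nU.
have [S [SC hS']] := pc_in U'N (pC nU').
have hS x : C x -> exists i : 'I_(size S), U (x - S`_i).
  move=> /hS'[z zS fz]; have lz : (index z S < size S)%N by rewrite index_mem.
  by exists (Ordinal lz); rewrite /= nth_index //; exact: fU'.
have [W [nW W0 WN fW]] := nb_fold (size S) nU.
have [n hn] := recurrence SC nW.
pose T : finZmodType := 'rV['I_n.+2]_(size S).
pose pi_ (c : T) : K := approx c.
have piD a b : U (pi_ a + pi_ b - pi_ (a + b)) by exact: (approxD W0 fW hn).
have piB a b : U (pi_ a - pi_ b - pi_ (a - b)) by exact: (approxB UN W0 fW hn).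
have UV1 m x : (m <= J + 10)%N -> fold U m x -> V1 x.
  by move=> mJ f; apply: fU; exact: fold_mono f.
have V1V0 x : V1 x -> V0 x.
  by move=> Vx; apply: fV1; apply: (@fold_mono _ _ 1) => //; exact: fold1.
have UV0 x : U x -> V0 x.
  by move=> Ux; apply: V1V0; apply: (@UV1 1); [lia|exact: fold1].
pose g (c : T) : R := bump U V0 J (pi_ c).
have g01 c : 0 <= g c <= 1 by exact: bump01.
have gsupp c : g c != 0 -> fold V0 2 (pi_ c).
  move=> /(bump_out U0)[v Vv fv]; have -> : pi_ c = v + (pi_ c - v) by zmod.
  apply: (@foldD _ _ 1 1); first exact: fold1.
  by apply: fold1; apply: V1V0; apply: (@UV1 J) => //; rewrite leq_addr.
have hsupp d : autocor g d != 0 -> fold V0 5 (pi_ d).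
  move=> h; have [c hc] : exists c, g c * g (c + d) != 0.
    apply: contrapT => /forallNP nc; case/negP: h; apply/eqP; rewrite /autocor big1 // => c _.
    by apply/eqP; apply: contrapT => /negP; exact: nc.
  move: hc; rewrite mulf_eq0 negb_or => /andP[/gsupp h1 /gsupp h2].
  have -> : pi_ d = pi_ (c + d) - pi_ c + (pi_ c + pi_ d - pi_ (c + d)) by zmod.
  apply: (@foldD _ _ 4 1); first exact: (@foldB _ _ 2 2).
  by apply: fold1; apply: UV0.
have /choice[idx hidx] : forall x, exists i : 'I_(size S), C x -> U (x - S`_i).
  move=> x; have [Cx|nCx] := pselect (C x); first by have [i hi] := hS x Cx; exists i.
  by have [i hi] := hS 0 (subgroup0 sC); exists i.
pose be x : T := basis n (idx x).
have pibe x : pi_ (be x) = S`_(idx x) by exact: approx_basis.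
have hy d : autocor g d * autocor g (d + be y) = 0.
  apply/eqP; rewrite mulf_eq0; apply: contrapT => /negP; rewrite negb_or.
  move=> /andP[/hsupp h1 /hsupp h2]; apply: Vy; apply: fV0.
  have -> : y = pi_ (d + be y) - pi_ d + (pi_ d + pi_ (be y) - pi_ (d + be y)) + (y - S`_(idx y)).
    by rewrite pibe; zmod.
  apply: (@fold_mono _ _ 12) => //; apply: (@foldD _ _ 11 1); last first.
    by apply: fold1; apply: UV0; exact: hidx.
  apply: (@foldD _ _ 10 1); first exact: (@foldB _ _ 5 5).
  by apply: fold1; apply: UV0.
have Cpi c : C (pi_ c).
  apply: subgroup_sum => // i; apply: subgroupMn => //; apply: SC.
  by apply: mem_nth; exact: ltn_ord.
(* The k sets of those c for which [pi_ c] is near a given centre cover T, and each can be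
   translated into the set where [pi_] takes values in V0, on which g is 1. *)
have hk : #|T|%:R <= k%:R * \sum_c g c.
  pose b := (\sum_(c : T) (`[< V0 (pi_ c) >] : nat))%N.
  have hb : b%:R <= \sum_c g c.
    rewrite /b natr_sum ler_sum // => c _; case: asboolP => Vc.
      by rewrite /g bump_in.
    by have /andP[] := g01 c.
  rewrite (le_trans (_ : _ <= k%:R * b%:R)) //; last by rewrite ler_wpM2l // ltW.
  rewrite -natrM ler_nat.
  pose Ti (i : 'I_k) (c : T) := `[< fold V1 2 (pi_ c - s0`_i) >].
  rewrite (leq_trans (_ : _ <= \sum_(c : T) \sum_(i < k) (Ti i c : nat))%N) //.
    rewrite -sum1_card; apply: leq_sum => c _; have [z zs fz] := hs0 _ (Cpi c).
    have lz : (index z s0 < k)%N by rewrite index_mem.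
    rewrite (bigD1 (Ordinal lz)) //= /Ti /= nth_index // asboolT //.
  rewrite exchange_big /= (leq_trans (_ : _ <= \sum_(i < k) b)%N) //; last first.
    by rewrite sum_nat_const card_ord.
  apply: leq_sum => i _; have [[c0 hc0]|nc] := pselect (exists c0, Ti i c0); last first.
    rewrite big1 // => c _; case e1 : (Ti i c) => //; case: nc; by exists c.
  rewrite /b [leqRHS](reindex_inj (addIr (- c0))) /=; apply: leq_sum => c _.
  case: (boolP (Ti i c)) => // /asboolP hc; rewrite asboolT //; apply: fV1.
  have -> : pi_ (c - c0) = (pi_ c - s0`_i) - (pi_ c0 - s0`_i) - (pi_ c - pi_ c0 - pi_ (c - c0)) by zmod.
  apply: (@foldB _ _ 4 1) => //; first by apply: (@foldB _ _ 2 2) => //; exact/asboolP.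
  by apply: fold1; apply: (@UV1 1); [lia|exact: fold1].
(* The large Fourier coefficient at xi makes the phases of small elements small, by [power_shift];
   the second bound keeps the phase at y away from 0. *)
have [xi [hA hcos]] := large_power (@phaseD R _ _) (@phase_orth R _ _) g01 kR0 hk hy.
have nT0 : 0 < #|T|%:R :> R by rewrite ltr0n; apply/card_gt0P; exists 0.
have small c : fold U 6 (pi_ c) -> tnorm (phase R xi c) <= e.
  move=> fc; apply: hkp.
  have hdl t : `|g (t - c) - g t| <= 7 / J%:R.
    apply: bump_lip => //.
    have -> : pi_ (t - c) - pi_ t = - (pi_ t - pi_ c - pi_ (t - c)) - pi_ c by zmod.
    apply: (@foldB _ _ 1 6) => //; apply: foldN => //; exact: fold1.
  have h1 := power_shift (@phaseD R _ _) xi hdl.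
  have c1 : 0 <= 1 - cosT (phase R xi c) by rewrite subr_ge0 cosT_le1.
  have h2 : (1 - cosT (phase R xi c)) * (kap * #|T|%:R ^+ 2) <= #|T|%:R ^+ 2 * (kap * kp).
    rewrite (le_trans (_ : _ <= (1 - cosT (phase R xi c)) * power (@phase R n (size S)) g xi)) //.
      by rewrite ler_wpM2l.
    by rewrite (le_trans h1) // ler_wpM2l // exprn_ge0 // ltW.
  have k2 : 0 < kap * #|T|%:R ^+ 2 by rewrite mulr_gt0 // exprn_gt0.
  rewrite -(ler_pM2r k2) (le_trans h2) // le_eqVlt; apply/orP; left; apply/eqP.
  by ring.
pose F x : R := phase R xi (be x).
have FD x x' : C x -> C x' -> tnorm (F (x + x') - F x - F x') <= e.
  move=> Cx Cx'; have Cxx := subgroupD sC Cx Cx'.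
  have e1 : tnorm (F (x + x') - F x - F x' - phase R xi (be (x + x') - be x - be x')) = 0.
    have h1 := phaseB R xi (be (x + x') - be x) (be x').
    have h2 := phaseB R xi (be (x + x')) (be x).
    rewrite -tnormN; set A := phase R xi (_ - be x - _); rewrite -/A in h1.
    set B := phase R xi (_ - _) in h1 h2.
    have -> : - (F (x + x') - F x - F x' - A) = (A - (B - F x')) + (B - (F (x + x') - F x)).
      by ring.
    by rewrite tnorm_intD.
  rewrite (tnorm_eqB e1); apply: small.
  have -> : pi_ (be (x + x') - be x - be x') =
    - (x + x' - S`_(idx (x + x'))) + (x - S`_(idx x)) + (x' - S`_(idx x'))
    - (pi_ (be (x + x')) - pi_ (be x) - pi_ (be (x + x') - be x))
    - (pi_ (be (x + x') - be x) - pi_ (be x') - pi_ (be (x + x') - be x - be x')).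
    by rewrite !pibe; zmod.
  apply: (@fold_mono _ _ 5) => //; apply: (@foldB _ _ 4 1) => //; last exact: fold1.
  apply: (@foldB _ _ 3 1) => //; last exact: fold1.
  apply: (@foldD _ _ 2 1) => //; last by apply: fold1; exact: hidx.
  apply: (@foldD _ _ 1 1) => //; last by apply: fold1; exact: hidx.
  by apply: foldN => //; apply: fold1; exact: hidx.
have [H [HD HF]] := hyers (subgroupD sC) e32 FD.
exists H; split=> //.
  apply: (tchar_continuous HD nU) => x Cx Ux.
  have Fx : tnorm (F x) <= e.
    apply: small; rewrite pibe; have -> : S`_(idx x) = x - (x - S`_(idx x)) by zmod.
    apply: (@fold_mono _ _ 2) => //; apply: (@foldB _ _ 1 1) => //; apply: fold1 => //.
    exact: hidx.
  have -> : H x = (H x - F x) + F x by ring.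
  have := HF x Cx; have := tnormD (H x - F x) (F x); lra.
move=> Hy; have Fy : tnorm (F y) <= e.
  have -> : F y = H y - (H y - F y) by ring.
  by rewrite (le_trans (tnormB _ _)) // Hy add0r; exact: HF.
have : tnorm (F y) < eta by lra.
by move/heta; rewrite ltNge; move/negP; apply; exact: hcos.
Qed.

End PeterWeyl.

(** * Coarser topologies from formal sums *)

Section GroupBases.
Variable K : topologicalZmodType.

(** Bases at 0 of group topologies, with a single axiom on differences in place of those on sums and
    opposites. Separation is left out, since it has to be proved for each base. *)
Definition group_base (B : set (set K)) : Prop :=
  [/\ B !=set0,
      forall A1 A2, B A1 -> B A2 -> exists2 A, B A & A `<=` A1 `&` A2,
      forall A, B A -> exists2 A', B A' & forall x y, A' x -> A' y -> A (x - y) &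
      forall A, B A -> A 0].

Definition minimal_base : Prop := forall B : set (set K), group_base B ->
  (forall A, B A -> nbhs (0 : K) A) ->
  (forall x, (forall A, B A -> A x) -> x = 0) ->
  forall V, nbhs (0 : K) V -> exists2 A, B A & A `<=` V.

(** Closed subgroups inherit minimality: the sums V + A, for V a neighbourhood of 0 and A in B, form
    a coarser base on all of K. It is separated because a point of all these sums lies in the closed
    set L, and then in every A. *)
Lemma minimal_base_closed (L : set K) (B : set (set K)) : minimal_base ->
  closed L -> subgroup L -> group_base B -> (forall A, B A -> A `<=` L) ->
  (forall A, B A -> exists2 V, nbhs (0 : K) V & V `&` L `<=` A) ->
  (forall x, (forall A, B A -> A x) -> x = 0) ->
  forall V, nbhs (0 : K) V -> exists2 A, B A & A `<=` V.
Proof.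
move=> mK cL sL [[A0 BA0] BI BB B0] BL Bnb Bsep.
pose sm (V A : set K) := [set x | exists v a, [/\ V v, A a & x = v + a]].
pose B' := [set X | exists V A, [/\ nbhs (0 : K) V, B A & X = sm V A]].
have gB : group_base B'.
  split.
  - by exists (sm setT A0), setT, A0; split=> //; exact: filterT.
  - move=> _ _ [V1 [A1 [nV1 BA1 ->]]] [V2 [A2 [nV2 BA2 ->]]].
    have [A BA hA] := BI _ _ BA1 BA2.
    exists (sm (V1 `&` V2) A).
      by exists (V1 `&` V2), A; split=> //; exact: filterI.
    by move=> _ [v [a [[Vv1 Vv2] /hA[h1 h2] ->]]]; split; exists v, a.
  - move=> _ [V [A [nV BA ->]]]; have [A' BA' hA'] := BB _ BA.
    have [W [nW W0 WN fW]] := nb_fold 2 nV.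
    exists (sm W A'); first by exists W, A'.
    move=> _ _ [v [a [Wv Aa ->]]] [v' [a' [Wv' Aa' ->]]].
    exists (v - v'), (a - a'); split; [|exact: hA'|by zmod].
    by apply: fW; apply: (@foldB _ _ 1 1) => //; exact: fold1.
  - move=> _ [V [A [nV BA ->]]]; exists 0, 0; rewrite addr0; split=> //.
      exact: nb0.
    exact: B0.
move=> V nV; have [||X [V1 [A [nV1 BA ->]]] h] := mK B' gB _ _ V nV.
- move=> _ [V' [A [nV' BA ->]]]; apply: filterS nV' => v Vv.
  by exists v, 0; rewrite addr0; split=> //; exact: B0.
- move=> x hx; have Lx : L x.
    apply: cL; apply/closureBP => W nW.
    have [v [a [Wv Aa e]]] := hx _ (ex_intro _ W (ex_intro _ A0 (And3 nW BA0 erefl))).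
    by exists a; [exact: BL Aa|rewrite e addrK].
  apply: Bsep => A BA; have [A' BA' hA'] := BB _ BA.
  have [V' nV' hV'] := Bnb _ BA'; have [W [nW WV WN]] := nb_sym nV'.
  have [v [a [Wv Aa e]]] := hx _ (ex_intro _ W (ex_intro _ A' (And3 nW BA' erefl))).
  have -> : x = a - (- v) by rewrite e; zmod.
  apply: hA' => //; apply: hV'; split; first by apply: WV; exact: WN.
  have -> : - v = a - x by rewrite e; zmod.
  by apply: subgroupB => //; exact: BL Aa.
exists A => // a Aa; apply: h; exists 0, a; rewrite add0r; split=> //.
exact: nb0.
Qed.

End GroupBases.

Section FormalSums.
Variables (K : zmodType) (a : nat -> K).

(** A polynomial serves as a finitely supported integer sequence; its value at 1 is the sum of the
    coefficients. *)
Definition psum (c : {poly int}) : K := \sum_(n < size c) a n *~ c`_n.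

Lemma psumE (c : {poly int}) M : (size c <= M)%N -> psum c = \sum_(n < M) a n *~ c`_n.
Proof.
move=> h; rewrite /psum -!(big_mkord xpredT (fun n => a n *~ c`_n)).
have z : \sum_(size c <= n < M) a n *~ c`_n = 0.
  by rewrite big_nat_cond big1 // => n /andP[/andP[hn _] _]; rewrite nth_default.
by rewrite [RHS](@big_cat_nat _ _ _ (size c)) //= z addr0.
Qed.

Lemma psumB c c' : psum (c - c') = psum c - psum c'.
Proof.
pose M := maxn (size c) (size c').
have h : (size (c - c')%R <= M)%N by rewrite (leq_trans (size_polyD _ _)) // size_polyN.
rewrite (psumE h) (@psumE c M) ?leq_maxl // (@psumE c' M) ?leq_maxr // -sumrB.
by apply: eq_bigr => n _; rewrite coefB mulrzBr.
Qed.

Lemma psum0 : psum 0 = 0. Proof. by rewrite /psum size_poly0 big_ord0. Qed.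
End FormalSums.

Section FormalBase.
Implicit Types (A : nat -> set nat) (c : {poly int}).

(** Base at 0, when the [A j] range over a filter, for a group topology on the integer sequences of
    sum zero in which the difference of two generators tends to 0 along the filter. An index of
    weight j must lie in [A j], and the indices of weight at most j carry a total mass of at most
    2^j. *)
Definition fbase A c : Prop := c.[1] = 0 /\ exists w : nat -> nat,
  (forall n, c`_n != 0 -> A (w n) n) /\
  (forall j, \sum_(n < size c | w n <= j) absz (c`_n)%R <= 2 ^ j)%N.

Lemma fbase_wide c (w : nat -> nat) j M : (size c <= M)%N ->
  (\sum_(n < size c | w n <= j) absz (c`_n)%R = \sum_(n < M | w n <= j) absz (c`_n)%R)%N.
Proof.
move=> h; rewrite -!(big_mkord (fun n => w n <= j)%N (fun n => absz (c`_n)%R)).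
have z : (\sum_(size c <= n < M | w n <= j) absz (c`_n)%R = 0)%N.
  by rewrite big_nat_cond big1 // => n /andP[/andP[hn _] _]; rewrite nth_default.
by rewrite [RHS](@big_cat_nat _ _ _ (size c)) //= z addn0.
Qed.

Lemma fbase0 A : fbase A 0.
Proof.
split; first by rewrite horner0.
by exists (fun=> 0%N); split=> [n|j]; rewrite ?coef0 // size_poly0 big_ord0.
Qed.

Lemma fbase_le c (w : nat -> nat) n : c`_n != 0 ->
  (forall j, \sum_(n < size c | w n <= j) absz (c`_n)%R <= 2 ^ j)%N ->
  (absz (c`_n)%R <= 2 ^ w n)%N.
Proof.
move=> cn h; have ln : (n < size c)%N.
  by rewrite ltnNge; apply/negP => l; rewrite nth_default in cn.
by apply: leq_trans (h (w n)); rewrite (bigD1 (Ordinal ln)) //= leq_addr.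
Qed.

Lemma fbaseN A c : fbase A c -> fbase A (- c).
Proof.
move=> [c1 [w [hw hs]]]; split; first by rewrite hornerN c1 oppr0.
exists w; split=> [n|j]; first by rewrite coefN oppr_eq0; exact: hw.
by rewrite size_polyN (leq_trans _ (hs j)) // leq_sum // => n _; rewrite coefN abszN.
Qed.

(** Raising all weights by one doubles the budget 2^j, which pays for two summands; an index in both
    supports gets one more than the larger of its two weights. *)
Lemma fbaseD A c c' : fbase (fun j => A j.+1) c -> fbase (fun j => A j.+1) c' ->
  fbase A (c + c').
Proof.
move=> [c1 [w [hw hs]]] [c1' [w' [hw' hs']]].
split; first by rewrite hornerD c1 c1' addr0.
pose v n := if c`_n == 0 then (if c'`_n == 0 then 0 else (w' n).+1)
  else if c'`_n == 0 then (w n).+1 else (maxn (w n) (w' n)).+1.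
exists v; split=> [n|j].
  rewrite coefD /v; have [->|h] := eqVneq c`_n 0; have [->|h'] := eqVneq c'`_n 0.
  - by rewrite addr0 eqxx.
  - by move=> _; exact: hw'.
  - by move=> _; exact: hw.
  - move=> _; case: (leqP (w n) (w' n)) => _; [exact: hw'|exact: hw].
pose M := maxn (size c) (size c').
have lM : (size (c + c')%R <= M)%N by exact: size_polyD.
rewrite (fbase_wide _ _ lM).
case: j => [|j].
  rewrite big1 // => n; rewrite leqn0 coefD /v.
  by case: (c`_n =P 0) => [->|//]; case: (c'`_n =P 0) => [->|//].
rewrite (leq_trans (_ : _ <= \sum_(n < M | v n <= j.+1) absz (c`_n)%R +
   \sum_(n < M | v n <= j.+1) absz (c'`_n)%R)%N) //.
  rewrite -big_split /=; apply: leq_sum => n _; rewrite coefD.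
  by move: (c`_n)%R (c'`_n)%R => x y; lia.
rewrite expnS mul2n -addnn leq_add //.
  apply: leq_trans (hs j); rewrite (@fbase_wide c w j M) ?leq_maxl //.
  rewrite [leqLHS]big_mkcond [leqRHS]big_mkcond /=; apply: leq_sum => n _.
  case: (leqP (v n) j.+1) => // hv; case: (leqP (w n) j) => // hj.
  case: (eqVneq c`_n 0) => [->//|cn]; move: hv; rewrite /v (negbTE cn).
  by case: eqP => _; rewrite ?ltnS ?geq_max; lia.
apply: leq_trans (hs' j); rewrite (@fbase_wide c' w' j M) ?leq_maxr //.
rewrite [leqLHS]big_mkcond [leqRHS]big_mkcond /=; apply: leq_sum => n _.
case: (leqP (v n) j.+1) => // hv; case: (leqP (w' n) j) => // hj.
case: (eqVneq c'`_n 0) => [->//|cn]; move: hv; rewrite /v (negbTE cn).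
by case: eqP => _; rewrite ?ltnS ?geq_max; lia.
Qed.

Lemma fbase_sub A A' c : (forall j, A j `<=` A' j) -> fbase A c -> fbase A' c.
Proof. by move=> h [c1 [w [hw hs]]]; split=> //; exists w; split=> // n /hw /h. Qed.

Lemma fbase_pair A n n' : n != n' -> A 1%N n -> A 1%N n' -> fbase A ('X^n - 'X^n').
Proof.
move=> nn' An An'; split; first by rewrite hornerD hornerN !hornerXn !expr1n subrr.
(* Weight 1, since the mass 2 exceeds the budget 1 of weight 0. *)
exists (fun=> 1%N); split=> [k|j].
  rewrite coefB !coefXn; case: (k =P n) => [->//|_]; case: (k =P n') => [->//|_].
  by rewrite subrr eqxx.
case: j => [|j]; first by rewrite big1.
rewrite (leq_trans (_ : _ <= 2)%N) //; last by rewrite expnS leq_pmulr // expn_gt0.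
pose M := maxn (size ('X^n - 'X^n' : {poly int})) (maxn n.+1 n'.+1).
rewrite (@fbase_wide _ (fun=> 1%N) j.+1 M) ?leq_maxl //=.
have ln : (n < M)%N by rewrite /M !leq_max ltnSn orbT.
have ln' : (n' < M)%N by rewrite /M !leq_max ltnSn !orbT.
rewrite (bigD1 (Ordinal ln)) //= (bigD1 (Ordinal ln')) //=; last by rewrite -val_eqE /= eq_sym.
rewrite big1 ?addn0 => [|k /andP[/negbTE h1 /negbTE h2]].
  by rewrite !coefB !coefXn !eqxx (eq_sym n') (negbTE nn').
by rewrite coefB !coefXn; rewrite -!val_eqE /= in h1 h2; rewrite h1 h2.
Qed.
End FormalBase.

Section CoarserTopology.
Variable K : topologicalZmodType.
Hypothesis hK : hausdorff_space K.
Hypothesis mK : minimal_base K.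
Variables (L : set K) (a : nat -> K).
Hypotheses (cL : closed L) (sL : subgroup L) (aL : forall n, L (a n)).
Variables (F : set_system nat) (PF : ProperFilter F).
Hypothesis Ffr : forall m : nat, F [set n | (m <= n)%N].
(** [H1] says that sums with coefficients divisible by [d m] are small, [H2] that smallness in [U m]
    forces this divisibility. The instances of d are 0, p^(m+1) and the constant p. *)
Variables (d : nat -> nat) (U : nat -> set K).
Hypothesis nU : forall m, nbhs (0 : K) (U m).
Hypothesis H1 : forall V, nbhs (0 : K) V -> exists m A,
  (forall j, F (A j)) /\
  forall c, fbase A c -> (forall n, ((d m)%:Z %| c`_n)%Z) -> V (psum a c).
Hypothesis H2 : forall m (c : {poly int}), c.[1] = 0 ->
  (forall n, c`_n != 0 -> (m <= n)%N /\ (absz (c`_n)%R <= 2 ^ n.+1)%N) ->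
  U m (psum a c) -> forall n, ((d m)%:Z %| c`_n)%Z.

Lemma psum_in c : L (psum a c).
Proof. by apply: subgroup_sum => // n; exact: subgroupMz. Qed.

(* The sets (V n L) + psum (fbase A) are a base of a coarser group topology, which
   is Hausdorff by H1 and H2; minimality then puts some a m - a n into U 0, and H2
   allows this only if d 0 = 1. *)
Lemma coarser_topology : d 0 = 1%N.
Proof.
pose X (V : set K) A := [set x | exists v c, [/\ V v, L v, fbase A c & x = v + psum a c]].
pose B := [set Y | exists V A, [/\ nbhs (0 : K) V, (forall j, F (A j)) & Y = X V A]].
have gB : group_base B.
  split.
  - exists (X setT (fun=> setT)), setT, (fun=> setT); split=> //; first exact: filterT.
    by move=> j; exact: filterT.
  - move=> _ _ [V1 [A1 [nV1 FA1 ->]]] [V2 [A2 [nV2 FA2 ->]]].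
    exists (X (V1 `&` V2) (fun j => A1 j `&` A2 j)).
      exists (V1 `&` V2), (fun j => A1 j `&` A2 j); split=> //; first exact: filterI.
      by move=> j; exact: filterI.
    move=> _ [v [c [[Vv1 Vv2] Lv fc ->]]].
    by split; exists v, c; split=> //; apply: fbase_sub fc => j n [].
  - move=> _ [V [A [nV FA ->]]]; have [W [nW W0 WN fW]] := nb_fold 2 nV.
    exists (X W (fun j => A j.+1)); first by exists W, (fun j => A j.+1).
    move=> _ _ [v [c [Wv Lv fc ->]]] [v' [c' [Wv' Lv' fc' ->]]].
    exists (v - v'), (c - c'); split; last by rewrite psumB; zmod.
    + by apply: fW; apply: (@foldB _ _ 1 1) => //; exact: fold1.
    + exact: subgroupB.
    + by apply: fbaseD => //; exact: fbaseN.
  - move=> _ [V [A [nV FA ->]]]; exists 0, 0; rewrite psum0 addr0; split=> //.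
    + exact: nb0.
    + exact: subgroup0.
    + exact: fbase0.
have sep x : (forall Y, B Y -> Y x) -> x = 0.
  move=> hx; apply: contrapT => /(nb_avoid hK)[V nV Vx].
  have [W [nW W0 WN fW]] := nb_fold 2 nV.
  have [m [A0 [FA0 hA0]]] := H1 nW.
  have [W' [nW' W'0 W'N fW']] := nb_fold 2 (filterI (nU m) nW).
  have W'W z : W' z -> W z.
    by move=> W'z; have [] := fW' z (fold_mono W'0 (isT : (1 <= 2)%N) (fold1 W'z)).
  (* An index n of weight j satisfies j <= n, so its coefficient is at most 2^n in absolute value,
     and 2^(n+1) bounds that of a difference, as [H2] demands. *)
  pose A j := A0 j `&` [set n | (maxn m j <= n)%N].
  have FA j : F (A j) by apply: filterI => //; exact: Ffr.
  have [v [c [W'v Lv [c1 [w [hw hs]]] ex]]] := hx _ (ex_intro _ W' (ex_intro _ A (And3 nW' FA erefl))).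
  (* The second expression of x is supported beyond the size of c, so divisibility of the
     coefficients of c - c' gives that of the coefficients of c. *)
  pose A' j := A j `&` [set n | (size c <= n)%N].
  have FA' j : F (A' j) by apply: filterI => //; exact: Ffr.
  have [v' [c' [W'v' Lv' [c1' [w' [hw' hs']]] ex']]] :=
    hx _ (ex_intro _ W' (ex_intro _ A' (And3 nW' FA' erefl))).
  have bound (cc : {poly int}) (ww : nat -> nat) n : (forall j, \sum_(n < size cc | ww n <= j) absz (cc`_n)%R <= 2 ^ j)%N ->
      (forall n, cc`_n != 0 -> A (ww n) n) -> cc`_n != 0 -> (m <= n)%N /\ (absz (cc`_n)%R <= 2 ^ n)%N.
    move=> hss hww ccn; have [_] := hww n ccn; rewrite /= geq_max => /andP[-> h]; split=> //.
    by rewrite (leq_trans (fbase_le ccn hss)) // leq_exp2l.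
  have hA'A n : c'`_n != 0 -> A (w' n) n by move=> /hw'[].
  have dvd : forall n, ((d m)%:Z %| (c - c')`_n)%Z.
    apply: H2.
    - by rewrite hornerD hornerN c1 c1' subrr.
    - move=> n; rewrite coefB; have [e|e] := eqVneq c`_n 0.
        rewrite e sub0r oppr_eq0 => e'; have [-> h] := bound _ _ _ hs' hA'A e'; split=> //.
        by rewrite abszN (leq_trans h) // leq_exp2l.
      have [mn h] := bound _ _ _ hs hw e; move=> _; split=> //.
      have [e'|e'] := eqVneq c'`_n 0; first by rewrite e' subr0 (leq_trans h) // leq_exp2l.
      have [_ h'] := bound _ _ _ hs' hA'A e'.
      rewrite expnS mul2n -addnn; move: h h'; move: (c`_n)%R (c'`_n)%R (2 ^ n)%N => x1 y1 z1; lia.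
    - have -> : psum a (c - c') = v' - v.
        have := ex; rewrite ex' psumB => e; have -> : psum a c = v' + psum a c' - v.
          by rewrite e; zmod.
        by zmod.
      by have [] := fW' _ (@foldB _ _ 1 1 _ _ W'N (fold1 W'v') (fold1 W'v)).
  have dvdc n : ((d m)%:Z %| c`_n)%Z.
    have [l|l] := ltnP n (size c); last by rewrite nth_default // dvdz0.
    have := dvd n; rewrite coefB.
    have [->|/hw'[_ /=]] := eqVneq c'`_n 0; first by rewrite subr0.
    by rewrite leqNgt l.
  have fA0 : fbase A0 c by split=> //; exists w; split=> // n /hw[].
  apply: Vx; apply: fW; rewrite ex; apply: (@foldD _ _ 1 1); apply: fold1.
    exact: W'W.
  exact: hA0.
have [||X0 [V [A [nV FA ->]]] hX0] := minimal_base_closed mK cL sL gB _ _ sep (nU 0).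
- move=> _ [V [A [nV FA ->]]] _ [v [c [_ Lv _ ->]]]; apply: subgroupD => //.
  exact: psum_in.
- move=> _ [V [A [nV FA ->]]]; exists V => // v [Vv Lv].
  by exists v, 0; rewrite psum0 addr0; split=> //; exact: fbase0.
have [n [An _]] := filterI_ex PF (FA 1%N) (Ffr 0).
have [n' [An' nn']] := filterI_ex PF (FA 1%N) (Ffr n.+1).
have ne : n != n' by move: nn' => /=; rewrite neq_ltn => ->.
have fc := fbase_pair ne An An'.
have : U 0 (psum a ('X^n - 'X^n')).
  apply: hX0; exists 0, ('X^n - 'X^n'); rewrite add0r; split=> //.
    exact: nb0.
  exact: subgroup0.
move=> /H2 h; have := h _ _ n; rewrite coefB !coefXn eqxx (negbTE ne) subr0.
have [c1 _] := fc => /(_ c1) h'; have : ((d 0)%:Z %| 1)%Z.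
  apply: h' => k; rewrite coefB !coefXn => _; split=> //.
  rewrite (leq_trans (_ : _ <= 1)%N) //; last by rewrite expn_gt0.
  by case: (k == n); case: (k == n').
by rewrite dvdz1 /= => /eqP.
Qed.

End CoarserTopology.

(** * Coverings of a group by finitely many translates *)

Section Neumann.
Variables (K : zmodType) (L : set K).
Hypothesis sL : subgroup L.

Lemma neumann (m : nat) (B : nat -> set K) (F : nat -> seq K) :
  (forall i, B i `<=` L) ->
  (forall x, L x -> exists i f, [/\ (i < m)%N, f \in F i & B i (x - f)]) ->
  exists i (s : seq K), (i < m)%N /\ forall x, L x ->
    exists f b b', [/\ f \in s, B i b, B i b' & x - f = b - b'].
Proof.
move=> BL; elim: m F => [|m IH] F hF.
  by have [i [f []]] := hF 0 (subgroup0 sL).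
have [h|] := pselect (forall x, L x -> exists f b b',
    [/\ f \in F m, B m b, B m b' & x - f = b - b']).
  by exists m, (F m).
move=> /existsNP[a /not_implyP[La na]].
pose F' i := F i ++ [seq f + f' - a | f <- F m, f' <- F i].
have [|i [s [im hs]]] := IH F'.
  move=> x Lx; have [i [f [im fF Bf]]] := hF x Lx.
  move: im; rewrite ltnS leq_eqVlt => /orP[/eqP ei|im]; last first.
    by exists i, f; split=> //; rewrite mem_cat fF.
  rewrite {}ei in fF Bf *.
  have [i' [f' [im' fF' Bf']]] := hF (a + (x - f)) (subgroupD sL La (BL _ _ Bf)).
  move: im'; rewrite ltnS leq_eqVlt => /orP[/eqP ei|im'].
    rewrite {}ei in fF' Bf' *; case: na.
    by exists f', (a + (x - f) - f'), (x - f); split=> //; zmod.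
  exists i', (f + f' - a); split=> //.
    by rewrite mem_cat; apply/orP; right; apply/allpairsP; exists (f, f').
  by have -> : x - (f + f' - a) = a + (x - f) - f' by zmod.
by exists i, s; split=> //; exact: ltnW.
Qed.

Definition fourfold (S : set K) : set K :=
  [set x | exists b1 b2 b3 b4, [/\ S b1, S b2, S b3, S b4 & x = (b1 - b2) - (b3 - b4)]].

(** If no point avoided all the forbidden translates, L would be covered by finitely many translates
    of the sets of x with q_i x in S_i - S_i. By [neumann] the multiples q_i x, for some i, would
    then be covered by finitely many translates of [fourfold (S i)]. *)
Lemma neumann_pick (m : nat) (q : nat -> nat) (S : nat -> set K) (Y : nat -> seq K) :
  (forall i, (i < m)%N -> ~ exists s : seq K, forall x, L x ->
     exists2 f, f \in s & fourfold (S i) (x *+ q i - f)) ->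
  exists2 a, L a & forall i y, (i < m)%N -> y \in Y i -> ~ S i (a *+ q i - y).
Proof.
move=> hS; apply: contrapT => na.
have cov x : L x -> exists i y, [/\ (i < m)%N, y \in Y i & S i (x *+ q i - y)].
  move=> Lx; apply: contrapT => nx; apply: na; exists x => // i y im yY Sx.
  by apply: nx; exists i, y.
have /choice[r hr] : forall iy : nat * K, exists r, L r /\
   ((exists2 z, L z & S iy.1 (z *+ q iy.1 - iy.2)) -> S iy.1 (r *+ q iy.1 - iy.2)).
  move=> [i y] /=; have [[z Lz Sz]|nz] := pselect (exists2 z, L z & S i (z *+ q i - y)).
    by exists z.
  by exists 0; split=> //; exact: subgroup0.
pose B i := [set x | L x /\ exists b1 b2, [/\ S i b1, S i b2 & x *+ q i = b1 - b2]].
have [i x []//||i [s [im hs]]] := @neumann m B (fun i => [seq r (i, y) | y <- Y i]).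
  move=> x Lx; have [i [y [im yY Sx]]] := cov x Lx.
  have [Lr Sr] := hr (i, y); exists i, (r (i, y)); split=> //; first exact: map_f.
  split; first exact: subgroupB.
  exists (x *+ q i - y), (r (i, y) *+ q i - y); split=> //.
    by apply: Sr; exists x.
  by rewrite mulrnBl; zmod.
apply: (hS i im); exists [seq f *+ q i | f <- s] => x Lx.
have [f [b [b' [fs [_ [b1 [b2 [S1 S2 e12]]]] [_ [b3 [b4 [S3 S4 e34]]]] e]]]] := hs x Lx.
exists (f *+ q i); first exact: map_f.
by exists b1, b2, b3, b4; split=> //; rewrite -e12 -e34 -!mulrnBl e.
Qed.

Lemma dependent_seq (P : seq K -> K -> Prop) : (forall l, exists x, P l x) ->
  exists a : nat -> K, forall n, P (mkseq a n) (a n).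
Proof.
move=> /choice[f hf]; pose lst := fix lst n := if n is m.+1 then rcons (lst m) (f (lst m)) else [::].
pose a n := f (lst n); exists a => n.
suff -> : mkseq a n = lst n by exact: hf.
by elim: n => // n IH; rewrite /= mkseqS IH.
Qed.

Definition zrange (M : nat) : seq int := [seq i%:Z - M%:Z | i <- iota 0 (M + M).+1].

Lemma mem_zrange M (z : int) : (absz z <= M)%N -> z \in zrange M.
Proof.
move=> h; apply/mapP; exists (absz (z + M%:Z)); last by lia.
by rewrite mem_iota; lia.
Qed.

Fixpoint comb (M : nat) (l : seq K) : seq K :=
  if l is x :: l' then [seq x *~ z + y | z <- zrange M, y <- comb M l'] else [:: 0].

Lemma mem_comb M l (c : nat -> int) :
  (forall i, (i < size l)%N -> (absz (c i) <= M)%N) ->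
  \sum_(i < size l) l`_i *~ c i \in comb M l.
Proof.
elim: l c => [|x l IH] c hc; first by rewrite big_ord0 inE.
rewrite big_ord_recl; apply: (allpairs_f (fun z y => x *~ z + y)).
  by apply: mem_zrange; exact: hc.
by apply: (IH (fun i => c i.+1)) => i il; exact: hc.
Qed.

End Neumann.

(** * The Kraft inequality for a chain of neighbourhoods *)

Section Kraft.
Variables (K : zmodType) (V : nat -> set K).
Hypothesis V0 : forall k, V k 0.
Hypothesis VD : forall k x y, V k.+1 x -> V k.+1 y -> V k (x + y).

Lemma kraft_pair k (s : seq K) : (forall x, x \in s -> V k.+1 x) ->
  exists s' : seq K, [/\ forall x, x \in s' -> V k x,
    (size s' <= uphalf (size s))%N & \sum_(x <- s) x = \sum_(x <- s') x].
Proof.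
elim: {s}(size s).+1 {-2}s (ltnSn (size s)) => // n IH [|x [|y s]] /= hn hs.
- by exists [::].
- exists [:: x]; split=> // z; rewrite inE => /eqP->.
  by rewrite -[x]addr0; apply: VD => //; apply: hs; rewrite inE.
have [||s' [h1 h2 h3]] := IH s; first by lia.
  by move=> z zs; apply: hs; rewrite !inE zs !orbT.
exists ((x + y) :: s'); split.
- move=> z; rewrite inE => /orP[/eqP->|/h1//]; apply: VD; apply: hs; rewrite !inE eqxx ?orbT //.
- by rewrite /=; lia.
- by rewrite !big_cons h3 addrA.
Qed.

(** The elements of the last level are added in pairs, which roughly halves their number and lowers
    the level by one; at level 0 at most one element is left. The rounding up in [kraft_pair] is
    harmless, because all other terms of the weighted sum, and its bound, are even. *)
Lemma kraft Q (s : seq (nat * K)) : (forall z, z \in s -> (z.1 <= Q)%N /\ V z.1 z.2) ->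
  (\sum_(z <- s) 2 ^ (Q - z.1) <= 2 ^ Q)%N -> V 0 (\sum_(z <- s) z.2).
Proof.
elim: Q s => [|Q IH] s hs hsum.
  have hz z : z \in s -> V 0%N z.2.
    by move=> /hs[]; rewrite leqn0 => /eqP->.
  have : (size s <= 1)%N.
    rewrite (leq_trans _ hsum) // -sum1_size; apply: leq_sum => z _.
    by rewrite expn_gt0.
  case: s hz {hs hsum} => [|z [|//]] hz _; first by rewrite big_nil.
  by rewrite big_seq1; apply: hz; rewrite inE.
pose top := [seq z.2 | z <- s & z.1 == Q.+1].
have [|s' [h1 h2 h3]] := @kraft_pair Q top.
  by move=> x /mapP[z]; rewrite mem_filter => /andP[/eqP e /hs[_]]; rewrite e => h ->.
pose s1 := [seq z <- s | z.1 != Q.+1] ++ [seq (Q, x) | x <- s'].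
have -> : \sum_(z <- s) z.2 = \sum_(z <- s1) z.2.
  rewrite /s1 big_cat /= big_map /= -h3 /top big_map !big_filter addrC.
  by rewrite [LHS](bigID (fun z => z.1 == Q.+1)).
apply: IH => [z|].
  rewrite mem_cat mem_filter => /orP[/andP[zQ /hs[h hV]]|/mapP[x /h1 Vx ->]//].
  by split=> //; move: h; rewrite leq_eqVlt (negbTE zQ).
rewrite /s1 big_cat /= big_map /= subnn expn0 sum1_size big_filter.
move: hsum; rewrite (bigID (fun z => z.1 == Q.+1)) /=.
rewrite (eq_bigr (fun=> 1%N)); last by move=> z /eqP->; rewrite subnn.
have -> : (\sum_(z <- s | z.1 == Q.+1) 1 = size top)%N.
  by rewrite size_map sum1_count size_filter.
have -> : (\sum_(z <- s | z.1 != Q.+1) 2 ^ (Q.+1 - z.1) =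
   2 * \sum_(z <- s | z.1 != Q.+1) 2 ^ (Q - z.1))%N.
  rewrite big_distrr /= [LHS]big_seq_cond [RHS]big_seq_cond; apply: eq_bigr => z.
  move=> /andP[/hs[h _] zQ]; rewrite -expnS subSn //.
  by move: h; rewrite leq_eqVlt (negbTE zQ).
by move: h2; rewrite expnS; lia.
Qed.

Lemma kraft_mul Q M (k m : nat -> nat) (x : nat -> K) :
  (forall n, (n < M)%N -> (0 < m n)%N -> (k n <= Q)%N /\ V (k n) (x n)) ->
  (\sum_(n < M) m n * 2 ^ (Q - k n) <= 2 ^ Q)%N -> V 0 (\sum_(n < M) x n *+ m n).
Proof.
move=> h hs; pose s := flatten [seq nseq (m n) (k n, x n) | n <- iota 0 M].
have e1 (T : Type) (idx : T) (op : Monoid.com_law idx) (f : nat * K -> T) :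
   \big[op/idx]_(z <- s) f z = \big[op/idx]_(n < M) iter (m n) (op (f (k n, x n))) idx.
  rewrite -(big_mkord xpredT (fun n => iter (m n) (op (f (k n, x n))) idx)).
  rewrite /s big_flatten big_map /index_iota subn0.
  by apply: eq_bigr => n _; rewrite big_nseq.
have -> : \sum_(n < M) x n *+ m n = \sum_(z <- s) z.2.
  by rewrite e1; apply: eq_bigr => n _; rewrite iter_addr_0.
apply: (@kraft Q); last first.
  by rewrite e1 (leq_trans _ hs) // leq_sum // => n _; rewrite iter_addn_0 mulnC.
move=> z /flatten_mapP[n]; rewrite mem_iota add0n => /= nM /nseqP[-> m0].
exact: h.
Qed.
End Kraft.

(** * Precompactness in minimal groups *)

Section NonPrecompact.
Variable K : topologicalZmodType.
Hypothesis hK : hausdorff_space K.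
Hypothesis cK : complete_group K.
Hypothesis mK : minimal_base K.

Let frechet (m : nat) : (\oo : set_system nat) [set n | (m <= n)%N].
Proof. by exists m. Qed.

Lemma fourfold_fold (W : set K) x : (forall x, W x -> W (- x)) ->
  fourfold W x -> fold W 4 x.
Proof.
move=> WN [b1 [b2 [b3 [b4 [h1 h2 h3 h4 ->]]]]].
by apply: (@foldB _ _ 2 2) => //; apply: (@foldB _ _ 1 1) => //; exact: fold1.
Qed.

(** Otherwise [neumann_pick] gives a_n such that no q a_n with 0 < q <= 2^(n+1) is within W of a
    combination of the earlier terms with coefficients up to the same bound. The leading coefficient
    then shows that a sum in W is zero, and [coarser_topology] applies with d = 0, divisibility by 0
    meaning equality to 0. *)
Theorem multiples_precompact U : nbhs (0 : K) U ->
  exists2 m, (0 < m)%N & pc U [set x | exists y, x = y *+ m].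
Proof.
move=> nU; apply: contrapT => npc.
have {}npc m : (0 < m)%N -> ~ pc U [set x | exists y, x = y *+ m].
  by move=> m0 h; apply: npc; exists m.
have [W [nW W0 WN fW]] := nb_fold 4 nU.
have sT : subgroup [set: K] by [].
pose P (l : seq K) (x : K) := forall q y, (0 < q <= 2 ^ (size l).+1)%N ->
  y \in comb (2 ^ (size l).+1) l -> ~ W (x *+ q - y).
have [a ha] : exists a : nat -> K, forall n, P (mkseq a n) (a n).
  apply: dependent_seq => l.
  have [i _ [s hs]|x _ hx] := @neumann_pick _ setT sT (2 ^ (size l).+1) S (fun=> W)
    (fun=> comb (2 ^ (size l).+1) l).
    apply: (npc i.+1) => //; exists s => _ [y ->]; have [f fs hf] := hs y I.
    by exists f => //; apply: fW; exact: fourfold_fold.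
  by exists x => -[//|q] y /andP[_ hq] hy; exact: hx.
suff : (fun=> 0%N) 0%N = 1%N by [].
apply: (@coarser_topology K hK mK setT a (@closedT K) sT (fun=> I) \oo _ frechet
  (fun=> 0%N) (fun=> W)) => //.
- move=> V nV; exists 0%N, (fun=> setT); split=> [j|c _ hc]; first exact: filterT.
  have -> : c = 0 by apply/polyP => n; rewrite coef0; apply/eqP; have := hc n; rewrite dvd0z.
  by rewrite psum0; exact: nb0.
- move=> m c _ hc Wc; suff -> : c = 0 by move=> n; rewrite coef0 dvdz0.
  apply/eqP; rewrite -size_poly_eq0 -leqn0 leqNgt; apply/negP => sc.
  pose n := (size c).-1; have en : size c = n.+1 by rewrite prednK.
  have cn : c`_n != 0 by rewrite -/(lead_coef c) lead_coef_eq0 -size_poly_gt0.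
  have Wb (cc : int -> int) : (forall z, absz (cc z) = absz z) ->
     \sum_(i < n) (mkseq a n)`_i *~ cc c`_i \in comb (2 ^ n.+1) (mkseq a n).
    move=> hcc; have := @mem_comb _ (2 ^ n.+1) (mkseq a n) (fun i => cc c`_i).
    rewrite size_mkseq; apply=> i ilt; rewrite hcc.
    have [->//|ci] := eqVneq c`_i 0; have [_ h] := hc i ci.
    by rewrite (leq_trans h) // leq_exp2l // ltnW.
  have e : psum a c = a n *~ c`_n + \sum_(i < n) (mkseq a n)`_i *~ c`_i.
    rewrite (@psumE _ _ _ n.+1) ?en // big_ord_recr addrC /=; congr (_ + _).
    by apply: eq_bigr => i _; rewrite nth_mkseq.
  have [_ hn] := hc n cn.
  have := ha n (absz c`_n); rewrite /P size_mkseq absz_gt0 cn hn /= => h.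
  have [s0|s0] := lerP 0 c`_n.
    have e1 : a n *~ c`_n = a n *+ absz c`_n by rewrite -{1}(gez0_abs s0) -pmulrn.
    apply: (h _ isT (Wb -%R _)) => [z|]; first by rewrite abszN.
    have -> : a n *+ absz c`_n - \sum_(i < n) (mkseq a n)`_i *~ (- c`_i) = psum a c.
      rewrite e e1; congr (_ + _); rewrite -sumrN; apply: eq_bigr => i _.
      by rewrite mulrNz opprK.
    exact: Wc.
  have e1 : a n *~ c`_n = - (a n *+ absz c`_n).
    by rewrite -{1}[c`_n]opprK mulrNz -ltz0_abs // -pmulrn.
  apply: (h _ isT (Wb id _)) => //.
  have -> : a n *+ absz c`_n - \sum_(i < n) (mkseq a n)`_i *~ c`_i = - psum a c.
    by rewrite e e1 opprD opprK.
  exact: WN.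
Qed.

(** * Layers of p-primary subgroups *)

Section PrimaryGroup.
Variables (M : set K) (p : nat).
Hypotheses (clM : closed M) (sM : subgroup M) (pp : prime p).

Definition pim v : set K := [set x | exists2 l, M l & x = l *+ p ^ v].
Definition psh (V : set K) v : set K :=
  [set x | exists w l, [/\ V w, M l & x = w + l *+ p ^ v]].

Lemma psh_fourfold (W : set K) v x : (forall x, W x -> W (- x)) ->
  fourfold (psh W v) x -> psh (fold W 4) v x.
Proof.
move=> WN [b1 [b2 [b3 [b4 [[w1 [l1 [W1 L1 ->]]] [w2 [l2 [W2 L2 ->]]]
  [w3 [l3 [W3 L3 ->]]] [w4 [l4 [W4 L4 ->]]] ->]]]]].
exists ((w1 - w2) - (w3 - w4)), ((l1 - l2) - (l3 - l4)); split.
- by apply: (@foldB _ _ 2 2) => //; apply: (@foldB _ _ 1 1) => //; exact: fold1.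
- by do ![apply: subgroupB => //].
- by rewrite !mulrnBl; zmod.
Qed.

Lemma psh_sub V V' v : V `<=` V' -> psh V v `<=` psh V' v.
Proof. by move=> h x [w [l [/h Vw Ml ->]]]; exists w, l. Qed.

(** u is invertible modulo p, so p^v u M and p^v M agree modulo p^(v+1) M and a finite cover of one
    serves the other. *)
Lemma unit_cover V v u : (0 < u < p)%N -> ~ pc (psh V v.+1) (pim v) ->
  ~ exists s : seq K, forall x, M x ->
     exists2 f, f \in s & psh V v.+1 (x *+ (p ^ v * u) - f).
Proof.
move=> /andP[u0 up] npc [s hs]; apply: npc; exists s => _ [x Mx ->].
have cup : coprime u p by rewrite coprime_sym prime_coprime // gtnNdvd.
case: (egcdnP p u0) => km kn; rewrite (eqP cup) => ek _.
have [f fs [w [l [Vw Ml e]]]] := hs (x *+ km) (subgroupMn sM _ Mx).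
exists f => //; exists w, (l - x *+ kn); split=> //.
  by apply: subgroupB => //; exact: subgroupMn.
have {e} : x *+ (p ^ v * (km * u)) - f = w + l *+ p ^ v.+1.
  by rewrite -e -!mulrnA; congr (_ *+ _ - _); rewrite mulnCA.
rewrite ek mulnDr muln1 mulrnDr => e; rewrite mulrnBl -mulrnA addrA -e.
have -> : (p ^ v * (kn * p) = kn * p ^ v.+1)%N by rewrite expnS; lia.
by zmod.
Qed.

Variable h : nat -> nat.

(** [h n] is the last layer controlled at step n: it is n when every layer is bad, and 0 when only
    the first layer is used. *)
Lemma independent_seq (W : nat -> set K) :
  (forall v x, W v x -> W v (- x)) ->
  (forall v, (exists n, v <= h n)%N -> ~ pc (psh (fold (W v) 4) v.+1) (pim v)) ->
  exists a : nat -> K, (forall n, M (a n)) /\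
    forall n v u y, (v <= h n)%N -> (0 < u < p)%N ->
      y \in comb (p ^ (h n).+1) (mkseq a n) ->
      ~ psh (W v) v.+1 (a n *+ (p ^ v * u) - y).
Proof.
move=> WN npc; have p0 : (0 < p)%N by exact: prime_gt0.
pose P (l : seq K) (x : K) := M x /\ forall v u y, (v <= h (size l))%N ->
  (0 < u < p)%N -> y \in comb (p ^ (h (size l)).+1) l ->
  ~ psh (W v) v.+1 (x *+ (p ^ v * u) - y).
have [a ha] : exists a : nat -> K, forall n, P (mkseq a n) (a n).
  apply: dependent_seq => l.
  (* The pair (v, u) is coded by i = v * p + u; for u = 0 the forbidden set is empty. *)
  have [i ilt hex|x Mx hx] := @neumann_pick _ M sM ((h (size l)).+1 * p)
     (fun i => (p ^ (i %/ p) * (i %% p)))%N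
     (fun i => if (i %% p == 0)%N then set0 else psh (W (i %/ p)%N) (i %/ p).+1)
     (fun=> comb (p ^ (h (size l)).+1) l).
    case: ifP hex => [_ [s hs]|/negbT i0 [s hs]].
      by have [f _ [? [? [? [? []]]]]] := hs 0 (subgroup0 sM).
    have ui : (0 < i %% p < p)%N by rewrite lt0n i0 ltn_pmod.
    apply: (@unit_cover (fold (W (i %/ p)%N) 4) (i %/ p) _ ui).
      by apply: npc; exists (size l); rewrite -ltnS ltn_divLR.
    exists s => x Mx; have [f fs hf] := hs x Mx; exists f => //.
    by apply: psh_fourfold => //; exact: WN.
  exists x; split=> // v u y hv /andP[u0 up] hy hS.
  have := hx (v * p + u)%N y; rewrite modnMDl modn_small // divnMDl // divn_small // addn0.
  rewrite -[X in if X then _ else _]negbK -lt0n u0 /=; apply=> //.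
  by rewrite (leq_trans (_ : _ <= v.+1 * p)%N) ?leq_mul2r ?ltnS ?hv ?orbT // mulSn addnC ltn_add2r.
exists a; split=> [n|n v u y]; first by have [] := ha n.
by have [_] := ha n; rewrite size_mkseq; exact.
Qed.

(** Reduce the coefficients modulo p^(v+1) and consider the last one that does not vanish. It is p^v
    u with 0 < u < p, and the reduced sum lies in W v + p^(v+1) M, against the choice of the
    corresponding term of the sequence. *)
Lemma independent_step (W : nat -> set K) (a : nat -> K) (c : {poly int}) v :
  (forall n, M (a n)) ->
  (forall n v u y, (v <= h n)%N -> (0 < u < p)%N ->
      y \in comb (p ^ (h n).+1) (mkseq a n) ->
      ~ psh (W v) v.+1 (a n *+ (p ^ v * u) - y)) ->
  (forall n, ((p ^ v)%N%:Z %| c`_n)%Z) -> (forall n, c`_n != 0 -> (v <= h n)%N) ->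
  W v (psum a c) -> forall n, ((p ^ v.+1)%N%:Z %| c`_n)%Z.
Proof.
move=> aM ha hd hc Wc; have p0 : (0 < p)%N by exact: prime_gt0.
have pv0 w : (0 < p ^ w)%N by rewrite expn_gt0 p0.
pose N0 : int := (p ^ v.+1)%N%:Z.
suff hn n : (forall k, (n < k)%N -> (N0 %| c`_k)%Z) -> (N0 %| c`_n)%Z.
  have H k : forall n, (size c <= n + k)%N -> (N0 %| c`_n)%Z.
    elim: k => [|k IH] n hk; first by rewrite nth_default ?dvdz0 // -[n]addn0.
    by apply: hn => j nj; apply: IH; lia.
  by move=> n; apply: (H (size c)); rewrite leq_addl.
move=> htop; apply: contrapT => /negP ndv.
have N00 : N0 != 0 by rewrite /N0 eqz_nat -lt0n pv0.
pose r i : int := (c`_i %% N0)%Z; pose q i : int := (c`_i %/ N0)%Z.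
have er i : c`_i = q i * N0 + r i by exact: divz_eq.
have r0 i : 0 <= r i by rewrite modz_ge0.
have rlt i : r i < N0 by rewrite ltz_pmod // ltz_nat pv0.
have cn : c`_n != 0 by apply: contra ndv => /eqP->; rewrite dvdz0.
have rn0 : r n != 0 by apply: contra ndv => /eqP h0; rewrite /dvdz; apply/dvdz_mod0P.
have rtop i : (n < i)%N -> r i = 0 by move=> /htop /dvdz_mod0P.
have [u eu] : exists u : nat, r n = (p ^ v * u)%N%:Z.
  have : ((p ^ v)%N%:Z %| r n)%Z.
    have -> : r n = c`_n - q n * N0 by rewrite er addrC addrA addNr add0r.
    apply: rpredB; first exact: hd.
    by rewrite /N0 expnS PoszM mulrA; apply: dvdz_mull.
  move=> /dvdzP[z ez]; exists (absz z); have := r0 n; rewrite ez PoszM mulrC.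
  by rewrite pmulr_rge0 ?ltz_nat ?pv0 // => z0; rewrite gez0_abs.
have un : (0 < u < p)%N.
  have := rlt n; have := rn0; rewrite eu /N0 ltz_nat expnSr ltn_pmul2l // => h1 ->.
  by rewrite andbT lt0n; apply: contra h1 => /eqP->; rewrite muln0.
have vn := hc n cn.
have hy : \sum_(i < n) (mkseq a n)`_i *~ (- r i) \in comb (p ^ (h n).+1) (mkseq a n).
  have := @mem_comb _ (p ^ (h n).+1) (mkseq a n) (fun i => - r i).
  rewrite size_mkseq; apply=> i _; rewrite abszN.
  have := rlt i; have := r0 i; rewrite /N0.
  have : (p ^ v.+1 <= p ^ (h n).+1)%N by rewrite leq_pexp2l.
  by move: (r i) => x; lia.
apply: (ha n v u _ vn un hy); exists (psum a c), (- \sum_(i < size c) a i *~ q i); split=> //.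
  by apply: subgroupN => //; apply: subgroup_sum => // i; exact: subgroupMz.
have ec : psum a c = \sum_(i < size c) a i *~ r i + (\sum_(i < size c) a i *~ q i) *+ p ^ v.+1.
  rewrite -sumrMnl -big_split /=; apply: eq_bigr => i _.
  by rewrite {1}er mulrzDr mulrzA -pmulrn addrC.
have es : \sum_(i < size c) a i *~ r i =
    \sum_(i < n) (mkseq a n)`_i *~ r i + a n *+ (p ^ v * u).
  have ln : (n < size c)%N by rewrite ltnNge; apply: contra cn => l; rewrite nth_default.
  rewrite -(big_mkord xpredT (fun i => a i *~ r i)) (@big_cat_nat _ _ _ n.+1) //= big_nat_recr //=.
  rewrite [X in _ + X]big_nat_cond [X in _ + X]big1 ?addr0; last first.
    by move=> i /andP[/andP[ni _] _]; rewrite rtop // mulr0z.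
  rewrite eu -pmulrn big_mkord; congr (_ + _); apply: eq_bigr => i _.
  by rewrite nth_mkseq.
rewrite ec es mulNrn.
have -> : \sum_(i < n) (mkseq a n)`_i *~ - r i = - \sum_(i < n) (mkseq a n)`_i *~ r i.
  by rewrite -sumrN; apply: eq_bigr => i _; rewrite mulrNz.
by zmod.
Qed.

End PrimaryGroup.

Section PrimaryContradictions.
Variables (M : set K) (p : nat).
Hypotheses (clM : closed M) (sM : subgroup M) (pp : prime p).

(** If every layer were bad, a sequence independent in all of them would make smallness in W 0, ...,
    W m force divisibility by p^(m+1). Conversely sums with such coefficients lie in p^(m+1) M,
    which tends to 0, so [coarser_topology] applies. *)
Theorem primary_layers : (forall V, nbhs (0 : K) V -> exists t, pim M p t `<=` V) ->
  exists v, forall V, nbhs (0 : K) V -> pc (psh M p V v.+1) (pim M p v).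
Proof.
move=> ht; apply: contrapT => /forallNP hv.
have {}hv v : exists V, nbhs (0 : K) V /\ ~ pc (psh M p V v.+1) (pim M p v).
  have /existsNP[V /not_implyP[nV npc]] := hv v; by exists V.
have /choice[W hW] : forall v, exists W, [/\ nbhs (0 : K) W, W 0,
   (forall x, W x -> W (- x)) & ~ pc (psh M p (fold W 4) v.+1) (pim M p v)].
  move=> v; have [V [nV npc]] := hv v; have [W [nW W0 WN fW]] := nb_fold 4 nV.
  exists W; split=> // h; apply: npc; apply: pc_sub h => //; exact: psh_sub.
have [||a [aM ha]] := @independent_seq M p sM pp id W.
- by move=> v x; have [_ _ WN _] := hW v; exact: WN.
- by move=> v _; have [] := hW v.
have : (p ^ 1 = 1)%N.
  pose U m := \bigcap_(v in [set v | (v <= m)%N]) W v.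
  apply: (@coarser_topology K hK mK M a clM sM aM \oo _ frechet (fun m => p ^ m.+1)%N U).
  - move=> m; elim: m => [|m IH].
      have [nW _ _ _] := hW 0%N; apply: filterS nW => x Wx v /=.
      by rewrite leqn0 => /eqP->.
    have [nW _ _ _] := hW m.+1; apply: filterS2 IH nW => x Ux Wx v /=.
    by rewrite leq_eqVlt => /orP[/eqP->//|]; rewrite ltnS; exact: Ux.
  - move=> V nV; have [t hV] := ht V nV; exists t, (fun=> setT).
    split=> [j|c _ hc]; first exact: filterT.
    apply: hV; exists (\sum_(i < size c) a i *~ (c`_i %/ (p ^ t)%N%:Z)%Z).
      by apply: subgroup_sum => // i; exact: subgroupMz.
    rewrite -sumrMnl; apply: eq_bigr => i _.
    rewrite pmulrn -mulrzA divzK //; apply: dvdz_trans (hc i).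
    by rewrite expnS PoszM dvdz_mull.
  - move=> m c _ hc Uc.
    have H v : (v <= m.+1)%N -> forall n, ((p ^ v)%N%:Z %| c`_n)%Z.
      elim: v => [|v IH] hvm; first by move=> n; exact: dvd1z.
      apply: (independent_step sM pp aM ha (IH (ltnW hvm))).
        by move=> n /hc[mn _]; exact: leq_trans mn.
      by apply: Uc.
    exact: H.
by rewrite expn1 => p1; move: pp; rewrite p1.
Qed.

(** If M were not precompact, its layer 0 would be bad, giving a sequence independent in that layer.
    Along an ultrafilter p a_n converges to some c0. As the coefficients have sum zero, a sum with
    coefficients p e_i equals that of the e_i (p a_i - c0), which is small; so [coarser_topology]
    applies with d = p. *)
Theorem bounded_precompact : (forall V, nbhs (0 : K) V -> pc V (pim M p 1)) ->
  forall V, nbhs (0 : K) V -> pc V M.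
Proof.
move=> hp V nV; apply: contrapT => npc.
have [V' [nV' V'0 V'N fV']] := nb_fold 2 nV.
have npc' : ~ pc (psh M p V' 1) (pim M p 0).
  move=> [s hs]; apply: npc; have [s' hs'] := hp V' nV'.
  exists [seq y + y' | y <- s, y' <- s'] => x Mx.
  have [|y ys [w [l [Vw Ml e]]]] := hs x; first by exists x; rewrite ?expn0 ?mulr1n.
  have [|y' ys' Vy'] := hs' (l *+ p ^ 1); first by exists l.
  exists (y + y'); first by apply/allpairsP; exists (y, y').
  apply: fV'; have -> : x - (y + y') = w + (l *+ p ^ 1 - y').
    have ex : x = w + l *+ p ^ 1 + y by rewrite -e; zmod.
    by rewrite ex; zmod.
  by apply: (@foldD _ _ 1 1); apply: fold1.
have [W [nW W0 WN fW]] := nb_fold 4 nV'.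
have [||a [aM ha]] := @independent_seq M p sM pp (fun=> 0%N) (fun=> W).
- by move=> _; exact: WN.
- move=> v [_]; rewrite leqn0 => /eqP-> h; apply: npc'; apply: pc_sub h => //.
  exact: psh_sub.
have [|||F [UF hF]] := @ultra_from_base nat [set A | exists m, A = [set n | (m <= n)%N]].
- by exists [set n | (0 <= n)%N], 0%N.
- move=> _ _ [m1 ->] [m2 ->]; exists [set n | (maxn m1 m2 <= n)%N].
    by exists (maxn m1 m2).
  by move=> n /=; rewrite geq_max => /andP[].
- by move=> _ [m ->]; exists m => /=.
have PF : ProperFilter F by exact: ultra_proper.
have [c0 hc0] : exists c0, tolim F (fun n => a n *+ p) c0.
  apply: complete_lim => // V1 nV1; exists (pim M p 1); last exact: hp.
  by apply: filterS filterT => n _; exists (a n).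
have : p = 1%N.
  apply: (@coarser_topology K hK mK M a clM sM aM F _ _ (fun=> p) (fun=> W)) => //.
  - by move=> m; apply: hF; exists m.
  - move=> V1 nV1.
    have /choice[f hf] : forall X : set K, exists Y : set K, nbhs (0 : K) X ->
        [/\ nbhs (0 : K) Y, Y 0, (forall x, Y x -> Y (- x)) & fold Y 2 `<=` X].
      move=> X; have [nX|nX] := pselect (nbhs (0 : K) X); last by exists X.
      by have [Y hY] := nb_fold 2 nX; exists Y.
    pose Vs := fix Vs k := if k is k'.+1 then f (Vs k') else f V1.
    have nVs k : nbhs (0 : K) (Vs k).
      by elim: k => [|k IH] /=; [have [] := hf V1 nV1|have [] := hf _ IH].
    have Vs0 k : Vs k 0 by exact: nb0.
    have VsN k x : Vs k x -> Vs k (- x).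
      case: k => [|k] /=; first by have [_ _ h _] := hf V1 nV1; exact: h.
      by have [_ _ h _] := hf _ (nVs k); exact: h.
    have VsD k x y : Vs k.+1 x -> Vs k.+1 y -> Vs k (x + y).
      move=> hx hy; have [_ _ _ hh] := hf _ (nVs k); apply: hh.
      by apply: (@foldD _ _ 1 1); exact: fold1.
    have VsV x : Vs 0%N x -> V1 x.
      have [_ h0 _ hh] := hf _ nV1 => hx; apply: hh.
      by apply: (@fold_mono _ _ 1) => //; exact: fold1.
    (* Up to weight j the mass may be 2^j. At level 2 j + 1 a unit of mass costs 2^-(2j+1) in the
       Kraft inequality, so the total cost stays bounded by 1. *)
    exists 0%N, (fun j => [set n | Vs (j.*2.+1) (a n *+ p - c0)]).
    split=> [j|c [c1 [w [hw hs]]] hc]; first by apply: hc0; exact: nVs.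
    apply: VsV; pose e i := (c`_i %/ p%:Z)%Z.
    have p0 : (0 < p)%N by exact: prime_gt0.
    have ce i : c`_i = e i * p%:Z by rewrite divzK.
    have se : \sum_(i < size c) e i = 0.
      apply: (@mulIf _ p%:Z); first by rewrite eqz_nat -lt0n.
      rewrite mul0r mulr_suml; transitivity c.[1] => //.
      rewrite horner_coef; apply: eq_bigr => i _.
      by rewrite expr1n mulr1 -ce.
    have -> : psum a c = \sum_(i < size c) ((a i *+ p - c0) *~ e i).
      under [RHS]eq_bigr do rewrite mulrzBl.
      rewrite sumrB -mulrz_sumr se mulr0z subr0; apply: eq_bigr => i _.
      by rewrite ce mulrC mulrzA pmulrn.
    pose x i := if (0 <= e i) then a i *+ p - c0 else - (a i *+ p - c0).
    rewrite (eq_bigr (fun i : 'I_(size c) => x i *+ absz (e i))); last first.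
      move=> i _; rewrite /x; case: (lerP 0 (e i)) => he.
        by rewrite -{1}(gez0_abs he) -pmulrn.
      by rewrite mulNrn -{1}[e i]opprK mulrNz -ltz0_abs // -pmulrn.
    pose J := \max_(i < size c) w i.
    have wJ (i : 'I_(size c)) : (w i <= J)%N by exact: (leq_bigmax i).
    apply: (@kraft_mul _ Vs Vs0 VsD (J.*2.+1) (size c) (fun i => (w i).*2.+1) (fun i => absz (e i)) x).
      move=> i ilt e0; split; first by rewrite ltnS leq_double (wJ (Ordinal ilt)).
      have ci : c`_i != 0 by rewrite ce mulf_neq0 -?absz_gt0.
      by rewrite /x; case: ifP => _; [|apply: VsN]; exact: hw.
    (* The Kraft sum rescaled by 4^j. The additional term 2^j lets the induction absorb the mass at
       most 2^(j+1) that arrives with weight j + 1. *)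
    have key j : (\sum_(i < size c | w i <= j) absz (c`_i)%R * 4 ^ (j - w i) + 2 ^ j <= 2 * 4 ^ j)%N.
      elim: j => [|j IH].
        rewrite (eq_bigr (fun i : 'I_(size c) => absz (c`_i)%R)) => [|i].
          by have := hs 0%N; rewrite !expn0 muln1 addn1.
        by rewrite leqn0 => /eqP->; rewrite muln1.
      rewrite (bigID (fun i : 'I_(size c) => w i <= j)%N) /=.
      have -> : (\sum_(i < size c | (w i <= j.+1) && (w i <= j)) absz (c`_i)%R * 4 ^ (j.+1 - w i) =
         4 * \sum_(i < size c | w i <= j) absz (c`_i)%R * 4 ^ (j - w i))%N.
        rewrite big_distrr /=; apply: eq_big => i.
          by case: (leqP (w i) j) => h; rewrite ?andbF // (leq_trans h).
        by move=> /andP[_ h]; rewrite subSn // expnS mulnCA.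
      have : (\sum_(i < size c | (w i <= j.+1) && ~~ (w i <= j)) absz (c`_i)%R * 4 ^ (j.+1 - w i) <= 2 ^ j.+1)%N.
        apply: leq_trans (hs j.+1).
        rewrite [leqLHS]big_mkcond [leqRHS]big_mkcond /=; apply: leq_sum => i _.
        case: (leqP (w i) j.+1) => h1 //=; case: (leqP (w i) j) => h2 //=.
        have -> : (j.+1 - w i = 0)%N by lia.
        by rewrite muln1.
      have ar (S0 T0 x0 y0 : nat) : (S0 + x0 <= 2 * y0 -> T0 <= 2 * x0 ->
        4 * S0 + T0 + 2 * x0 <= 2 * (4 * y0))%N by lia.
      by rewrite !(expnS _ j); exact: ar.
    have -> : (2 ^ J.*2.+1 = 2 * 4 ^ J)%N by rewrite expnS -mul2n expnM.
    apply: leq_trans (leq_trans (leq_addr _ _) (key J)).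
    rewrite [leqRHS]big_mkcond /=; apply: leq_sum => i _; rewrite wJ.
    have -> : (J.*2.+1 - (w i).*2.+1 = 2 * (J - w i))%N by have := wJ i; lia.
    rewrite expnM leq_mul2r ce abszM /= leq_pmulr // orbT //.
  - move=> m c _ _ Wc n; have := @independent_step M p sM pp (fun=> 0%N) (fun=> W) a c 0 aM ha.
    rewrite expn1; apply=> // k; exact: dvd1z.
by move=> p1; move: pp; rewrite p1.
Qed.

End PrimaryContradictions.
End NonPrecompact.

(** * Topological characters and the divisible part *)

Section TopologicalCharacters.
Variables (R : realType) (K : topologicalZmodType).

Definition tcharacter (C : set K) (H : K -> R) : Prop :=
  (forall x y, C x -> C y -> tnorm (H (x + y) - H x - H y) = 0) /\
  (forall e : R, 0 < e ->
    exists2 V, nbhs (0 : K) V & forall x, C x -> V x -> tnorm (H x) <= e).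

Variables (C : set K) (H : K -> R).
Hypotheses (sC : subgroup C) (tH : tcharacter C H).

Lemma tcharacterB x y : C x -> C y -> tnorm (H (x - y) - (H x - H y)) = 0.
Proof. by move=> Cx Cy; apply: (tcharB (subgroupB sC) tH.1). Qed.
Lemma tcharacterD x y : C x -> C y -> tnorm (H (x + y) - (H x + H y)) = 0.
Proof. by move=> Cx Cy; apply: (tcharD tH.1). Qed.
Lemma tcharacterMn x n : C x -> tnorm (H (x *+ n) - H x *+ n) = 0.
Proof. by move=> Cx; have [] := tcharMn (subgroup0 sC) (subgroupB sC) tH.1 n Cx. Qed.
Lemma tcharacter0 : tnorm (H 0) = 0.
Proof. exact: tchar0 (subgroup0 sC) tH.1. Qed.

Lemma tnorm_trans (a b c : R) : tnorm (a - b) = 0 -> tnorm (b - c) = 0 -> tnorm (a - c) = 0.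
Proof.
move=> h1 h2; have -> : a - c = (a - b) + (b - c) by ring.
by rewrite tnorm_intD.
Qed.

Lemma tcharacter_near (T : Type) (F : set_system T) (f : T -> K) l (e : R) :
  ProperFilter F -> C l -> F [set t | C (f t)] -> tolim F f l -> 0 < e ->
  F [set t | tnorm (H (f t) - H l) <= e].
Proof.
move=> PF Cl FC hl e0; have [V nV hV] := tH.2 e e0.
apply: filterS2 FC (hl V nV) => t /= Ct Vt.
by rewrite -(tnorm_eqB (tcharacterB Ct Cl)); apply: hV => //; exact: subgroupB.
Qed.

Lemma tcharacter_lim (T : Type) (F : set_system T) (f : T -> K) l (t0 : R) :
  ProperFilter F -> C l -> F [set t | C (f t)] -> tolim F f l ->
  (forall e, 0 < e -> F [set t | tnorm (H (f t) - t0) <= e]) -> tnorm (H l - t0) = 0.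
Proof.
move=> PF Cl FC hl h; apply/eqP; rewrite eq_le tnorm_ge0 andbT.
apply/ler_addgt0Pl => e e0; rewrite addr0.
have e2 : 0 < e / 2 by rewrite divr_gt0.
have [t [/= h1 h2]] := filterI_ex PF (tcharacter_near PF Cl FC hl e2) (h _ e2).
have -> : H l - t0 = (H (f t) - t0) - (H (f t) - H l) by ring.
by rewrite (le_trans (tnormB _ _)) // [leRHS]splitr lerD.
Qed.

(** Take N > 1 / e and x with N! H(x) nonzero. Among the N + 1 values H(j x), j <= N, two fall into
    the same of N arcs; their difference is at most e, and it is nonzero because j - i divides
    N!. *)
Lemma tchar_small_values : ~ (exists2 n, (0 < n)%N & forall x, C x -> tnorm (H x *+ n) = 0) ->
  forall e : R, 0 < e -> exists x, [/\ C x, 0 < tnorm (H x) & tnorm (H x) <= e].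
Proof.
move=> nH e e0.
have [N N0 hN] : exists2 N : nat, 0 < N%:R :> R & e^-1 < N%:R.
  by exists (Num.truncn e^-1).+1; [rewrite ltr0n|exact: truncnS_gt].
have [x Cx nx] : exists2 x, C x & tnorm (H x *+ N`!) <> 0.
  apply: contrapT => nex; apply: nH; exists N`!%N; first exact: fact_gt0.
  by move=> x Cx; apply: contrapT => h; apply: nex; exists x.
pose y (j : nat) := (centered (H x *+ j) + 2^-1) * N%:R.
have y_b j : 0 <= y j < N%:R.
  have := centered_bound (H x *+ j); rewrite /y => /andP[h1 h2].
  apply/andP; split; first by apply: mulr_ge0; [lra|exact: ltW].
  by rewrite gtr_pMl //; lra.
have yt j : (Num.truncn (y j) < N)%N.
  have /andP[h1 h2] := y_b j; rewrite -(ltr_nat R) (le_lt_trans _ h2) //.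
  by rewrite truncn_le.
pose F (j : 'I_N.+1) : 'I_N := Ordinal (yt j).
have [i [j [lij jN eij]]] : exists i j : nat, [/\ (i < j)%N, (j <= N)%N & Num.truncn (y i) = Num.truncn (y j)].
  apply: contrapT => nex; have : (#|'I_N.+1| <= #|'I_N|)%N.
    apply: (@leq_card _ _ F) => a b /(congr1 val) /= eab; apply: contrapT => ab.
    have [l|l|/val_inj//] := ltngtP a b; apply: nex.
      by exists (nat_of_ord a), (nat_of_ord b); split=> //; rewrite -ltnS ltn_ord.
    by exists (nat_of_ord b), (nat_of_ord a); split=> //; rewrite -ltnS ltn_ord.
  by rewrite !card_ord ltnn.
have dij : `|y j - y i| <= 1.
  have /andP[a0 _] := y_b i; have /andP[b0 _] := y_b j.
  have /andP[h1 h2] := truncn_itv a0; have /andP[h3 h4] := truncn_itv b0.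
  rewrite -eij in h3 h4; rewrite -natr1 in h2 h4; rewrite ler_norml; lra.
have small : tnorm (H x *+ (j - i)) <= e.
  have ez : tnorm (H x *+ (j - i) - (centered (H x *+ j) - centered (H x *+ i))) = 0.
    have lij' := ltnW lij; apply/eqP; rewrite tnorm_eq0 (mulrnBr _ lij').
    have -> : H x *+ j - H x *+ i - (centered (H x *+ j) - centered (H x *+ i)) =
      (H x *+ j - centered (H x *+ j)) - (H x *+ i - centered (H x *+ i)) by ring.
    by rewrite rpredB // centered_int.
  rewrite (tnorm_eqB ez) (le_trans (tnorm_le_abs _)) //.
  have : `|(centered (H x *+ j) - centered (H x *+ i)) * N%:R| <= 1.
    by move: dij; rewrite /y; congr (`|_| <= _); ring.
  rewrite normrM (ger0_norm (ltW N0)) -ler_pdivlMr // => h.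
  by rewrite (le_trans h) // mul1r -[leRHS]invrK lef_pV2 ?posrE ?invr_gt0 // ltW.
exists (x *+ (j - i)); split; first exact: subgroupMn.
  rewrite (tnorm_eqB (tcharacterMn _ Cx)) lt_neqAle tnorm_ge0 andbT eq_sym.
  apply/eqP => h; apply: nx.
  have /dvdnP[k ->] : (j - i %| N`!)%N.
    by apply: dvdn_fact; rewrite subn_gt0 lij (leq_trans (leq_subr _ _)).
  by rewrite mulnC mulrnA; exact: tnorm_mulrn.
by rewrite (tnorm_eqB (tcharacterMn _ Cx)).
Qed.

(** The multiples of a nonzero value of size at most e come within e of every point of the circle;
    compactness of C turns density into surjectivity. *)
Lemma tchar_onto : compact C ->
  ~ (exists2 n, (0 < n)%N & forall x, C x -> tnorm (H x *+ n) = 0) ->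
  forall t : R, exists2 x, C x & tnorm (H x - t) = 0.
Proof.
move=> cC nH t; have sv := tchar_small_values nH.
have near_t (e : R) : 0 < e -> exists2 x, C x & tnorm (H x - t) <= e.
  move=> e0; have [x [Cx h0 he]] := sv e e0.
  pose t' : R := t - (Num.floor t)%:~R.
  have t'0 : 0 <= t' by rewrite subr_ge0 floor_le.
  have [z [Cz hz]] : exists z, C z /\ tnorm (H z - tnorm (H x)) = 0.
    have [c0|c0] := lerP 0 (centered (H x)).
      exists x; split=> //; apply/eqP; rewrite tnorm_eq0 /tnorm ger0_norm //.
      exact: centered_int.
    exists (- x); split; first exact: subgroupN.
    have := tcharacterB (subgroup0 sC) Cx; rewrite sub0r => /tnorm_trans; apply.
    have -> : H 0 - H x - tnorm (H x) = H 0 + - (H x - centered (H x)).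
      by rewrite /tnorm ltr0_norm //; ring.
    rewrite tnorm_intD; first exact: tcharacter0.
    by rewrite tnormN; apply/eqP; rewrite tnorm_eq0 centered_int.
  pose s := tnorm (H x); pose k := Num.truncn (t' / s).
  exists (z *+ k); first exact: subgroupMn.
  have e1 : tnorm (H (z *+ k) - t - (s *+ k - t')) = 0.
    have -> : H (z *+ k) - t - (s *+ k - t') =
      (H (z *+ k) - H z *+ k) + ((H z - s) *+ k + - (Num.floor t)%:~R).
      by rewrite /t' mulrnBl; ring.
    rewrite tnorm_intD; first exact: tcharacterMn.
    rewrite tnorm_intD; first exact: tnorm_mulrn.
    by apply/eqP; rewrite tnorm_eq0 rpredN intr_int.
  rewrite (tnorm_eqB e1) (le_trans (tnorm_le_abs _)) // (le_trans _ he) // -/s.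
  have q0 : 0 <= t' / s by rewrite divr_ge0 // ltW.
  have /andP[h1 h2] := truncn_itv q0.
  move: h1 h2; rewrite -/k ler_pdivlMr // ltr_pdivrMr // -natr1 mulrDl mul1r.
  rewrite mulr_natl ler_norml; lra.
have [|||F [UF hF]] := @ultra_from_base K [set A | exists2 e : R, 0 < e & A = [set x | C x /\ tnorm (H x - t) <= e]].
- by exists [set x | C x /\ tnorm (H x - t) <= 1], 1.
- move=> _ _ [e1 e10 ->] [e2 e20 ->].
  exists [set x | C x /\ tnorm (H x - t) <= Num.min e1 e2].
    by exists (Num.min e1 e2) => //; rewrite lt_min e10.
  by move=> x [Cx]; rewrite le_min => /andP[h1 h2]; split.
- by move=> _ [e e0 ->]; have [x Cx hx] := near_t e e0; exists x.
have PF : ProperFilter F by exact: ultra_proper.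
have FC : F C.
  have := hF _ (ex_intro2 _ _ 1 ltr01 erefl); by apply: filterS => x [].
have [l Cl hl] := @compact_lim K C _ F id cC UF FC.
exists l => //; apply: (tcharacter_lim PF Cl FC hl) => e e0.
by have := hF _ (ex_intro2 _ _ e e0 erefl); apply: filterS => x [].
Qed.

End TopologicalCharacters.

(** * The divisible part of a subgroup *)

Section DivisiblePart.
Variable K : topologicalZmodType.
Hypotheses (hK : hausdorff_space K) (cK : complete_group K).

Definition mulset (M : set K) d : set K := [set x | exists2 y, M y & x = y *+ d].
Definition divpart (M : set K) : set K :=
  [set x | forall d, (0 < d)%N -> closure (mulset M d) x].

Variable M : set K.
Hypotheses (clM : closed M) (sM : subgroup M).
Hypothesis pcM : forall V, nbhs (0 : K) V -> exists2 d, (0 < d)%N & pc V (mulset M d).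

Lemma closure_subgroup (S : set K) : subgroup S -> subgroup (closure S).
Proof.
move=> sS; split; first by apply: subset_closure; exact: subgroup0.
move=> x y /closureP hx /closureP hy; apply/closureP => V nV.
have [W [nW W0 WN fW]] := nb_fold 2 nV.
have [a Sa Wa] := hx W nW; have [b Sb Wb] := hy W nW.
exists (a - b); first exact: subgroupB.
apply: fW; have -> : a - b - (x - y) = (a - x) - (b - y) by zmod.
by apply: (@foldB _ _ 1 1) => //; exact: fold1.
Qed.

Lemma mulset_subgroup d : subgroup (mulset M d).
Proof.
split; first by exists 0; [exact: subgroup0|rewrite mul0rn].
move=> _ _ [x Mx ->] [y My ->]; exists (x - y); [exact: subgroupB|by rewrite mulrnBl].
Qed.

Lemma mulset_sub d e : mulset M (d * e) `<=` mulset M d.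
Proof.
move=> _ [x Mx ->]; exists (x *+ e); first exact: subgroupMn.
by rewrite -mulrnA mulnC.
Qed.

Lemma mulsetM d : mulset M d `<=` M.
Proof. by move=> _ [x Mx ->]; exact: subgroupMn. Qed.

Lemma divpart_subgroup : subgroup (divpart M).
Proof.
split=> [d d0|x y hx hy d d0]; have sd := closure_subgroup (mulset_subgroup d).
  exact: subgroup0.
exact: (subgroupB sd (hx d d0) (hy d d0)).
Qed.

Lemma divpart_closed : closed (divpart M).
Proof.
move=> x hx d d0; apply: (closed_closure (A := mulset M d)).
by apply: closureS hx => y; exact.
Qed.

Lemma divpart_sub : divpart M `<=` M.
Proof.
move=> x hx; apply: clM; apply: closureS (hx 1%N isT); exact: mulsetM.
Qed.

Lemma divpart_lim (T : Type) (F : set_system T) (f : T -> K) : UltraFilter F ->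
  (forall d, (0 < d)%N -> F [set t | mulset M d (f t)]) ->
  exists2 l, divpart M l & tolim F f l.
Proof.
move=> UF hF; have PF : ProperFilter F by exact: ultra_proper.
have [|l hl] := @complete_lim K cK _ F f UF.
  by move=> V nV; have [d d0 pcd] := pcM nV; exists (mulset M d) => //; exact: hF.
exists l => // d d0; exact: (tolim_closure PF (hF d d0) hl).
Qed.

Lemma divpart_compact : compact (divpart M).
Proof.
apply: (complete_compact cK divpart_closed) => V nV.
have [W [nW W0 WN fW]] := nb_fold 2 nV; have [d d0 [s hs]] := pcM nW.
exists s => x /(_ d d0)/closureBP/(_ W nW)[a /hs[y ys Wy] Wa].
exists y => //; apply: fW; have -> : x - y = (x - a) + (a - y) by zmod.
by apply: (@foldD _ _ 1 1); exact: fold1.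
Qed.

(** Otherwise the points of dM that are V-far from the divisible part, for d increasing by
    divisibility, would have a limit, which [divpart_lim] puts into the divisible part. *)
Lemma divpart_near V : nbhs (0 : K) V -> exists2 d, (0 < d)%N &
  forall x, M x -> exists2 y, divpart M y & V (x *+ d - y).
Proof.
move=> nV; apply: contrapT => nex.
have [|||F [UF hF]] := @ultra_from_base K [set A | exists2 d, (0 < d)%N &
    A = [set x | mulset M d x /\ forall y, divpart M y -> ~ V (x - y)]].
- by exists [set x | mulset M 1 x /\ forall y, divpart M y -> ~ V (x - y)], 1%N.
- move=> _ _ [d d0 ->] [e e0 ->].
  exists [set x | mulset M (d * e) x /\ forall y, divpart M y -> ~ V (x - y)].
    by exists (d * e)%N => //; rewrite muln_gt0 d0.
  move=> x [hx hy]; split; split=> //; first exact: mulset_sub hx.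
  by apply: (@mulset_sub e d); rewrite mulnC.
- move=> _ [d d0 ->]; apply: contrapT => hd; apply: nex; exists d => // x Mx.
  apply: contrapT => hx; apply: hd; exists (x *+ d); split; first by exists x.
  by move=> y Dy Vy; apply: hx; exists y.
have PF : ProperFilter F by exact: ultra_proper.
have [|l Dl hl] := @divpart_lim _ F id UF.
  by move=> d d0; have := hF _ (ex_intro2 _ _ d d0 erefl); apply: filterS => x [].
have [x [[_ h1] h2]] := filterI_ex PF (hF _ (ex_intro2 _ _ 1%N isT erefl)) (hl V nV).
exact: (h1 l Dl).
Qed.

(** If z (d m) is close to x, then z d is an approximate m-th root of x inside dM; such roots
    accumulate at an exact one lying in the closure of every dM. *)
Lemma divpart_divisible m x : (0 < m)%N -> divpart M x ->
  exists2 y, divpart M y & y *+ m = x.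
Proof.
move=> m0 Dx.
have [|||F [UF hF]] := @ultra_from_base K [set A | exists d V, [/\ (0 < d)%N, nbhs (0 : K) V &
    A = [set y | mulset M d y /\ V (y *+ m - x)]]].
- by exists [set y | mulset M 1 y /\ setT (y *+ m - x)], 1%N, setT; split=> //; exact: filterT.
- move=> _ _ [d [V [d0 nV ->]]] [e [W [e0 nW ->]]].
  exists [set y | mulset M (d * e) y /\ (V `&` W) (y *+ m - x)].
    by exists (d * e)%N, (V `&` W); split=> //; [rewrite muln_gt0 d0|exact: filterI].
  move=> y [hy [Vy Wy]]; split; split=> //; first exact: mulset_sub hy.
  by apply: (@mulset_sub e d); rewrite mulnC.
- move=> _ [d [V [d0 nV ->]]].
  have dm : (0 < d * m)%N by rewrite muln_gt0 d0.
  have /closureP/(_ V nV)[_ [z Mz ->] Vz] := Dx _ dm.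
  exists (z *+ d); split; first by exists z.
  by rewrite -mulrnA.
have PF : ProperFilter F by exact: ultra_proper.
have [|l Dl hl] := @divpart_lim _ F id UF.
  have nT : nbhs (0 : K) setT by exact: filterT.
  move=> d d0; have := hF _ (ex_intro _ d (ex_intro _ setT (And3 d0 nT erefl))).
  by apply: filterS => y [].
exists l => //; apply: (tolim_unique hK PF (tolimMn m _ hl)).
move=> V nV; have := hF _ (ex_intro _ 1%N (ex_intro _ V (And3 isT nV erefl))).
by apply: filterS => y [].
Qed.

End DivisiblePart.

(** * Primary components *)

(* Converges to the idempotent of the p-component in the profinite integers. *)
Definition pmult (p j : nat) : nat := chinese (p ^ j) ((j`!)`_(p^')%N) 1 0.

Section Multipliers.
Variables (p d j : nat).
Hypotheses (pp : prime p) (d0 : (0 < d)%N) (dj : (d <= j)%N).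

Let cop : coprime (p ^ j) ((j`!)`_(p^')%N).
Proof.
apply: (@pnat_coprime (p : nat_pred)); last exact: part_pnat.
by rewrite pnatX pnat_id.
Qed.

Lemma pmult_p : pmult p j = 1 %[mod d`_p].
Proof.
have dv : (d`_p %| p ^ j)%N.
  by rewrite p_part dvdn_exp2l // (leq_trans _ dj) // ltnW // ltn_logl.
by have := chinese_modl cop 1 0 => e; rewrite -(modn_dvdm _ dv) e modn_dvdm.
Qed.

Lemma pmult_p' : (d`_(p^')%N %| pmult p j)%N.
Proof.
have dv : (d`_(p^')%N %| (j`!)`_(p^')%N)%N.
  by apply: partn_dvd; [exact: fact_gt0|apply: dvdn_fact; rewrite d0].
apply: dvdn_trans dv _; have := chinese_modr cop 1 0; rewrite mod0n => e.
by rewrite /dvdn /pmult e.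
Qed.
End Multipliers.

Lemma pmult_mod p d j j' : prime p -> (0 < d)%N -> (d <= j)%N -> (d <= j')%N ->
  pmult p j = pmult p j' %[mod d].
Proof.
move=> pp d0 dj dj'; apply/eqP; rewrite -{1 2}(partnC p d0).
rewrite chinese_remainder; last exact: coprime_partC.
rewrite (pmult_p pp d0 dj) (pmult_p pp d0 dj') eqxx /=.
have /eqP -> := pmult_p' pp d0 dj; by have /eqP -> := pmult_p' pp d0 dj'.
Qed.

(** Checked on the l-part of d for each prime l dividing d: the term q = l is 1 there and all other
    terms are 0. *)
Lemma pmult_sum d n j : (0 < d)%N -> (d < n)%N -> (d <= j)%N ->
  \sum_(q < n | prime q) pmult q j = 1 %[mod d].
Proof.
move=> d0 dn dj; set r := (\sum_(q < n | prime q) pmult q j)%N.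
have key l : l \in \pi(d) -> r = 1 %[mod d`_l].
  move=> /= ld; have pl : prime l by move: ld; rewrite mem_primes => /andP[].
  have ln : (l < n)%N.
    by move: ld; rewrite mem_primes => /and3P[_ _ /dvdn_leq h]; rewrite (leq_ltn_trans (h d0)).
  rewrite /r (bigD1 (Ordinal ln)) //= -modnDm (pmult_p pl d0 dj).
  have -> : ((\sum_(i < n | prime i && (i != Ordinal ln)) pmult i j) %% d`_l = 0)%N.
    apply/eqP; apply: dvdn_sum => i /andP[pi il].
    apply: dvdn_trans (pmult_p' pi d0 dj).
    have <- : (d`_((i : nat)^')`_l = d`_l)%N.
      apply: partn_part => k; rewrite !inE /= => /eqP->.
      by rewrite eq_sym; rewrite -val_eqE /= in il.
    exact: dvdn_part.
  by rewrite addn0 modn_mod.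
have [d1|d1] := leqP d 1%N.
  have -> : d = 1%N by lia.
  by rewrite !modn1.
have r0 : (0 < r)%N.
  rewrite lt0n; apply/eqP => e; have ld : pdiv d \in \pi(d) by rewrite pi_pdiv.
  have := key _ ld; rewrite e mod0n modn_small //.
  by rewrite p_part_gt1.
apply/eqP; rewrite eqn_mod_dvd //; apply/dvdn_partP => // l /key/eqP.
by rewrite eqn_mod_dvd.
Qed.

Section Profinite.
Variable K : topologicalZmodType.
Hypothesis hK : hausdorff_space K.
Hypothesis cK : complete_group K.

Lemma tolim_eq (T : Type) (F : set_system T) (f g : T -> K) l :
  f =1 g -> tolim F f l -> tolim F g l.
Proof. by move=> /funext ->. Qed.

(** The multiples of x tend to 0 in the p-adic sense. This form is plainly stable under differences
    and p-power roots; for prime p it agrees with [quasi_p_torsion], by [quasi_torsion_Qp] and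
    [Qp_quasi_torsion]. *)
Definition Qp (p : nat) (x : K) : Prop :=
  forall V, nbhs (0 : K) V -> exists t : nat, forall j : nat, V (x *+ (p ^ t * j)).

(** The default 0 is irrelevant on the subgroups C below, where the limit exists by [primcompP]. *)
Definition primcomp (p : nat) (x : K) : K :=
  xget 0 [set y | tolim \oo (fun j => x *+ pmult p j) y].

Lemma Mn_mod (W C : set K) d a b x : subgroup C -> (forall x, W x -> W (- x)) ->
  (forall x, C x -> W (x *+ d)) -> C x -> a = b %[mod d] -> W (x *+ a - x *+ b).
Proof.
move=> sC WN hd; wlog ab : a b / (b <= a)%N.
  move=> h Cx e; have [l|l] := leqP b a; first exact: h.
  by rewrite -opprB; apply: WN; apply: h => //; exact: ltnW.
move=> Cx /eqP; rewrite eqn_mod_dvd // => /dvdnP[k e].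
rewrite -mulrnBr // e mulrnA; apply: hd; exact: subgroupMn.
Qed.

Lemma Qp_coprime_divisible p q x : prime p -> (0 < q)%N -> coprime p q -> Qp p x ->
  closure [set z | exists m, z = x *+ m *+ q] x.
Proof.
move=> pp q0 cpq Qx; apply/closureP => V nV; have [W [nW WV WN]] := nb_sym nV.
have [t ht] := Qx W nW.
have cq : coprime q (p ^ t) by rewrite coprime_sym coprimeXl.
case: (egcdnP (p ^ t) q0) => km kn; rewrite (eqP cq) => ek _.
exists (x *+ km *+ q); first by exists km.
apply: WV; rewrite -mulrnA ek mulrnDr mulr1n addrK mulnC.
exact: ht.
Qed.

Lemma Qp_sub p x y : Qp p x -> Qp p y -> Qp p (x - y).
Proof.
move=> Qx Qy V nV; have [W [nW W0 WN fW]] := nb_fold 2 nV.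
have [t ht] := Qx W nW; have [s hs] := Qy W nW.
exists (t + s)%N => j; apply: fW; rewrite mulrnBl; apply: (@foldB _ _ 1 1) => //; apply: fold1.
  by rewrite expnD -mulnA; exact: ht.
by rewrite addnC expnD -mulnA; exact: hs.
Qed.

Lemma Qp_root p k x : Qp p (x *+ p ^ k) -> Qp p x.
Proof.
move=> Qx V nV; have [t ht] := Qx V nV; exists (k + t)%N => j.
by rewrite expnD -mulnA mulrnA; exact: ht.
Qed.

Variable C : set K.
Hypotheses (clC : closed C) (sC : subgroup C).
Hypothesis pfC : forall V, nbhs (0 : K) V ->
  exists2 d, (0 < d)%N & forall x, C x -> V (x *+ d).

Lemma primcompP p x : prime p -> C x -> tolim \oo (fun j => x *+ pmult p j) (primcomp p x).
Proof.
move=> pp Cx; rewrite /primcomp; case: xgetP => [y _ //|nx].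
have [|l hl] := @complete_seq K cK (fun j => x *+ pmult p j); last by case: (nx l).
move=> V nV; have [W [nW WV WN]] := nb_sym nV; have [d d0 hd] := pfC nW.
exists d => m n dm dn; apply: WV; apply: (Mn_mod sC WN hd) => //.
exact: pmult_mod.
Qed.

Lemma primcomp_in p x : prime p -> C x -> C (primcomp p x).
Proof.
move=> pp Cx; apply: (tolim_closed _ clC) (primcompP pp Cx).
by apply: filterS filterT => j _ /=; exact: subgroupMn.
Qed.

(** [pmult p i] is divisible by the prime-to-p part of d, so only the p-part of d remains to be
    supplied, and one t serves all x. *)
Lemma primcomp_Qp_uniform p V : prime p -> nbhs (0 : K) V ->
  exists t : nat, forall x j, C x -> V (primcomp p x *+ (p ^ t * j)).
Proof.
move=> pp nV; have [W [nW W0 WN fW]] := nb_fold 2 nV.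
have [d d0 hd] := pfC nW; exists (logn p d) => x j Cx; apply: fW.
set N := (p ^ logn p d * j)%N.
have h : tolim \oo (fun i => x *+ pmult p i *+ N) (primcomp p x *+ N).
  exact: tolimMn (primcompP pp Cx).
have [i [/= h1 h2]] := filterI_ex _ (h W nW) (ex_intro2 _ _ d I (fun k (dk : (d <= k)%N) => dk) : (\oo : set_system nat) [set k | (d <= k)%N]).
have [k ek] : exists k, (pmult p i * N = k * d)%N.
  apply/dvdnP; rewrite /N -p_part mulnCA -{1}(partnC p d0).
  by apply: dvdn_mul => //; apply: dvdn_mulr; exact: pmult_p'.
have -> : primcomp p x *+ N = x *+ pmult p i *+ N - (x *+ pmult p i *+ N - primcomp p x *+ N) by zmod.
apply: (@foldB _ _ 1 1) => //; apply: fold1 => //.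
by rewrite -mulrnA ek mulrnA; apply: hd; exact: subgroupMn.
Qed.

Lemma primcomp_Qp p x : prime p -> C x -> Qp p (primcomp p x).
Proof.
by move=> pp Cx V nV; have [t ht] := primcomp_Qp_uniform pp nV; exists t => j; exact: ht.
Qed.

Lemma primcomp_closed p x (S : set K) : prime p -> C x -> closed S -> subgroup S ->
  S x -> S (primcomp p x).
Proof.
move=> pp Cx cS sS Sx; apply: (tolim_closed _ cS) (primcompP pp Cx).
by apply: filterS filterT => j _ /=; exact: subgroupMn.
Qed.

Lemma primcomp_compl p k x : prime p -> C x ->
  closure [set z | exists2 y, C y & z = y *+ p ^ k] (x - primcomp p x).
Proof.
move=> pp Cx.
have h : tolim \oo (fun j => x - x *+ pmult p j) (x - primcomp p x).
  by apply: tolimB (primcompP pp Cx); exact: tolim_cst.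
apply: (tolim_closure _ _ h); exists (p ^ k)%N => // j /= kj.
have e : pmult p j = 1 %[mod p ^ k].
  have := @pmult_p p (p ^ k) j pp; rewrite expn_gt0 prime_gt0 // => /(_ isT kj).
  by rewrite part_pnat_id // pnatX pnat_id.
have [l|l] := leqP 1 (pmult p j).
  move/eqP: e; rewrite eqn_mod_dvd // => /dvdnP[m em].
  exists (- (x *+ m)); first by apply: subgroupN => //; exact: subgroupMn.
  by rewrite mulNrn -mulrnA -em mulrnBr // mulr1n opprB.
(* A multiplier 0 is congruent to 1 modulo p^k only when p^k = 1. *)
have e0 : pmult p j = 0%N by lia.
rewrite e0 mod0n in e *; have pk0 : (0 < p ^ k)%N by rewrite expn_gt0 prime_gt0.
have pk1 : (p ^ k = 1)%N.
  by apply/eqP; move: e pk0; case: (p ^ k)%N => [|[|m]].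
by exists x; rewrite // pk1 mulr0n subr0 mulr1n.
Qed.

Lemma primcomp_sum x : C x ->
  tolim \oo (fun n => \sum_(q < n | prime q) primcomp q x) x.
Proof.
move=> Cx V nV; have [W [nW W0 WN fW]] := nb_fold 2 nV.
have [d d0 hd] := pfC nW; exists d.+1 => // n /= dn; apply: fW.
have h : tolim \oo (fun j => \sum_(q < n | prime q) x *+ pmult q j) (\sum_(q < n | prime q) primcomp q x).
  elim: (index_enum _) => [|q s IH].
    by rewrite big_nil; apply: (tolim_eq _ (tolim_cst 0 _)) => j; rewrite big_nil.
  rewrite big_cons; case: (boolP (prime q)) => pq; last first.
    by apply: (tolim_eq _ IH) => j; rewrite big_cons (negbTE pq).
  by apply: (tolim_eq _ (tolimD _ (primcompP pq Cx) IH)) => j; rewrite big_cons pq.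
have [j [/= h1 h2]] := filterI_ex _ (h W nW) (ex_intro2 _ _ d I (fun k (dk : (d <= k)%N) => dk) : (\oo : set_system nat) [set k | (d <= k)%N]).
set S := \sum_(q < n | prime q) primcomp q x in h1 *.
have -> : S - x = (x *+ \sum_(q < n | prime q) pmult q j - x *+ 1)
   - (\sum_(q < n | prime q) x *+ pmult q j - S) by rewrite -sumrMnr; zmod.
apply: (@foldB _ _ 1 1) => //; apply: fold1 => //.
by apply: (Mn_mod sC WN hd) => //; exact: pmult_sum.
Qed.

End Profinite.

(** * Quasi-torsion elements *)

Section MinimalBase.
Variable X : topologicalZmodType.

Lemma group_base_add (B : set (set X)) A : group_base B -> B A ->
  exists2 A1, B A1 & [/\ A1 `<=` A, forall x y, A1 x -> A1 y -> A (x + y) &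
    forall x y, A1 x -> A1 y -> A (x - y)].
Proof.
move=> [_ _ BB B0] BA; have [A2 BA2 h2] := BB _ BA; have [A1 BA1 h1] := BB _ BA2.
have s12 x : A1 x -> A2 x by move=> Ax; rewrite -[x]subr0; apply: h1 => //; exact: B0.
have s2 x : A2 x -> A x by move=> Ax; rewrite -[x]subr0; apply: h2 => //; exact: B0.
exists A1 => //; split=> [x /s12/s2//|x y Ax Ay|x y Ax Ay].
  rewrite -[y]opprK; apply: h2; first exact: s12.
  by rewrite -sub0r; apply: h1 => //; exact: B0.
by apply: h2; exact: s12.
Qed.

Lemma minimal_group_base : minimal_group X -> minimal_base X.
Proof.
move=> [hX mX] B gB Bnb Bsep V nV; have [[A0 BA0] BI BB B0] := gB.
pose tau : set (set X) := [set U | forall x, U x -> exists2 A, B A & forall y, A (y - x) -> U y].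
(* The interior of x + A' in the topology generated by B; members of a base at 0 need not be
   open. *)
pose I x A' : set X := [set z | exists2 A, B A & forall w, A (w - z) -> A' (w - x)].
have Itau x A' : tau (I x A').
  move=> z [A BA hA]; have [A1 BA1 [sA1 dA1 _]] := group_base_add gB BA.
  exists A1 => // y Ay; exists A1 => // w Aw; apply: hA.
  have -> : w - z = (w - y) + (y - z) by zmod. exact: dA1.
have Ix x A' : B A' -> I x A' x by exists A'.
have Is x A' z : I x A' z -> A' (z - x).
  by move=> [A BA]; apply; rewrite subrr; exact: B0.
have gtau : group_topology tau.
  split.
  - by move=> x _; exists A0.
  - move=> U1 U2 t1 t2 x [/t1[A1 BA1 h1] /t2[A2 BA2 h2]].
    have [A BA sA] := BI _ _ BA1 BA2; exists A => // y /sA[a1 a2].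
    by split; [exact: h1|exact: h2].
  - move=> J f tf x [j _ fx]; have [A BA hA] := tf j x fx.
    by exists A => // y /hA fy; exists j.
  - move=> x y U tU Uxy; have [A BA hA] := tU _ Uxy.
    have [A1 BA1 [_ dA1 _]] := group_base_add gB BA.
    exists (I x A1), (I y A1); split=> //; [exact: Ix|exact: Ix|].
    move=> a b /Is ha /Is hb; apply: hA.
    have -> : a + b - (x + y) = (a - x) + (b - y) by zmod. exact: dA1.
  - move=> U tU x /tU[A BA hA]; have [A1 BA1 h1] := BB _ BA.
    exists A1 => // y Ay; apply: hA.
    have -> : - y - - x = 0 - (y - x) by zmod.
    by apply: h1 => //; exact: B0.
have htau : hausdorff_topology tau.
  move=> x y xy; have [A BA nA] : exists2 A, B A & ~ A (x - y).
    apply: contrapT => nex; apply: xy; apply/eqP; rewrite -subr_eq0; apply/eqP.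
    by apply: Bsep => A BA; apply: contrapT => nA; apply: nex; exists A.
  have [A1 BA1 [_ _ h1]] := group_base_add gB BA.
  exists (I x A1), (I y A1); split=> //; [exact: Ix|exact: Ix|].
  rewrite -subset0 => z [/Is zx /Is zy]; apply: nA.
  have -> : x - y = (z - y) - (z - x) by zmod. exact: h1.
have eqt : tau = open.
  apply: mX => // U tU; apply/open_interiorP => x /tU[A BA hA].
  by exists A => //; exact: Bnb.
have [O [[oO O0] OV]] : exists O : set X, (open O /\ O 0) /\ O `<=` V.
  by move: nV; rewrite nbhsE => -[O [oO O0] OV]; exists O.
have [A BA hA] : exists2 A, B A & forall y, A (y - 0) -> O y.
  by move: oO; rewrite -eqt => /(_ 0 O0).
by exists A => // y Ay; apply: OV; apply: hA; rewrite subr0.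
Qed.
End MinimalBase.

Section QuasiTorsion.
Variable K : topologicalZmodType.
Hypothesis hK : hausdorff_space K.

Lemma Qp_int p (x : K) V : nbhs (0 : K) V -> (forall x, V x -> V (- x)) -> Qp p x ->
  exists t : nat, forall z : int, ((p ^ t)%N%:Z %| z)%Z -> V (x *~ z).
Proof.
move=> nV VN Qx; have [t ht] := Qx V nV; exists t => z /dvdzP[q ->].
case: q => q; first by rewrite -PoszM mulnC; exact: ht.
by rewrite NegzE mulNr -PoszM mulrNz mulnC; apply: VN; exact: ht.
Qed.

Lemma generated_cyclic (x : K) : generated_subgroup [set x] = [set y | exists z : int, y = x *~ z].
Proof.
rewrite eqEsubset; split=> y.
  move=> h; apply: (h [set y | exists z : int, y = x *~ z]); split.
    split; first by exists 0; rewrite mulr0z.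
    by move=> a b [z1 ->] [z2 ->]; exists (z1 - z2); rewrite mulrzBr.
  by move=> _ ->; exists 1; rewrite mulr1z.
by move=> [z ->] S [sS Sx]; apply: subgroupMz => //; exact: Sx.
Qed.

Lemma quasi_torsion_Qp p (x : K) : quasi_p_torsion p x -> Qp p x.
Proof.
move=> [[n [_ xn _]] V nV|[f [[finj fopen] frange]] V nV].
  by exists n => j; rewrite mulrnA xn mul0rn; exact: nb0.
have [a _ ea] : range f x.
  by rewrite frange generated_cyclic; exists 1; rewrite mulr1z.
have [O [[oO O0] OV]] : exists O : set K, (open O /\ O 0) /\ O `<=` V.
  by move: nV; rewrite nbhsE => -[O [oO O0] OV]; exists O.
have oA : open (f @^-1` O) by apply/fopen; exists O.
have := oA : padic_open (f @^-1` O).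
move=> /(_ 0); rewrite /= raddf0 => /(_ O0)[t ht]; exists t => j; apply: OV.
rewrite -ea -raddfMn; apply: ht; rewrite subr0.
have -> : ((a : int) *+ (p ^ t * j) : int) = (a *+ j) * (p ^ t)%N%:Z.
  by rewrite mulnC mulrnA -[LHS]mulr_natr natz.
exact: dvdz_mull.
Qed.

(** The gcd of r and p^s is a power p^e, and e <= t since p^t does not divide r; Bezout then reaches
    p^t. *)
Lemma mod_solve p t s r : prime p -> ~~ (p ^ t %| r)%N ->
  exists m, (m * r = p ^ t %[mod p ^ s])%N.
Proof.
move=> pp nd; have r0 : (0 < r)%N by rewrite lt0n; apply: contra nd => /eqP->; rewrite dvdn0.
case: (egcdnP (p ^ s) r0) => km kn ek _.
have /(dvdn_pfactor _ _ pp)[e _ ee] := dvdn_gcdr r (p ^ s).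
have et : (e <= t)%N.
  rewrite leqNgt; apply: contra nd => te.
  by apply: dvdn_trans (dvdn_gcdl r (p ^ s)); rewrite ee dvdn_exp2l // ltnW.
exists (p ^ (t - e) * km)%N; rewrite -mulnA ek ee mulnDr -expnD subnK //.
by rewrite mulnA modnMDl.
Qed.

(** If no p^n x vanishes, each t has a neighbourhood V such that z x in V forces p^t to divide z.
    Otherwise [mod_solve] would turn small multiples z x into p^t x, which would be arbitrarily
    small, hence 0. So the topology of the cyclic group of x is finer than the p-adic one, and by
    [Qp_int] it is also coarser. *)
Lemma Qp_quasi_torsion p (x : K) : prime p -> Qp p x -> quasi_p_torsion p x.
Proof.
move=> pp Qx; have p0 := prime_gt0 pp; have pe e : (0 < p ^ e)%N by rewrite expn_gt0 p0.
have [[n xn]|nt] := pselect (exists n, x *+ p ^ n = 0).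
  left; have ex : exists n, `[< x *+ p ^ n = 0 >] by exists n; apply/asboolP.
  pose e := ex_minn ex; exists e.
  have [/asboolP xe emin] : `[< x *+ p ^ e = 0 >] /\ forall m, `[< x *+ p ^ m = 0 >] -> (e <= m)%N.
    by rewrite /e; case: ex_minnP.
  split=> // j /andP[j0 je] xj.
  case: (egcdnP (p ^ e) j0) => km kn ek _.
  have /(dvdn_pfactor _ _ pp)[g _ eg] := dvdn_gcdr j (p ^ e).
  have : x *+ p ^ g = 0.
    have : x *+ (km * j) = 0 by rewrite mulnC mulrnA xj mul0rn.
    by rewrite ek eg mulrnDr mulnC mulrnA xe mul0rn add0r.
  move=> /asboolP/emin ge.
  have : (p ^ e %| j)%N.
    by apply: dvdn_trans (dvdn_gcdl j (p ^ e)); rewrite eg dvdn_exp2l.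
  by move=> /(dvdn_leq j0); rewrite leqNgt je.
have sep t : exists2 V, nbhs (0 : K) V & forall z : int, V (x *~ z) -> ((p ^ t)%N%:Z %| z)%Z.
  apply: contrapT => nex; apply: nt; exists t.
  apply: (nb_separate hK) => V nV; have [W [nW W0 WN fW]] := nb_fold 2 nV.
  have [s hs] := Qp_int nW WN Qx.
  have [W' [nW' W'0 W'N fW']] := nb_fold (p ^ s) nW.
  have [z Wz nz] : exists2 z : int, W' (x *~ z) & ~ ((p ^ t)%N%:Z %| z)%Z.
    apply: contrapT => h; apply: nex; exists W' => // z Wz.
    by apply: contrapT => nz; apply: h; exists z.
  wlog z0 : z Wz nz / 0 <= z.
    move=> h; have [l|l] := lerP 0 z; first exact: (h z).
    apply: (h (- z)); last by rewrite oppr_ge0 ltW.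
      by rewrite mulrNz; exact: W'N.
    by rewrite rpredN.
  have [m em] : exists m, (m * absz z = p ^ t %[mod p ^ s])%N.
    by apply: mod_solve => //; apply/negP => h; apply: nz; rewrite /dvdz.
  pose m' := (m %% p ^ s)%N.
  have em' : (m' * absz z = p ^ t %[mod p ^ s])%N by rewrite modnMml.
  have h1 : W (x *~ z *+ m').
    apply: fW'; apply: (fold_mono W'0 _ (foldMn m' Wz)); rewrite ltnW // ltn_pmod //.
  have h2 : W (x *~ ((p ^ t)%N%:Z - (m' * absz z)%N%:Z)).
    apply: hs; rewrite -eqz_mod_dvd; apply/eqP; rewrite !modz_nat; congr Posz.
    by rewrite em'.
  apply: fW; have -> : x *+ p ^ t = x *~ z *+ m' + x *~ ((p ^ t)%N%:Z - (m' * absz z)%N%:Z).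
    rewrite mulrzBr PoszM gez0_abs // mulrC mulrzA -!pmulrn.
    by rewrite addrC subrK.
  by apply: (@foldD _ _ 1 1); exact: fold1.
right; pose f (z : padic_int p) : K := x *~ (z : int).
have fB : zmod_morphism f by move=> a b; rewrite /f mulrzBr.
pose fA := GRing.isZmodMorphism.Build _ _ f fB.
pose F : {additive padic_int p -> K} := HB.pack f fA.
exists F; split; last first.
  rewrite generated_cyclic eqEsubset; split=> y; first by move=> [z _ <-]; exists z.
  by move=> [z ->]; exists z.
have inj : injective F.
  move=> a b e; apply/eqP; rewrite -subr_eq0; apply/negP => /negP ab.
  have xz : x *~ ((a : int) - b) = 0 by rewrite mulrzBr; apply/eqP; rewrite subr_eq0; apply/eqP.
  have dv t : ((p ^ t)%N%:Z %| (a : int) - b)%Z.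
    by have [V nV hV] := sep t; apply: hV; rewrite xz; exact: nb0.
  have := dv (absz ((a : int) - b)); rewrite /dvdz /= => /dvdn_leq h.
  have : (0 < absz ((a : int) - b)%R)%N by rewrite absz_gt0.
  move=> /h; rewrite leqNgt ltn_expl // prime_gt1 //.
split=> // A; split=> [oA|[B oB ->]].
  (* The largest open set whose inverse image under f is contained in A. *)
  pose B := \bigcup_(O in [set O : set K | open O /\ f @^-1` O `<=` A]) O.
  exists B; first by apply: bigcup_open => O [].
  rewrite eqEsubset; split=> [z Az|z [O [oO OA] Oz]]; last exact: OA.
  have [t ht] := (oA : padic_open A) z Az; have [V nV hV] := sep t.
  have [O [[oO O0] OV]] : exists O : set K, (open O /\ O (f z)) /\ O `<=` [set y | V (y - f z)].
    have : nbhs (f z) [set y | V (y - f z)] by apply/nb_shiftB; exists V.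
    by rewrite nbhsE => -[O [oO O0] OV]; exists O.
  exists O => //; split=> // y Oy; apply: ht; apply: hV.
  by rewrite mulrzBr; apply: (OV (f y)).
move=> z Bz; have /open_interiorP/(_ _ Bz)[V nV hV] := oB.
have [W [nW WV WN]] := nb_sym nV.
have [t ht] := Qp_int nW WN Qx; exists t => y dy; apply: hV; apply: WV.
by rewrite /= /f -mulrzBr; exact: ht.
Qed.
End QuasiTorsion.

(** * Essential density of G in its completion *)

Section Essential.
Variables (G K : topologicalZmodType) (i : {additive G -> K}).
Hypothesis hK : hausdorff_space K.
Hypotheses (emb : top_embedding i) (dns : dense (range i)).
Hypothesis mP : minimal_group (topprod (fun _ : nat => G)).
Local Notation P := (topprod (fun _ : nat => G)).

Lemma embedding_nb V : nbhs (0 : K) V -> nbhs (0 : G) [set g | V (i g)].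
Proof.
rewrite nbhsE => -[O [oO O0] OV].
have oA : open (i @^-1` O) by apply/emb.2; exists O.
apply: filterS (open_nbhs_nbhs (conj oA _)) => [g /OV//|].
by rewrite /= raddf0.
Qed.

Lemma dense_approx x V : nbhs (0 : K) V -> exists g, V (i g - x).
Proof.
move=> nV; have : nbhs x [set y | V (y - x)] by apply/nb_shiftB; exists V.
rewrite nbhsE => -[O [oO Ox] OV].
have [y [Oy [g _ gy]]] := dns (ex_intro _ x Ox) oO.
by exists g; rewrite gy; exact: OV.
Qed.

Lemma proj_nb n (V : set G) : nbhs (0 : G) V -> nbhs (0 : P) [set f : P | V (f n)].
Proof.
move=> nV.
exact: (@proj_continuous _ (fun _ : nat => G : topologicalType) n (0 : P) V nV).
Qed.

Lemma box_nb m V : nbhs (0 : K) V ->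
  nbhs (0 : P) [set f : P | forall n, (n < m)%N -> V (i (f n))].
Proof.
move=> nV; elim: m => [|m IH]; first by apply: filterS filterT.
apply: filterS2 IH (proj_nb m (embedding_nb nV)) => f h1 h2 n.
by rewrite ltnS leq_eqVlt => /orP[/eqP->|/h1].
Qed.

Let iinj : injective i. Proof. exact: emb.1. Qed.

Let i_eq0 g : i g = 0 -> g = 0.
Proof. by move=> h; apply: iinj; rewrite h raddf0. Qed.

(** A coarser base on K is traced on coordinate 0 of G^omega, the other coordinates keeping their
    topology. Minimality gives A with the trace of A on G inside V, and density of G carries the
    inclusion over to K with a smaller A and a larger V. *)
Lemma completion_minimal_base : minimal_base K.
Proof.
move=> B gB Bnb Bsep V0 nV0; have [[A0 BA0] BI BB B0] := gB.
have [V [nV _ VN fV]] := nb_fold 2 nV0.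
pose O (A V : set K) m := [set f : P | A (i (f 0%N)) /\ forall n, (0 < n < m)%N -> V (i (f n))].
pose B' := [set X : set P | exists A V m, [/\ B A, nbhs (0 : K) V & X = O A V m]].
have gB' : group_base B'.
  split.
  - by exists (O A0 setT 0%N), A0, setT, 0%N; split=> //; exact: filterT.
  - move=> _ _ [A1 [V1 [m1 [BA1 nV1 ->]]]] [A2 [V2 [m2 [BA2 nV2 ->]]]].
    have [A BA hA] := BI _ _ BA1 BA2.
    exists (O A (V1 `&` V2) (maxn m1 m2)).
      by exists A, (V1 `&` V2), (maxn m1 m2); split=> //; exact: filterI.
    move=> f [/hA[h1 h2] h]; split; split=> // n /andP[n0 nm].
      have hn : (0 < n < maxn m1 m2)%N by rewrite n0 leq_max nm.
      by have [] := h n hn.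
    have hn : (0 < n < maxn m1 m2)%N by rewrite n0 leq_max nm orbT.
    by have [] := h n hn.
  - move=> _ [A [V1 [m [BA nV1 ->]]]]; have [A' BA' hA'] := BB _ BA.
    have [W [nW W0 WN fW]] := nb_fold 2 nV1.
    exists (O A' W m); first by exists A', W, m.
    move=> f g [hf1 hf2] [hg1 hg2]; split.
      by rewrite -[(f - g) 0%N]/(f 0%N - g 0%N) raddfB; exact: hA'.
    move=> n nm; rewrite -[(f - g) n]/(f n - g n) raddfB; apply: fW.
    by apply: (@foldB _ _ 1 1) => //; apply: fold1; [exact: hf2|exact: hg2].
  - move=> _ [A [V1 [m [BA nV1 ->]]]]; split=> [|n _].
      by rewrite -[(0 : P) 0%N]/(0 : G) raddf0; exact: B0.
    by rewrite -[(0 : P) n]/(0 : G) raddf0; exact: nb0.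
have [||X [A [V1 [m [BA nV1 ->]]]] hX] := minimal_group_base mP gB' _ _
   (box_nb 1 (V := V) nV).
- move=> _ [A [V1 [m [BA nV1 ->]]]].
  apply: filterS2 (proj_nb 0 (embedding_nb (Bnb _ BA))) (box_nb m nV1) => f h1 h2.
  by split=> // n /andP[_]; exact: h2.
- move=> f hf; apply: functional_extensionality_dep => n; apply: i_eq0.
  case: n => [|n].
    apply: Bsep => A BA.
    by have [] := hf _ (ex_intro _ A (ex_intro _ setT (ex_intro _ 0%N (And3 BA filterT erefl)))).
  apply: (nb_separate hK) => W nW.
  have [_ h] := hf _ (ex_intro _ A0 (ex_intro _ W (ex_intro _ n.+2 (And3 BA0 nW erefl)))).
  by apply: h => /=.
have AV g : A (i g) -> V (i g).
  move=> Ag; pose f : P := fun n => if n == 0%N then g else 0.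
  have : O A V1 m f.
    by split=> // -[//|n] _; rewrite /f /= raddf0; exact: nb0.
  by move=> /hX/(_ 0%N isT).
have [A1 BA1 [_ dA1 _]] := group_base_add gB BA.
exists A1 => // x Ax.
have [g [Ag Vg]] : exists g, (A1 `&` V) (i g - x).
  by apply: dense_approx; apply: filterI => //; exact: Bnb.
apply: fV; have -> : x = i g - (i g - x) by zmod.
apply: (@foldB _ _ 1 1) => //; apply: fold1 => //; apply: AV.
have -> : i g = x + (i g - x) by zmod.
exact: dA1.
Qed.

(** The traces on G^omega of the sets Zx + box, with x regarded as a point of K^omega, form a
    coarser base. If the closure of Zx met G^omega only in 0, this base would be separated, hence a
    base of the product topology. But points of G^omega close to x lie in these sets, while their
    coordinate n0 stays away from 0. *)
Lemma essential (x : nat -> K) n0 : x n0 <> 0 -> exists f : nat -> G,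
  (exists n, f n <> 0) /\ forall V m, nbhs (0 : K) V ->
    exists j : int, forall n, (n < m)%N -> V (i (f n) - x n *~ j).
Proof.
move=> xn0; apply: contrapT => nex.
pose O (V : set K) m := [set f : P | exists j : int, forall n, (n < m)%N -> V (i (f n) - x n *~ j)].
pose B' := [set X : set P | exists V m, nbhs (0 : K) V /\ X = O V m].
have gB' : group_base B'.
  split.
  - by exists (O setT 0%N), setT, 0%N; split=> //; exact: filterT.
  - move=> _ _ [V1 [m1 [nV1 ->]]] [V2 [m2 [nV2 ->]]].
    exists (O (V1 `&` V2) (maxn m1 m2)).
      by exists (V1 `&` V2), (maxn m1 m2); split=> //; exact: filterI.
    move=> f [j hj]; split; exists j => n nm.
      have hn : (n < maxn m1 m2)%N by rewrite leq_max nm.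
      by have [] := hj n hn.
    have hn : (n < maxn m1 m2)%N by rewrite leq_max nm orbT.
    by have [] := hj n hn.
  - move=> _ [V1 [m [nV1 ->]]]; have [W [nW W0 WN fW]] := nb_fold 2 nV1.
    exists (O W m); first by exists W, m.
    move=> f g [j hj] [j' hj']; exists (j - j') => n nm; apply: fW.
    have -> : i ((f - g) n) - x n *~ (j - j') = (i (f n) - x n *~ j) - (i (g n) - x n *~ j').
      by rewrite -[(f - g) n]/(f n - g n) raddfB mulrzBr; zmod.
    by apply: (@foldB _ _ 1 1) => //; apply: fold1; [exact: hj|exact: hj'].
  - move=> _ [V1 [m [nV1 ->]]]; exists 0 => n _.
    by rewrite -[(0 : P) n]/(0 : G) raddf0 mulr0z subrr; exact: nb0.
have [V nV Vx] := nb_avoid hK xn0; have [W [nW W0 WN fW]] := nb_fold 2 nV.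
have [||X [V1 [m [nV1 ->]]] hX] := minimal_group_base mP gB' _ _ (box_nb n0.+1 nW).
- move=> _ [V1 [m [nV1 ->]]]; apply: filterS (box_nb m nV1) => f hf.
  by exists 0 => n nm; rewrite mulr0z subr0; exact: hf.
- move=> f hf; apply: functional_extensionality_dep => n; apply: contrapT => fn.
  apply: nex; exists f; split; first by exists n.
  by move=> V1 m nV1; apply: (hf (O V1 m)); exists V1, m.
have /choice[f hf] : forall n, exists g, (V1 `&` W) (i g - x n).
  by move=> n; apply: dense_approx; exact: filterI.
have : O V1 m f by exists 1 => n _; rewrite mulr1z; have [] := hf n.
move=> /hX/(_ n0 (ltnSn n0)) Wf; apply: Vx; apply: fW.
have -> : x n0 = i (f n0) - (i (f n0) - x n0) by zmod.
by apply: (@foldB _ _ 1 1) => //; apply: fold1 => //; have [] := hf n0.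
Qed.

Lemma essential_ultra (x : nat -> K) n0 : x n0 <> 0 ->
  exists (f : nat -> G) (F : set_system int), [/\ UltraFilter F, exists n, f n <> 0 &
    forall n, tolim F (fun j => x n *~ j) (i (f n))].
Proof.
move=> /essential[f [fn hf]].
have [|||F [UF hF]] := @ultra_from_base int [set A | exists V m, nbhs (0 : K) V /\
   A = [set j : int | forall n, (n < m)%N -> V (i (f n) - x n *~ j)]].
- by exists [set j : int | forall n, (n < 0)%N -> setT (i (f n) - x n *~ j)], setT, 0%N; split=> //; exact: filterT.
- move=> _ _ [V1 [m1 [nV1 ->]]] [V2 [m2 [nV2 ->]]].
  exists [set j : int | forall n, (n < maxn m1 m2)%N -> (V1 `&` V2) (i (f n) - x n *~ j)].
    by exists (V1 `&` V2), (maxn m1 m2); split=> //; exact: filterI.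
  move=> j hj; split=> n nm.
    have hn : (n < maxn m1 m2)%N by rewrite leq_max nm.
    by have [] := hj n hn.
  have hn : (n < maxn m1 m2)%N by rewrite leq_max nm orbT.
  by have [] := hj n hn.
- by move=> _ [V [m [nV ->]]]; have [j hj] := hf V m nV; exists j.
have PF : ProperFilter F by exact: ultra_proper.
exists f, F; split=> // n V nV.
have := hF _ (ex_intro _ _ (ex_intro _ n.+1 (conj (nbN nV) erefl))).
by apply: filterS => j /(_ n (ltnSn n)) /=; rewrite opprB.
Qed.

Lemma ultra_residue (F : set_system int) N : UltraFilter F -> (0 < N)%N ->
  exists2 r : nat, (r < N)%N & F [set j : int | (N%:Z %| j - r%:Z)%Z].
Proof.
move=> UF N0; have [|r] := @ultra_seq_cover _ _ F (iota 0 N)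
  (fun r => [set j : int | (N%:Z %| j - r%:Z)%Z]) UF.
  have PF : ProperFilter F by exact: ultra_proper.
  apply: filterS filterT => j _; have N1 : N%:Z != 0 by rewrite eqz_nat -lt0n.
  have r0 : 0 <= (j %% N%:Z)%Z by rewrite modz_ge0.
  have rN : (j %% N%:Z)%Z < N%:Z by rewrite ltz_pmod // ltz_nat.
  exists (absz (j %% N%:Z)%Z); first by rewrite mem_iota add0n; move: r0 rN; lia.
  by rewrite /= gez0_abs // {1}(divz_eq j N%:Z) addrK dvdz_mull.
by rewrite mem_iota add0n => rN; exists r.
Qed.

(** Along the ultrafilter the multipliers have a constant residue r modulo p, so the point of G that
    is found is r x. It is nonzero, so r is invertible modulo p. *)
Lemma socle_in p (x : K) : prime p -> x *+ p = 0 -> range i x.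
Proof.
move=> pp xp; have [->|x0] := pselect (x = 0); first by exists 0 => //; rewrite raddf0.
have [f [F [UF [n fn] hF]]] := @essential_ultra (fun=> x) 0 x0.
have PF : ProperFilter F by exact: ultra_proper.
have [r rp Fr] := ultra_residue UF (prime_gt0 pp).
have e : i (f n) = x *+ r.
  apply/eqP; rewrite -subr_eq0 -oppr_eq0 opprB; apply/eqP.
  apply: (nb_separate hK) => V nV; have [j [/= /dvdzP[q ej] h]] := filterI_ex PF Fr (hF n V nV).
  move: h; have -> : x *~ j = x *+ r.
    have -> : j = q * p%:Z + r%:Z by rewrite -ej subrK.
    by rewrite mulrzDr mulrC mulrzA -pmulrn xp mul0rz add0r.
  by [].
have r0 : (0 < r)%N.
  by rewrite lt0n; apply/eqP => e0; apply: fn; apply: i_eq0; rewrite e e0 mulr0n.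
have cup : coprime r p by rewrite coprime_sym prime_coprime // gtnNdvd.
case: (egcdnP p r0) => km kn; rewrite (eqP cup) => ek _.
exists (f n *+ km) => //; rewrite raddfMn e -mulrnA mulnC ek mulrnDr mulnC mulrnA xp mul0rn add0r.
by rewrite mulr1n.
Qed.

(** Take x_k with p^k x_k outside G, and integers j along an ultrafilter with j x_n tending to f_n
    in G for all n and some f_n nonzero. Since x_n is topologically p-torsion, the residues r_s of j
    modulo p^s are not divisible by some fixed p^t. Solving m_s r_s = p^t modulo p^s gives a
    sequence m_s f_t of G converging to p^t x_t. *)
Lemma torsion_bound p : sequentially_complete i -> prime p ->
  exists k : nat, forall x, Qp p x -> range i (x *+ p ^ k).
Proof.
move=> sq pp; apply: contrapT => /forallNP nk.
have p0 := prime_gt0 pp.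
have /choice[x hx] : forall k, exists x, Qp p x /\ ~ range i (x *+ p ^ k).
  by move=> k; have /existsNP[x /not_implyP[]] := nk k; exists x.
have x0 : x 0%N <> 0.
  by move=> e; have [_] := hx 0%N; apply; exists 0 => //; rewrite raddf0 e mul0rn.
have [f [F [UF [n fn] hF]]] := @essential_ultra x 0 x0.
have PF : ProperFilter F by exact: ultra_proper.
have ifn : i (f n) <> 0 by move=> /i_eq0.
have [V1 nV1 V1f] := nb_avoid hK ifn; have [W [nW W0 WN fW]] := nb_fold 2 nV1.
have [t ht] := Qp_int nW WN (hx n).1.
have pe e : (0 < p ^ e)%N by rewrite expn_gt0 p0.
have res s : exists r : nat, F [set j : int | ((p ^ s)%N%:Z %| j - r%:Z)%Z].
  by have [r _ Fr] := ultra_residue UF (pe s); exists r.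
have nd s r : (t <= s)%N -> F [set j : int | ((p ^ s)%N%:Z %| j - r%:Z)%Z] -> ~~ (p ^ t %| r)%N.
  move=> ts Fr; apply/negP => dr.
  have [j [/= h1 h2]] := filterI_ex PF Fr (hF n W nW).
  apply: V1f; apply: fW.
  have -> : i (f n) = x n *~ j - (x n *~ j - i (f n)) by zmod.
  apply: (@foldB _ _ 1 1) => //; apply: fold1 => //; apply: ht.
  rewrite -(subrK r%:Z j); apply: rpredD; last by rewrite /dvdz.
  have tp : ((p ^ t)%N%:Z %| (p ^ s)%N%:Z)%Z by exact: dvdn_exp2l.
  exact: dvdz_trans tp h1.
have /choice[m hm] : forall s, exists m : nat, (t <= s)%N -> exists r : nat,
    F [set j : int | ((p ^ s)%N%:Z %| j - r%:Z)%Z] /\ (m * r = p ^ t %[mod p ^ s])%N.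
  move=> s; have [r Fr] := res s; have [ts|st] := leqP t s; last by exists 0%N.
  by have [m em] := mod_solve s pp (nd s r ts Fr); exists m => _; exists r.
(* The coordinate t has nothing to do with n: it is the exponent just found, and x_t is the
   counterexample for that exponent. *)
have [_] := hx t; apply.
apply: (sq (fun s => i (f t *+ m s))); first by move=> s; exists (f t *+ m s).
apply: (tolimP (fun s => i (f t *+ m s)) (x t *+ p ^ t) _).2 => V nV.
have [W1 [nW1 W10 W1N fW1]] := nb_fold 2 nV.
have [s0 hs0] := Qp_int nW1 W1N (hx t).1.
exists (maxn t s0) => // s /=; rewrite geq_max => /andP[ts s0s].
have [r [Fr em]] := hm s ts.
have [j [/= h1 h2]] := filterI_ex PF Fr (hF t _ (nbMn (m s) nW1)).
apply: fW1.
have -> : i (f t *+ m s) - x t *+ p ^ t =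
  x t *~ (j * (m s)%:Z - (p ^ t)%N%:Z) - (x t *~ j - i (f t)) *+ m s.
  by rewrite raddfMn mulrzBr mulrzA -!pmulrn mulrnBl; zmod.
apply: (@foldB _ _ 1 1) => //; apply: fold1 => //; apply: hs0.
have sp : ((p ^ s0)%N%:Z %| (p ^ s)%N%:Z)%Z by exact: dvdn_exp2l.
apply: (dvdz_trans sp).
have -> : j * (m s)%:Z - (p ^ t)%N%:Z = (j - r%:Z) * (m s)%:Z + ((m s * r)%N%:Z - (p ^ t)%N%:Z).
  by rewrite PoszM mulrBl [r%:Z * _]mulrC addrA subrK.
apply: rpredD; first exact: dvdz_mulr.
by rewrite -eqz_mod_dvd !modz_nat em.
Qed.

End Essential.

(** * Compactness of the completion *)

Section Compactness.
Variables (R : realType) (K : topologicalZmodType).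
Hypotheses (hK : hausdorff_space K) (cK : complete_group K) (mK : minimal_base K).

Let pcM (M : set K) V : nbhs (0 : K) V -> exists2 d, (0 < d)%N & pc V (mulset M d).
Proof.
move=> nV; have [d d0 h] := multiples_precompact hK mK nV; exists d => //.
by apply: pc_sub h => // _ [y _ ->]; exists y.
Qed.

Local Notation D := (divpart [set: K]).
Let sT : subgroup [set: K]. Proof. by []. Qed.
Let sD : subgroup D. Proof. exact: divpart_subgroup. Qed.
Let cD : compact D. Proof. exact: (divpart_compact cK (@pcM setT)). Qed.

Definition supplement (L : set K) : Prop :=
  [/\ closed L, subgroup L & forall x, exists2 y, D y & L (x - y)].

(** Zorn's lemma on complements. Compactness of D makes the intersection of a chain a supplement:
    elements y of D with x - y in the members of the chain accumulate. *)
Lemma minimal_supplement : exists2 L, supplement L &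
  forall L', supplement L' -> L' `<=` L -> L `<=` L'.
Proof.
have [F FP Ftot|A [PA Amax]] := @Zorn_bigcup K [set A | supplement (~` A)].
  rewrite /= setC_bigcup.
  have clF A : F A -> closed (~` A) by move=> /FP[].
  split.
  - exact: closed_bigI.
  - split=> [A FA|x y hx hy A FA]; have [_ sA _] := FP A FA; first exact: subgroup0.
    by apply: (subgroupB sA); [exact: hx|exact: hy].
  - move=> x; have [[A0 FA0]|nF] := pselect (exists A, F A); last first.
      exists 0; first exact: subgroup0.
      by move=> A FA; case: nF; exists A.
    have [|||U [UU hU]] := @ultra_from_base K [set B | exists2 A, F A &
       B = [set y | D y /\ (~` A) (x - y)]].
    + by exists [set y | D y /\ (~` A0) (x - y)], A0.
    + move=> _ _ [A1 FA1 ->] [A2 FA2 ->].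
      have [s|s] := Ftot _ _ FA1 FA2.
        exists [set y | D y /\ (~` A2) (x - y)]; first by exists A2.
        by move=> y [Dy h2]; split; split=> // h1; apply: h2; exact: s.
      exists [set y | D y /\ (~` A1) (x - y)]; first by exists A1.
      by move=> y [Dy h1]; split; split=> // h2; apply: h1; exact: s.
    + move=> _ [A FA ->]; have [_ _ /(_ x)[y Dy hy]] := FP A FA; by exists y.
    have PU : ProperFilter U by exact: ultra_proper.
    have UD : U D by have := hU _ (ex_intro2 _ _ A0 FA0 erefl); apply: filterS => y [].
    have [l Dl hl] := @compact_lim K D _ U id cD UU UD.
    exists l => // A FA.
    have hl' : tolim U (fun y => x - y) (x - l).
      by apply: tolimB => //; exact: tolim_cst.
    apply: (tolim_closed PU (clF A FA) _ hl').
    by have := hU _ (ex_intro2 _ _ A FA erefl); apply: filterS => y [].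
exists (~` A) => // L' sL' L'A x Ax; apply: contrapT => nL'x.
apply: (Amax (~` L')); last by rewrite /= setCK.
split; first by move=> y Ay L'y; exact: (L'A _ L'y).
by move=> /(_ x nL'x).
Qed.

Lemma divpart_mono (L : set K) : divpart L `<=` D.
Proof.
move=> x hx d d0; apply: closureS (hx d d0) => _ [y _ ->]; by exists y.
Qed.

(* A character th of divpart L, precomposed with multiplication by d, is
   approximately defined on all of L, where Hyers' theorem makes it exact; since
   divpart L is divisible, its kernel is still a supplement. *)
Theorem supplement_divpart0 (L : set K) : supplement L ->
  (forall L', supplement L' -> L' `<=` L -> L `<=` L') -> divpart L = [set 0].
Proof.
move=> [clL sL spL] Lmin; rewrite eqEsubset; split; last first.
  by move=> _ ->; exact: (subgroup0 (divpart_subgroup sL)).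
move=> y Cy; apply: contrapT => y0; set C := divpart L in Cy.
have sC : subgroup C by exact: divpart_subgroup.
have cC : compact C by exact: (divpart_compact cK (@pcM L)).
have [th [thD thc thy]] := @peter_weyl R K C sC (fun V nV => pc_compact cC nV) hK y Cy y0.
have tth : tcharacter C th by split.
have e64 : 0 < 64^-1 :> R by rewrite invr_gt0.
have [V1 nV1 hV1] := thc _ e64.
have [W [nW W0 WN fW]] := nb_fold 4 nV1.
have [d d0 hd] := divpart_near cK sL (@pcM L) nW.
have /choice[dl hdl] : forall x, exists z, L x -> C z /\ W (x *+ d - z).
  move=> x; have [Lx|nLx] := pselect (L x); last by exists 0.
  by have [z Cz Wz] := hd x Lx; exists z.
have thsmall n z : (n <= 4)%N -> C z -> fold W n z -> tnorm (th z) <= 64^-1.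
  by move=> n4 Cz fz; apply: hV1 => //; apply: fW; exact: fold_mono fz.
pose F x : R := th (dl x).
have FD x x' : L x -> L x' -> tnorm (F (x + x') - F x - F x') <= 64^-1.
  move=> Lx Lx'; have Lxx := subgroupD sL Lx Lx'.
  have [C1 W1] := hdl _ Lx; have [C2 W2] := hdl _ Lx'; have [C3 W3] := hdl _ Lxx.
  have e1 : tnorm (th (dl (x + x') - dl x - dl x') - (F (x + x') - F x - F x')) = 0.
    apply: tnorm_trans (tcharacterB sC tth (subgroupB sC C3 C1) C2) _.
    have := tcharacterB sC tth C3 C1; congr (tnorm _ = _); rewrite /F; ring.
  rewrite -(tnorm_eqB e1); apply: (@thsmall 3) => //.
    exact: (subgroupB sC (subgroupB sC C3 C1) C2).
  have -> : dl (x + x') - dl x - dl x' =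
    - ((x + x') *+ d - dl (x + x')) + (x *+ d - dl x) + (x' *+ d - dl x').
    by rewrite mulrnDl; zmod.
  apply: (@foldD _ _ 2 1); last exact: fold1.
  by apply: (@foldD _ _ 1 1); apply: fold1 => //; exact: WN.
have e32 : 64^-1 <= 32^-1 :> R by rewrite lef_pV2 ?posrE // ler_nat.
have [H [HD HF]] := hyers (subgroupD sL) e32 FD.
have tH : tcharacter L H.
  split=> //; apply: (tchar_continuous sL HD (nbMn d nW)) => x Lx /= Wx.
  have [C1 W1] := hdl _ Lx.
  have Fx : tnorm (F x) <= 64^-1.
    apply: (@thsmall 2) => //; have -> : dl x = x *+ d - (x *+ d - dl x) by zmod.
    by apply: (@foldB _ _ 1 1) => //; exact: fold1.
  have h1 := HF x Lx; have := tnormD (H x - F x) (F x); rewrite subrK; lra.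
have CL : C `<=` L by exact: divpart_sub.
have tHC : tcharacter C H.
  split=> [x x' Cx Cx'|e e0]; first by apply: HD; exact: CL.
  by have [V nV hV] := tH.2 e e0; exists V => // x Cx; apply: hV; exact: CL.
(* On C both functions are characters and they differ by at most 1/4 everywhere; the circle having
   no small subgroups, they agree. *)
have HC x : C x -> tnorm (H x - th (x *+ d)) = 0.
  move=> Cx; apply: tnorm_pow2_eq0 => j.
  have near z : C z -> tnorm (H z - th (z *+ d)) <= 4^-1.
    move=> Cz; have Lz := CL _ Cz; have [C1 W1] := hdl _ Lz.
    have Czd := subgroupMn sC d Cz.
    have h1 : tnorm (th (z *+ d) - F z) <= 64^-1.
      rewrite -(tnorm_eqB (tcharacterB sC tth Czd C1)).
      by apply: (@thsmall 1) => //; [exact: (subgroupB sC Czd C1)|exact: fold1].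
    have h2 := HF z Lz; have -> : H z - th (z *+ d) = (H z - F z) - (th (z *+ d) - F z) by ring.
    have := tnormB (H z - F z) (th (z *+ d) - F z); lra.
  have e1 : tnorm ((H x - th (x *+ d)) *+ 2 ^ j - (H (x *+ 2 ^ j) - th (x *+ 2 ^ j *+ d))) = 0.
    have h1 := tcharacterMn sC tHC (2 ^ j) Cx.
    have h2 := tcharacterMn sC tth (2 ^ j) (subgroupMn sC d Cx).
    have -> : x *+ 2 ^ j *+ d = x *+ d *+ 2 ^ j by rewrite -!mulrnA mulnC.
    rewrite mulrnBl.
    have -> : H x *+ 2 ^ j - th (x *+ d) *+ 2 ^ j - (H (x *+ 2 ^ j) - th (x *+ d *+ 2 ^ j)) =
      (th (x *+ d *+ 2 ^ j) - th (x *+ d) *+ 2 ^ j) + - (H (x *+ 2 ^ j) - H x *+ 2 ^ j) by ring.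
    by rewrite tnorm_intD // tnormN.
  by rewrite (tnorm_eqB e1); apply: near; exact: (subgroupMn sC _ Cx).
(* H sees th through multiplication by d only, so the nonvanishing at y is moved to a d-th root of
   y. *)
have [y' Cy' ey'] := divpart_divisible hK cK sL (@pcM L) d0 Cy.
have Hy' : tnorm (H y') <> 0.
  by rewrite (tnorm_eqB (HC _ Cy')) ey'.
have onto := tchar_onto sC tHC cC.
have {}onto t : exists2 x, C x & tnorm (H x - t) = 0.
  apply: onto => -[n n0 hn]; apply: Hy'.
  have [z Cz ez] := divpart_divisible hK cK sL (@pcM L) n0 Cy'.
  by rewrite -ez (tnorm_eqB (tcharacterMn sC tHC n Cz)); exact: hn.
(* H maps C onto the circle, so every element of L is corrected into L' by an element of C, which
   lies in D. This makes L' a supplement. *)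
pose L' := [set x | L x /\ tnorm (H x) = 0].
have sL' : supplement L'.
  split.
  - move=> x hx; have Lx : L x by apply: clL; apply: closureS hx => z [].
    split=> //; apply/eqP; rewrite eq_le tnorm_ge0 andbT.
    apply/ler_addgt0Pl => e e0; rewrite addr0.
    have [V nV hV] := tH.2 e e0; have [a [La Ha] Va] := (closureP L' x).1 hx _ (nbN nV).
    have h1 := tcharacterB sL tH Lx La; rewrite /= opprB in Va.
    have -> : tnorm (H x) = tnorm (H x - H a) by rewrite tnorm_intD // tnormN.
    by rewrite -(tnorm_eqB h1); apply: hV => //; exact: subgroupB.
  - split; first by split; [exact: subgroup0|exact: tcharacter0 tH].
    move=> a b [La Ha] [Lb Hb]; split; first exact: subgroupB.
    by rewrite (tnorm_eqB (tcharacterB sL tH La Lb)) tnorm_intD // tnormN.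
  - move=> x; have [z Dz Lz] := spL x; have [c Cc hc] := onto (H (x - z)).
    exists (z + c); first exact: (subgroupD sD Dz (divpart_mono Cc)).
    have -> : x - (z + c) = x - z - c by zmod.
    have Lc := CL _ Cc; split; first exact: subgroupB.
    by rewrite (tnorm_eqB (tcharacterB sL tH Lz Lc)) tnormC.
have [] := Lmin L' sL' _ y' (CL _ Cy'); last by [].
by move=> x [].
Qed.

Let pfin (L : set K) : subgroup L -> divpart L = [set 0] -> forall V, nbhs (0 : K) V ->
  exists2 d, (0 < d)%N & forall x, L x -> V (x *+ d).
Proof.
move=> sL eL V nV; have [d d0 hd] := divpart_near cK sL (@pcM L) nV.
exists d => // x Lx; have [y] := hd x Lx; rewrite eL => -> ; by rewrite subr0.
Qed.

(** The p-component M of L is precompact, by layers: some layer is, hence p^v M is, and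
    [bounded_precompact] removes one factor p at a time. As L lies in M plus the closure of pL, it
    is precompact modulo pL, then modulo dL by induction on d, and dL is small for a suitable d. *)
Lemma profinite_precompact (L : set K) : closed L -> subgroup L ->
  (forall V, nbhs (0 : K) V -> exists2 d, (0 < d)%N & forall x, L x -> V (x *+ d)) ->
  forall V, nbhs (0 : K) V -> pc V L.
Proof.
move=> clL sL pf.
have prim p : prime p -> forall V, nbhs (0 : K) V -> pc (psh L p V 1) L.
  move=> pp.
  pose M := [set x | L x /\ Qp p x].
  (* t is the p-adic valuation of d for every x in M: Bezout combines the prime-to-p part of d with
     a power p^s depending on x. *)
  have Mt V : nbhs (0 : K) V -> exists t, forall x, M x -> forall j, V (x *+ (p ^ t * j)).
    move=> nV; have [W [nW W0 WN fW]] := nb_fold 2 nV; have [d d0 hd] := pf W nW.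
    exists (logn p d) => x [Lx Qx] j; have [s hs] := Qx W nW.
    have cd : coprime d`_(p^')%N (p ^ s).
      rewrite coprime_sym; apply: (@pnat_coprime (p : nat_pred)); last exact: part_pnat.
      by rewrite pnatX pnat_id.
    case: (egcdnP (p ^ s) (part_gt0 (p^')%N d)) => km kn; rewrite (eqP cd) => ek _.
    apply: fW; set N := (p ^ logn p d * j)%N.
    have -> : x *+ N = x *+ (km * j) *+ d - x *+ (p ^ s * (kn * N)).
      rewrite -mulrnA -[in X in _ *+ X - _](partnC p d0) p_part.
      have -> : (km * j * (p ^ logn p d * d`_(p^')) = (km * d`_(p^')) * N)%N by rewrite /N; lia.
      rewrite ek mulnDl mul1n mulrnDr.
      have -> : (kn * p ^ s * N = p ^ s * (kn * N))%N by lia.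
      by zmod.
    apply: (@foldB _ _ 1 1) => //; apply: fold1 => //.
    by apply: hd; exact: subgroupMn.
  have sM : subgroup M.
    split; first by split; [exact: subgroup0|move=> V nV; exists 0%N => j; rewrite mul0rn; exact: nb0].
    by move=> x y [Lx Qx] [Ly Qy]; split; [exact: subgroupB|exact: Qp_sub].
  have clM : closed M.
    move=> x hx; have Lx : L x by apply: clL; apply: closureS hx => z [].
    split=> // V nV; have [W [nW W0 WN fW]] := nb_fold 2 nV; have [t ht] := Mt W nW.
    exists t => j; apply: fW.
    have [a Ma Wa] := (closureBP M x).1 hx _ (nbMn (p ^ t * j) nW).
    have -> : x *+ (p ^ t * j) = (x - a) *+ (p ^ t * j) + a *+ (p ^ t * j) by rewrite mulrnBl subrK.
    by apply: (@foldD _ _ 1 1); apply: fold1 => //; exact: ht.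
  have Mlay V : nbhs (0 : K) V -> exists t, pim M p t `<=` V.
    move=> nV; have [t ht] := Mt V nV; exists t => _ [l Ml ->].
    by have := ht l Ml 1%N; rewrite muln1.
  (* The layers after a precompact layer are its images under powers of p. Adding their covers
     treats p^v M modulo p^(v+w) M, which is small for large w. *)
  have pushup v : (forall V, nbhs (0 : K) V -> pc (psh M p V v.+1) (pim M p v)) ->
      forall V, nbhs (0 : K) V -> pc V (pim M p v).
    move=> hv.
    have step w : forall V, nbhs (0 : K) V -> pc (psh M p V (v + w)) (pim M p v).
      elim: w => [|w IH] V nV.
        exists [:: 0] => x [l Ml ->]; exists 0; rewrite ?inE //.
        by exists 0, l; rewrite add0r subr0 addn0; split=> //; exact: nb0.
      have [W [nW W0 WN fW]] := nb_fold 2 nV.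
      have [s hs] := IH W nW; have [s' hs'] := hv _ (nbMn (p ^ w) nW).
      exists [seq y + y' *+ p ^ w | y <- s, y' <- s'] => x Mx.
      have [y ys [w1 [l [Ww1 Ml e]]]] := hs x Mx.
      have [|y' ys' [w2 [l2 [Ww2 Ml2 e2]]]] := hs' (l *+ p ^ v); first by exists l.
      exists (y + y' *+ p ^ w); first by apply: (allpairs_f (fun y y' => y + y' *+ p ^ w)).
      exists (w1 + w2 *+ p ^ w), l2; split=> //.
        by apply: fW; apply: (@foldD _ _ 1 1); exact: fold1.
      have -> : x - (y + y' *+ p ^ w) = (x - y) - y' *+ p ^ w by zmod.
      rewrite e expnD mulrnA -addrA -mulrnBl e2 mulrnDl -mulrnA -expnD addSn addnS.
      by rewrite addrA.
    move=> V nV; have [W [nW W0 WN fW]] := nb_fold 2 nV; have [t ht] := Mlay W nW.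
    apply: pc_sub (step t W nW) => // _ [w [l [Ww Ml ->]]]; apply: fW.
    apply: (@foldD _ _ 1 1); apply: fold1 => //; apply: ht.
    by exists (l *+ p ^ v); [exact: subgroupMn|rewrite -mulrnA -expnD].
  have pcall : forall V, nbhs (0 : K) V -> pc V M.
    have [v hv] := primary_layers hK mK clM sM pp Mlay.
    (* Descent from v to 0. The closure of p^v M is used because [bounded_precompact] wants a closed
       subgroup; its multiple by p lies in the closure of p^(v+1) M. *)
    have := pushup v hv; elim: v {hv} => [|v IH] hv V nV.
      by apply: pc_sub (hv V nV) => // x Mx; exists x; rewrite // expn0 mulr1n.
    apply: IH => // {}V {}nV.
    pose M' := closure (pim M p v).
    have sM' : subgroup M' by apply: closure_subgroup; exact: (mulset_subgroup sM (p ^ v)).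
    have : forall V, nbhs (0 : K) V -> pc V M'.
      apply: (bounded_precompact hK cK mK _ sM' pp); first exact: closed_closure.
      move=> V1 nV1; have [W [nW W0 WN fW]] := nb_fold 2 nV1; have [s hs] := hv W nW.
      exists s => _ [l Ml ->].
      have [_ [a Ma ->] Wa] := (closureBP _ l).1 Ml _ (nbMn p nW).
      have [|y ys Wy] := hs (a *+ p ^ v.+1); first by exists a.
      exists y => //; apply: fW.
      have -> : l *+ p ^ 1 - y = (l - a *+ p ^ v) *+ p + (a *+ p ^ v.+1 - y).
        by rewrite mulrnBl -mulrnA -expnSr expn1; zmod.
      by apply: (@foldD _ _ 1 1); exact: fold1.
    by move=> /(_ V nV); apply: pc_sub => //; exact: subset_closure.
  move=> V nV; have [W [nW W0 WN fW]] := nb_fold 3 nV; have [s hs] := pcall W nW.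
  exists s => x Lx; have Mx : M (primcomp p x).
    by split; [exact: (primcomp_in cK clL sL pf)|exact: (primcomp_Qp cK sL pf)].
  have [y ys Wy] := hs _ Mx; exists y => //.
  have [_ [z Lz ->] Wz] := (closureBP _ _).1 (primcomp_compl cK sL pf 1 pp Lx) W nW.
  exists ((x - primcomp p x - z *+ p ^ 1) + (primcomp p x - y)), z; split=> //; last by zmod.
  apply: fW; apply: (@fold_mono _ _ 2) => //.
  by apply: (@foldD _ _ 1 1); exact: fold1.
have all d : (0 < d)%N -> forall V, nbhs (0 : K) V ->
    exists s : seq K, forall x, L x -> exists y w l, [/\ y \in s, V w, L l & x - y = w + l *+ d].
  elim: {d}d.+1 {-2}d (ltnSn d) => // n IH d dn d0 V nV.
  have [d1|d1] := leqP d 1%N.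
    exists [:: 0] => x Lx; exists 0, 0, x; rewrite inE eqxx; split=> //; first exact: nb0.
    by rewrite (_ : d = 1%N) ?mulr1n ?add0r ?subr0 //; lia.
  pose p := pdiv d; have pp : prime p by exact: pdiv_prime.
  have [W [nW W0 WN fW]] := nb_fold 2 nV.
  have ed : (d = d %/ p * p)%N by rewrite divnK // pdiv_dvd.
  have e0 : (0 < d %/ p)%N by rewrite divn_gt0 ?pdiv_gt0 // pdiv_leq.
  have [s hs] := prim p pp W nW.
  have [|s' hs'] := IH (d %/ p)%N _ e0 _ (nbMn p nW).
    by rewrite -ltnS (leq_trans _ dn) // ltnS ltn_Pdiv // prime_gt1.
  exists [seq y + y' *+ p | y <- s, y' <- s'] => x Lx.
  have [y ys [w [l [Ww Ll e]]]] := hs x Lx.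
  have [y' [w' [l' [ys' Ww' Ll' e']]]] := hs' l Ll.
  exists (y + y' *+ p), (w + w' *+ p), l'; split=> //.
  - by apply: (allpairs_f (fun y y' => y + y' *+ p)).
  - by apply: fW; apply: (@foldD _ _ 1 1); exact: fold1.
  - have -> : x - (y + y' *+ p) = (x - y) - y' *+ p by zmod.
    by rewrite e expn1 -addrA -mulrnBl e' mulrnDl -mulrnA -ed addrA.
move=> V nV; have [W [nW W0 WN fW]] := nb_fold 2 nV; have [d d0 hd] := pf W nW.
have [s hs] := all d d0 W nW; exists s => x Lx.
have [y [w [l [ys Ww Ll e]]]] := hs x Lx; exists y => //; rewrite e; apply: fW.
by apply: (@foldD _ _ 1 1); apply: fold1 => //; exact: hd.
Qed.

Theorem minimal_complete_compact : exists L, [/\ closed L, subgroup L,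
  (forall V, nbhs (0 : K) V -> exists2 d, (0 < d)%N & forall x, L x -> V (x *+ d)),
  (forall x, exists2 y, D y & L (x - y)) & compact [set: K]].
Proof.
have [L spl Lmin] := minimal_supplement; have [clL sL sp] := spl.
have pf := pfin sL (supplement_divpart0 spl Lmin).
exists L; split=> //.
apply: (complete_compact cK (@closedT K)) => V nV.
have [W [nW W0 WN fW]] := nb_fold 2 nV.
have [s hs] := pc_compact cD nW.
have [s' hs'] := profinite_precompact clL sL pf nW.
exists [seq a + b | a <- s, b <- s'] => x _.
have [y Dy Lxy] := sp x; have [a sa Wa] := hs y Dy; have [b sb Wb] := hs' _ Lxy.
exists (a + b); first by apply: (allpairs_f (fun a b => a + b)).
apply: fW; have -> : x - (a + b) = (y - a) + (x - y - b) by zmod.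
by apply: (@foldD _ _ 1 1); exact: fold1.
Qed.

End Compactness.

(** * Compact divisible groups *)

Section DivisibleCompact.
Variables (R : realType) (K : topologicalZmodType) (D : set K).
Hypotheses (hK : hausdorff_space K) (cD : compact D) (sD : subgroup D).
Hypothesis dD : forall m x, (0 < m)%N -> D x -> exists2 y, D y & y *+ m = x.

(** Arbitrary values on finitely many members of A are attained in D. By compactness
    [independent_onto] extends this to all of A, so that A maps D onto a torus with one factor for
    each member. *)
Definition independent (A : set (K -> R)) : Prop :=
  (forall f, A f -> tcharacter D f) /\
  forall s : seq (K -> R), (forall f, f \in s -> A f) -> forall t : (K -> R) -> R,
    exists2 y, D y & forall f, f \in s -> tnorm (f y - t f) = 0.

Lemma independent_chain (F : set (set (K -> R))) : F `<=` independent ->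
  total_on F subset -> independent (\bigcup_(A in F) A).
Proof.
move=> FI Ftot; split=> [f [A FA Af]|s hs t]; first by have [+ _] := FI A FA; exact.
have [e|[A FA hA]] : s = [::] \/ exists2 A, F A & forall f, f \in s -> A f.
  elim: s hs => [|f s IH] hs; first by left.
  right; have [A FA Af] : (\bigcup_(A in F) A) f by apply: hs; rewrite inE eqxx.
  have [|->|[B FB hB]] := IH.
  - by move=> g gs; apply: hs; rewrite inE gs orbT.
  - by exists A => // g; rewrite inE => /eqP->.
  - have [AB|BA] := Ftot _ _ FA FB.
      by exists B => // g; rewrite inE => /orP[/eqP->|/hB//]; exact: AB.
    by exists A => // g; rewrite inE => /orP[/eqP->//|/hB/BA].
- by exists 0; [exact: subgroup0|rewrite e].
- by have [_] := FI A FA; exact.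
Qed.

Let clD : closed D. Proof. exact: compact_closed. Qed.

Lemma independent_onto (A : set (K -> R)) (t : (K -> R) -> R) : independent A ->
  exists2 y, D y & forall f, A f -> tnorm (f y - t f) = 0.
Proof.
move=> [Ac Af].
have [|||U [UU hU]] := @ultra_from_base K [set B | exists2 s : seq (K -> R),
   (forall f, f \in s -> A f) & B = [set y | D y /\ forall f, f \in s -> tnorm (f y - t f) = 0]].
- by exists [set y | D y /\ forall f, f \in [::] -> tnorm (f y - t f) = 0], [::].
- move=> _ _ [s1 h1 ->] [s2 h2 ->].
  exists [set y | D y /\ forall f, f \in s1 ++ s2 -> tnorm (f y - t f) = 0].
    by exists (s1 ++ s2) => // f; rewrite mem_cat => /orP[/h1|/h2].
  by move=> y [Dy hy]; split; split=> // f fs; apply: hy; rewrite mem_cat fs ?orbT.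
- by move=> _ [s hs ->]; have [y Dy hy] := Af s hs t; exists y.
have PU : ProperFilter U by exact: ultra_proper.
have inU s (hs : forall f, f \in s -> A f) := hU _ (ex_intro2 _ _ s hs erefl).
have UD : U D.
  have h0 : forall f : K -> R, f \in [::] -> A f by [].
  by have := inU _ h0; apply: filterS => y [].
have [l Dl hl] := @compact_lim K D _ U id cD UU UD.
exists l => // f fA; apply: (tcharacter_lim sD (Ac f fA) PU Dl UD hl) => e e0.
have h1 : forall g : K -> R, g \in [:: f] -> A g by move=> g; rewrite inE => /eqP->.
have := inU _ h1; apply: filterS => y [_ hy] /=.
by rewrite hy ?inE //; exact: ltW.
Qed.

Definition annihilated (A : set (K -> R)) : set K :=
  [set z | D z /\ forall f, A f -> tnorm (f z) = 0].

Section Maximal.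
Variable A : set (K -> R).
Hypothesis iA : independent A.
Hypothesis Amax : forall B, A `<` B -> ~ independent B.
Local Notation Z := (annihilated A).

Let Ac f : A f -> tcharacter D f. Proof. exact: iA.1. Qed.

Lemma annihilated_subgroup : subgroup Z.
Proof.
split; first by split; [exact: subgroup0|move=> f /Ac/(tcharacter0 sD)].
move=> x y [Dx hx] [Dy hy]; split; first exact: subgroupB.
move=> f fA; rewrite (tnorm_eqB (tcharacterB sD (Ac fA) Dx Dy)).
by rewrite tnorm_intD; [exact: hx|rewrite tnormN hy].
Qed.

Lemma annihilated_closed : closed Z.
Proof.
move=> x hx; have Dx : D x by apply: clD; apply: closureS hx => y [].
split=> // f fA; apply/eqP; rewrite eq_le tnorm_ge0 andbT.
apply/ler_addgt0Pl => e e0; rewrite addr0.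
have [V nV hV] := (Ac fA).2 e e0.
have [a [Da ha] Va] := (closureBP _ _).1 hx V nV.
have -> : tnorm (f x) = tnorm (f x - f a) by rewrite tnorm_intD // tnormN ha.
rewrite -(tnorm_eqB (tcharacterB sD (Ac fA) Dx Da)).
by apply: hV => //; exact: subgroupB.
Qed.

Let ZD : Z `<=` D. Proof. by move=> z []. Qed.
Let cZ : compact Z. Proof. exact: subclosed_compact annihilated_closed cD ZD. Qed.

(* A character not torsion on Z maps Z onto the circle, so it could be added to A. *)
Lemma annihilated_torsion (H : K -> R) : tcharacter D H ->
  exists2 n, (0 < n)%N & forall z, Z z -> tnorm (H z *+ n) = 0.
Proof.
move=> tH; apply: contrapT => nH.
have tHZ : tcharacter Z H.
  split=> [x y Zx Zy|e e0]; first by apply: tH.1; exact: ZD.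
  by have [V nV hV] := tH.2 e e0; exists V => // x Zx; apply: hV; exact: ZD.
have onto := tchar_onto annihilated_subgroup tHZ cZ nH.
apply: (Amax (B := A `|` [set H])).
  split; first by left.
  move=> sub; have AH : A H by apply: sub; right.
  apply: nH; exists 1%N => // z [_ hz]; by rewrite mulr1n hz.
split=> [f [/Ac//|->//]|s hs t].
have [y Dy hy] := independent_onto t iA.
have [z Zz hz] := onto (t H - H y); have [Dz zA] := Zz.
exists (y + z); first exact: subgroupD.
move=> f /hs [fA|->].
  apply: tnorm_trans (tcharacterD (Ac fA) Dy Dz) _.
  have -> : f y + f z - t f = f y - t f + f z by ring.
  by rewrite tnorm_intD ?hy ?zA.
apply: tnorm_trans (tcharacterD tH Dy Dz) _.
by move: hz; congr (tnorm _ = _); ring.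
Qed.

(** Otherwise elements of dZ outside V, for d increasing by divisibility, have a nonzero limit l. A
    character not vanishing at l has values on Z killed by some n, so it vanishes on nZ and hence at
    l. *)
Lemma annihilated_profinite V : nbhs (0 : K) V ->
  exists2 d, (0 < d)%N & forall z, Z z -> V (z *+ d).
Proof.
move=> nV; apply: contrapT => nex.
have [|||U [UU hU]] := @ultra_from_base K [set B | exists2 d, (0 < d)%N &
    B = [set x | mulset Z d x /\ ~ V x]].
- by exists [set x | mulset Z 1 x /\ ~ V x], 1%N.
- move=> _ _ [d d0 ->] [e e0 ->].
  exists [set x | mulset Z (d * e) x /\ ~ V x].
    by exists (d * e)%N => //; rewrite muln_gt0 d0.
  move=> x [hx Vx]; split; split=> //; first exact: (mulset_sub annihilated_subgroup hx).
  by apply: (@mulset_sub _ _ annihilated_subgroup e d); rewrite mulnC.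
- move=> _ [d d0 ->]; apply: contrapT => hd; apply: nex; exists d => // x Zx.
  apply: contrapT => hx; apply: hd; exists (x *+ d); split=> //; by exists x.
have PU : ProperFilter U by exact: ultra_proper.
have inU d (d0 : (0 < d)%N) := hU _ (ex_intro2 _ _ d d0 erefl).
have UZ : U Z.
  by have := inU 1%N isT; apply: filterS => x [[y Zy ->] _]; rewrite mulr1n.
have [l Zl hl] := @compact_lim K Z _ U id cZ UU UZ.
have l0 : l <> 0.
  move=> e; have [x [[_ h1]]] := filterI_ex PU (inU 1%N isT) (hl V nV).
  by rewrite /= e subr0.
have [th [h1 h2 h3]] := @peter_weyl R K D sD (fun V nV => pc_compact cD nV) hK l (ZD Zl) l0.
have tth : tcharacter D th by [].
have [n n0 hn] := annihilated_torsion tth.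
have UD : U D by apply: filterS UZ.
apply: h3; rewrite -[th l]subr0; apply: (tcharacter_lim sD tth PU (ZD Zl) UD hl) => e e0.
have := inU n n0; apply: filterS => _ [[y Zy ->] _] /=.
rewrite subr0 (tnorm_eqB (tcharacterMn sD tth n (ZD Zy))) hn //; exact: ltW.
Qed.

(** The sets of points J y, where y in D has values t f / J under all f in A, decrease along
    divisibility of J. A limit point w has a J-th root of this kind for every J, again by
    compactness of D. *)
Lemma coherent_roots (t : (K -> R) -> R) : exists2 w, D w & forall J, (0 < J)%N ->
  exists y, [/\ D y, y *+ J = w & forall f, A f -> tnorm (f y - t f / J%:R) = 0].
Proof.
pose E J y := D y /\ forall f, A f -> tnorm (f y - t f / J%:R) = 0.
have EM J J' y : (0 < J)%N -> (0 < J')%N -> E (J * J')%N y -> E J (y *+ J').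
  move=> J0 J'0 [Dy hy]; split; first exact: subgroupMn.
  move=> f fA; apply: tnorm_trans (tcharacterMn sD (Ac fA) J' Dy) _.
  have := tnorm_mulrn J' (hy f fA); congr (tnorm _ = _).
  rewrite mulrnBl -[_ / _ *+ _]mulr_natr natrM; congr (_ - _).
  by field; rewrite !pnatr_eq0 -!lt0n J0.
have [|||U [UU hU]] := @ultra_from_base K [set B | exists2 J, (0 < J)%N &
    B = [set x | exists2 y, E J y & x = y *+ J]].
- by exists [set x | exists2 y, E 1%N y & x = y *+ 1], 1%N.
- move=> _ _ [d d0 ->] [e e0 ->].
  exists [set x | exists2 y, E (d * e)%N y & x = y *+ (d * e)].
    by exists (d * e)%N => //; rewrite muln_gt0 d0.
  move=> _ [y Ey ->]; split.
    by exists (y *+ e); [exact: EM|rewrite -mulrnA mulnC].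
  by exists (y *+ d); [apply: EM; rewrite // mulnC|rewrite -mulrnA].
- move=> _ [d d0 ->]; have [y Dy hy] := independent_onto (fun f => t f / d%:R) iA.
  by exists (y *+ d), y.
have PU : ProperFilter U by exact: ultra_proper.
have inU d (d0 : (0 < d)%N) := hU _ (ex_intro2 _ _ d d0 erefl).
have UD : U D.
  by have := inU 1%N isT; apply: filterS => x [y [Dy _] ->]; rewrite mulr1n.
have [w Dw hw] := @compact_lim K D _ U id cD UU UD.
exists w => // J J0.
have /choice[g hg] : forall x, exists y, (exists2 y, E J y & x = y *+ J) -> E J y /\ x = y *+ J.
  by move=> x; have [[y Ey e]|n] := pselect (exists2 y, E J y & x = y *+ J); [exists y|exists 0].
have Ug : U [set x | E J (g x) /\ x = g x *+ J] by apply: filterS (inU J J0) => x /hg.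
have UgD : U [set x | D (g x)] by apply: filterS Ug => x [[]].
have [y Dy hy] := @compact_lim K D _ U g cD UU UgD.
exists y; split=> //.
  have h1 : tolim U (fun x => g x *+ J) w.
    by apply: tolim_ext hw; apply: filterS Ug => x [].
  exact: (tolim_unique hK PU (tolimMn J _ hy) h1).
move=> f fA; apply: (tcharacter_lim sD (Ac fA) PU Dy UgD hy) => e e0.
by apply: filterS Ug => x [[_ hx] _] /=; rewrite (hx f fA); exact: ltW.
Qed.

Let frac (r : R) : R := r - (Num.floor r)%:~R.

(* e n is a coherent root of a point whose values under A are the fractional parts
   of f (n.+1 x) divided by n.+1; a limit of its m-th roots is killed by all of A. *)
Lemma null_approximation x : D x -> exists e : nat -> K,
  [/\ forall n, D (e n), tolim \oo e 0 & forall n, Z ((x - e n) *+ n.+1)].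
Proof.
move=> Dx.
have /choice[e he] : forall n : nat, exists w, D w /\ forall J, (0 < J)%N ->
  exists y, [/\ D y, y *+ J = w &
    forall f, A f -> tnorm (f y - frac (f (x *+ n.+1)) / n.+1%:R / J%:R) = 0].
  move=> n; have [w Dw hw] := coherent_roots (fun f => frac (f (x *+ n.+1)) / n.+1%:R).
  by exists w.
have frac_b (r : R) : 0 <= frac r <= 1.
  rewrite /frac subr_ge0 floor_le /= lerBlDl.
  by have := floorD1_gt r; rewrite intrD => /ltW; rewrite addrC.
exists e; split=> [n||n]; first by have [] := he n.
- move=> V nV; apply: contrapT => nVe.
  have [|||U [UU hU]] := @ultra_from_base nat [set B | exists N : nat,
      B = [set n | (N <= n)%N /\ ~ V (e n)]].
  + by exists [set n | (0 <= n)%N /\ ~ V (e n)], 0%N.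
  + move=> _ _ [a ->] [b ->]; exists [set n | (maxn a b <= n)%N /\ ~ V (e n)]; first by exists (maxn a b).
    by move=> n /= [+ h]; rewrite geq_max => /andP[h1 h2].
  + move=> _ [N ->]; apply: contrapT => h; apply: nVe; exists N => // n /= Nn.
    rewrite subr0; apply: contrapT => Vn; apply: h; by exists n.
  have PU : ProperFilter U by exact: ultra_proper.
  have inU N := hU _ (ex_intro _ N erefl).
  have UD : U [set n | D (e n)] by apply: filterS filterT => n _; have [] := he n.
  have [l Dl hl] := @compact_lim K D _ U e cD UU UD.
  have l0 : l <> 0.
    move=> el; have [n [[_ h1]]] := filterI_ex PU (inU 0%N) (hl V nV).
    by rewrite /= el subr0.
  have [th [h1 h2 h3]] := @peter_weyl R K D sD (fun V nV => pc_compact cD nV) hK l Dl l0.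
  have tth : tcharacter D th by [].
  have [m m0 hm] := annihilated_torsion tth.
  have /choice[y hy] : forall n : nat, exists y, [/\ D y, y *+ m = e n &
      forall f, A f -> tnorm (f y) <= n.+1%:R^-1].
    move=> n; have [_ /(_ m m0)[y [Dy ey hy]]] := he n; exists y; split=> // f fA.
    rewrite (tnorm_eqB (hy f fA)) (le_trans (tnorm_le_abs _)) //.
    have /andP[b0 b1] := frac_b (f (x *+ n.+1)).
    have i0 : 0 <= n.+1%:R^-1 :> R by rewrite invr_ge0.
    have j0 : 0 <= m%:R^-1 :> R by rewrite invr_ge0.
    have j1 : m%:R^-1 <= 1 :> R by rewrite invf_le1 ?ltr0n // ler1n.
    rewrite ger0_norm; last by rewrite !mulr_ge0.
    rewrite -mulrA [leRHS](_ : _ = 1 * (n.+1%:R^-1 * 1)); last by rewrite mul1r mulr1.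
    by rewrite ler_pM // ?mulr_ge0 // ler_pM.
  have UyD : U [set n | D (y n)] by apply: filterS filterT => n _; have [] := hy n.
  have [l' Dl' hl'] := @compact_lim K D _ U y cD UU UyD.
  have el : l' *+ m = l.
    apply: (tolim_unique hK PU (tolimMn m _ hl')); apply: tolim_ext hl.
    by apply: filterS filterT => n _; have [] := hy n.
  have Zl' : Z l'.
    split=> // f fA; rewrite -[f l']subr0.
    apply: (tcharacter_lim sD (Ac fA) PU Dl' UyD hl') => r r0.
    have := inU (Num.truncn r^-1); apply: filterS => n [hn _] /=.
    rewrite subr0; have [_ _ /(_ f fA)/le_trans->//] := hy n.
    rewrite -[leRHS]invrK lef_pV2 ?posrE ?invr_gt0 ?ltr0n //.
    by rewrite (le_trans (ltW (truncnS_gt _))) // ler_nat ltnS.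
  by apply: h3; rewrite -el (tnorm_eqB (tcharacterMn sD tth m Dl')) hm.
- have [De /(_ 1%N isT)[y [Dy]]] := he n; rewrite mulr1n => ey; rewrite {y}ey in Dy * => hf.
  split; first by apply: subgroupMn => //; exact: subgroupB.
  move=> f fA; have tf := Ac fA.
  rewrite mulrnBl (tnorm_eqB (tcharacterB sD tf (subgroupMn sD n.+1 Dx) (subgroupMn sD n.+1 De))).
  have h1 := tcharacterMn sD tf n.+1 De.
  have h2 := tnorm_mulrn n.+1 (hf f fA).
  have -> : f (x *+ n.+1) - f (e n *+ n.+1) =
    (Num.floor (f (x *+ n.+1)))%:~R + - (f (e n *+ n.+1) - f (e n) *+ n.+1) +
    - ((f (e n) - frac (f (x *+ n.+1)) / n.+1%:R / 1%:R) *+ n.+1).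
    rewrite mulrnBl -[_ / _ / _ *+ _]mulr_natr /frac.
    by field; rewrite addrC natr1 pnatr_eq0.
  rewrite tnorm_intD ?tnormN // tnorm_intD ?tnormN //.
  by apply/eqP; rewrite tnorm_eq0 intr_int.
Qed.

End Maximal.

Theorem divisible_compact_sub (S : set K) : complete_group K -> subgroup S ->
  sequentially_closed S ->
  (forall p, prime p -> exists k, forall x, Qp p x -> S (x *+ p ^ k)) -> D `<=` S.
Proof.
move=> cK sS seqS hS x Dx.
have [F FI Ftot|A [iA Amax]] := @Zorn_bigcup (K -> R) independent.
  exact: independent_chain.
(* Divisibility of D absorbs the exponent: z = p^k y with y in D, and y is again topologically
   p-torsion. *)
have QS p z : prime p -> D z -> Qp p z -> S z.
  move=> pp Dz Qz; have [k hk] := hS p pp.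
  have pk : (0 < p ^ k)%N by rewrite expn_gt0 prime_gt0.
  have [y Dy ey] := dD pk Dz; rewrite -ey; apply: hk.
  by apply: (@Qp_root _ p k); rewrite ey.
have [e [De e0 he]] := null_approximation iA Amax Dx.
have sZ := annihilated_subgroup iA.
have inS n : S (x - e n).
  (* Multiplication by (n + 1) d maps C into dZ, so C inherits from Z the smallness of its
     multiples, and x - e n is the sum of its p-components. *)
  pose C := [set y | D y /\ annihilated A (y *+ n.+1)].
  have sC : subgroup C.
    split; first by split; [exact: subgroup0|rewrite mul0rn; exact: subgroup0].
    move=> a b [Da Za] [Db Zb]; split; first exact: subgroupB.
    by rewrite mulrnBl; exact: subgroupB.
  have clC : closed C.
    move=> y hy; split; first by apply: clD; apply: closureS hy => z [].
    apply: (annihilated_closed iA); apply/closureBP => V nV.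
    have [a [Da Za] Va] := (closureBP _ _).1 hy _ (nbMn n.+1 nV).
    by exists (a *+ n.+1) => //; rewrite -mulrnBl.
  have pfC V : nbhs (0 : K) V -> exists2 d, (0 < d)%N & forall y, C y -> V (y *+ d).
    move=> nV; have [d d0 hd] := annihilated_profinite iA Amax nV.
    exists (n.+1 * d)%N; first by rewrite muln_gt0.
    by move=> y [_ Zy]; rewrite mulrnA; exact: hd.
  have Cx : C (x - e n) by split; [exact: subgroupB|exact: he].
  apply: (seqS (fun n0 => \sum_(q < n0 | prime q) primcomp q (x - e n))).
    move=> n0; apply: (big_ind S); [exact: subgroup0|by move=> ? ?; exact: subgroupD|].
    move=> q pq; apply: (QS q) => //; last exact: (primcomp_Qp cK sC pfC).
    by have [] := primcomp_in cK clC sC pfC pq Cx.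
  by apply: (tolimP _ _ _).2 => V nV; exact: (primcomp_sum cK sC pfC Cx nV).
apply: (seqS (fun n => x - e n)) => //; apply: (tolimP _ _ _).2.
rewrite -[X in tolim _ _ X]subr0; apply: tolimB => //; exact: tolim_cst.
Qed.

End DivisibleCompact.

(** * Quotients and products *)

Lemma subgroup_zmodClosed (G : zmodType) (S : set G) : subgroup S ->
  exists N : zmodClosed G, [set x | x \in N] = S.
Proof.
move=> sS; pose P : {pred G} := fun x => `[< S x >].
have zP : zmod_closed P.
  split; first by apply/asboolP; exact: (subgroup0 sS).
  by move=> x y /asboolP hx /asboolP hy; apply/asboolP; exact: (subgroupB sS hx hy).
pose M := GRing.isZmodClosed.Build G P zP.
pose N : zmodClosed G := HB.pack P M.
exists N; rewrite eqEsubset; split=> x /=; first by move=> /asboolP.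
by move=> Sx; apply/asboolP.
Qed.

Lemma torsion_prime_power (X : zmodType) p k (x : X) : prime p -> x *+ p ^ k = 0 ->
  prime_power_order p x.
Proof.
move=> pp xk; have ex : exists n, x *+ p ^ n == 0 by exists k; apply/eqP.
case: (ex_minnP ex) => n /eqP xn nmin; exists n; split=> //.
  by rewrite expn_gt0 prime_gt0.
move=> j /andP[j0 jn] xj.
case: (egcdnP (p ^ n) j0) => km kn ek _.
have xg : x *+ gcdn j (p ^ n) = 0.
  have : x *+ (km * j) = 0 by rewrite mulnC mulrnA xj mul0rn.
  by rewrite ek mulrnDr mulnC mulrnA xn mul0rn add0r.
have /(dvdn_pfactor _ _ pp)[e en eg] := dvdn_gcdr j (p ^ n).
have ne : (n <= e)%N by apply: nmin; rewrite -eg xg.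
have : (gcdn j (p ^ n) <= j)%N by apply: dvdn_leq => //; exact: dvdn_gcdl.
by rewrite eg leqNgt (leq_trans jn) // leq_exp2l // prime_gt1.
Qed.

Lemma hausdorff_separated (X : topologicalZmodType) :
  (forall x : X, x <> 0 -> exists2 V, nbhs (0 : X) V & ~ V x) -> hausdorff_space X.
Proof.
move=> h x y cxy; apply: contrapT => xy.
have [|V nV Vn] := h (x - y); first by move=> /eqP; rewrite subr_eq0 => /eqP.
have [W [nW W0 WN fW]] := nb_fold 2 nV.
have nA (z : X) : nbhs z [set u | W (u - z)] by apply/nb_shiftB; exists W.
have [u [/= h1 h2]] := cxy _ _ (nA x) (nA y).
apply: Vn; apply: fW; have -> : x - y = (u - y) - (u - x) by zmod.
by apply: (@foldB _ _ 1 1) => //; exact: fold1.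
Qed.

Lemma minimal_base_group (X : topologicalZmodType) :
  hausdorff_space X -> minimal_base X -> minimal_group X.
Proof.
move=> hX mX; split=> // tau gt ht to; rewrite eqEsubset; split=> // U oU.
have [tT tI tU tA tN] := gt.
have base V : nbhs (0 : X) V -> exists2 O, tau O /\ O 0 & O `<=` V.
  move=> nV; apply: (mX [set O | tau O /\ O 0]) => //.
  - split; first by exists setT.
    + move=> A1 A2 [t1 z1] [t2 z2]; exists (A1 `&` A2) => //.
      by split; [exact: tI|].
    + move=> A [tAA A0]; have [|V1 [W1 [tV tW V0 W0 VW]]] := tA 0 0 A tAA; first by rewrite addr0.
      exists (V1 `&` (-%R @^-1` W1)).
        split; first by apply: tI => //; exact: tN.
        by split=> //=; rewrite oppr0.
      by move=> x y [Vx _] [_ Wy]; exact: VW.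
    + by move=> A [].
  - by move=> A [tAA A0]; apply: open_nbhs_nbhs; split=> //; exact: to.
  - move=> x hx; apply: contrapT => x0; have [O1 [O2 [t1 t2 O1x O2y O12]]] := ht x 0 x0.
    have : (O1 `&` O2) x by split=> //; exact: hx.
    by rewrite O12.
have -> : U = \bigcup_(i : {V : set X | tau V /\ V `<=` U}) sval i.
  rewrite eqEsubset; split=> x; last by move=> [[V [tV VU]] _ /= Vx]; exact: VU.
  move=> Ux; have nU : nbhs (0 : X) [set z | U (x + z)].
    by apply: (nb_shift x U).1; exact: open_nbhs_nbhs.
  have [O [tO O0] OU] := base _ nU.
  have [|V [W [tV tW Vx Wx VW]]] := tA x (- x) O tO; first by rewrite subrr.
  have VU : V `<=` U.
    by move=> y Vy; have := OU _ (VW _ _ Vy Wx); rewrite /= addrC subrK.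
  by exists (exist _ V (conj tV VU)).
by apply: tU => -[V [tV VU]].
Qed.

Lemma top_isomorphic_intro (X Y : topologicalZmodType) (f : X -> Y) :
  (forall x y, f (x - y) = f x - f y) -> (forall x, f x = 0 -> x = 0) ->
  (forall y, exists x, f x = y) -> continuous f ->
  (forall V, nbhs (0 : X) V -> nbhs (0 : Y) (f @` V)) -> top_isomorphic X Y.
Proof.
move=> fB f0 fs fc fo.
pose M := GRing.isZmodMorphism.Build X Y f fB.
pose F : {additive X -> Y} := HB.pack f M.
have /choice[g hg] := fs.
have finj x y : f x = f y -> x = y.
  by move=> e; apply/eqP; rewrite -subr_eq0; apply/eqP; apply: f0; rewrite fB e subrr.
exists F, g; split=> //; first by move=> x; apply: finj; exact: hg.
move=> y A /nb_shiftB[V nV VA]; apply/nb_shiftB; exists (f @` V); first exact: fo.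
move=> y' [v Vv ev]; apply: VA.
by have -> : g y' - g y = v by apply: finj; rewrite fB !hg ev.
Qed.

Section QuotientMap.
Variables (G : topologicalZmodType) (N : zmodClosed G).
Local Notation pi := (topquot_pi N).

Lemma topquot_pi0 : pi 0 = 0.
Proof. by rewrite -{1}(subrr (0 : G)) topquot_piB subrr. Qed.

Lemma topquot_piD x y : pi (x + y) = pi x + pi y.
Proof.
have -> : x + y = x - (0 - y) by rewrite sub0r opprK.
by rewrite !topquot_piB topquot_pi0 sub0r opprK.
Qed.

Lemma topquot_piMn x n : pi (x *+ n) = pi x *+ n.
Proof. by elim: n => [|n IH]; rewrite ?mulr0n ?topquot_pi0 // !mulrS topquot_piD IH. Qed.

Lemma topquot_pi_eq0 x : pi x = 0 -> x \in N.
Proof. by rewrite -topquot_pi0 => /topquot_pi_eq; rewrite subr0. Qed.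

Lemma topquot_pi_in x : x \in N -> pi x = 0.
Proof. by move=> Nx; rewrite -topquot_pi0; apply: topquot_pi_eqP; rewrite subr0. Qed.

Lemma topquot_pi_continuous : continuous pi.
Proof. by apply/continuousP => A oA; rewrite -topquot_openE. Qed.

Lemma topquot_image_nb (V : set G) : nbhs (0 : G) V -> nbhs (0 : topquot N) (pi @` V).
Proof.
rewrite nbhsE => -[O [oO O0] OV].
have h : open_nbhs (0 : topquot N) (pi @` O).
  by split; [exact: topquot_pi_open|exists 0 => //; exact: topquot_pi0].
by apply: filterS (open_nbhs_nbhs h) => _ [x Ox <-]; exists x => //; exact: OV.
Qed.

Lemma topquot_preimage_nb (V : set (topquot N)) :
  nbhs (0 : topquot N) V -> nbhs (0 : G) [set x | V (pi x)].
Proof. by move=> nV; apply: (topquot_pi_continuous (x := 0)); rewrite topquot_pi0. Qed.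
End QuotientMap.

Lemma topprod_continuous (T : topologicalType) (I : eqType)
    (X : I -> topologicalZmodType) (f : T -> topprod X) :
  (forall j, continuous (fun x => f x j)) -> continuous f.
Proof.
move=> fc x; apply/cvg_sup => j A /=.
rewrite (@nbhsE (initial_topology (fun f : topprod X => f j))).
move=> [_ [[B oB <-] Bx] sBA].
apply: (@filterS _ (nbhs x) _ _ _ _ (fc j x _ (open_nbhs_nbhs (conj oB Bx)))).
by move=> z Bz; apply: sBA.
Qed.

Lemma topprod_proj_nb (I : eqType) (X : I -> topologicalZmodType) j (V : set (X j)) :
  nbhs (0 : X j) V -> nbhs (0 : topprod X) [set f : topprod X | V (f j)].
Proof.
move=> nV.
exact: (@proj_continuous _ (fun j => X j : topologicalType) j (0 : topprod X) V nV).
Qed.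

(** * The structure of G / N *)

Lemma closed_sequentially (K : topologicalZmodType) (S : set K) :
  closed S -> sequentially_closed S.
Proof.
move=> clS u l uS ul; have hl : tolim \oo u l by exact: (tolimP u l _).1.
by apply: (@tolim_closed K nat \oo u l S _ clS _ hl); apply: filterS filterT => n _; exact: uS.
Qed.

Lemma compact_mulset_closed (K : topologicalZmodType) m : hausdorff_space K ->
  compact [set: K] -> closed (mulset [set: K] m).
Proof.
move=> hK cT x hx.
have [|||F [UF hF]] := @ultra_from_base K [set A | exists2 V, nbhs (0 : K) V &
    A = [set y | V (y *+ m - x)]].
- by exists [set y | setT (y *+ m - x)], setT => //; exact: filterT.
- move=> _ _ [V nV ->] [W nW ->]; exists [set y | (V `&` W) (y *+ m - x)] => //.
  by exists (V `&` W) => //; exact: filterI.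
- by move=> _ [V nV ->]; have [_ [y _ ->] Vy] := (closureP _ _).1 hx V nV; exists y.
have PF : ProperFilter F by exact: ultra_proper.
have FT : F setT by exact: filterT.
have [l _ hl] := @compact_lim K setT _ F id cT UF FT.
exists l => //; apply: (tolim_unique hK PF _ (tolimMn m _ hl)).
move=> V nV; exact: (hF _ (ex_intro2 _ _ V nV erefl)).
Qed.

Section Structure.
Variables (R : realType) (G K : topologicalZmodType) (i : {additive G -> K}).
Hypotheses (hK : hausdorff_space K) (cK : complete_group K) (cT : compact [set: K]).
Hypotheses (emb : top_embedding i) (dns : dense (range i)).
Hypothesis sq : sequentially_closed (range i).
Hypothesis socle : forall p x, prime p -> x *+ p = 0 -> range i x.
Variables (L D : set K).
Hypotheses (clL : closed L) (sL : subgroup L).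
Hypothesis pfL : forall V, nbhs (0 : K) V -> exists2 d, (0 < d)%N & forall x, L x -> V (x *+ d).
Hypotheses (cD : compact D) (sD : subgroup D).
Hypothesis dD : forall m x, (0 < m)%N -> D x -> exists2 y, D y & y *+ m = x.
Hypothesis LD : forall x, exists2 y, D y & L (x - y).
Variable k : nat -> nat.
Hypothesis k0 : forall p, (0 < k p)%N.
Hypothesis hk : forall p x, prime p -> Qp p x -> range i (x *+ p ^ (k p).-1).

Definition ppower_image p : set K := mulset [set: K] (p ^ k p).
Definition ppower_core : set K := [set x | forall p, prime p -> ppower_image p x].
Local Notation pK := ppower_image.
Local Notation N := ppower_core.

Let sT : subgroup [set: K]. Proof. by []. Qed.
Let spK p : subgroup (pK p). Proof. exact: mulset_subgroup. Qed.
Let clpK p : closed (pK p). Proof. exact: compact_mulset_closed. Qed.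
Let si : subgroup (range i).
Proof.
split; first by exists 0 => //; exact: raddf0.
by move=> _ _ [x _ <-] [y _ <-]; exists (x - y) => //; exact: raddfB.
Qed.

Lemma ppower_core_closed : closed N.
Proof. by move=> x hx p pp; apply: clpK; apply: closureS hx => y; exact. Qed.

Lemma ppower_core_subgroup : subgroup N.
Proof.
split=> [p pp|x y hx hy p pp]; first exact: (subgroup0 (spK p)).
exact: (subgroupB (spK p) (hx p pp) (hy p pp)).
Qed.

(** By Bezout x is a limit of its own multiples by q^(k q), and the image of K under that
    multiplication is closed. *)
Lemma Qp_ppower p q x : prime p -> prime q -> p != q -> Qp p x -> pK q x.
Proof.
move=> pp pq npq Qx; have q0 : (0 < q ^ k q)%N by rewrite expn_gt0 prime_gt0.
have cpq : coprime p (q ^ k q).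
  by rewrite coprimeXr // prime_coprime // dvdn_prime2.
apply: clpK; apply: closureS (Qp_coprime_divisible pp q0 cpq Qx).
by move=> _ [m ->]; exists (x *+ m).
Qed.

Lemma D_ppower : D `<=` N.
Proof.
move=> x Dx p pp; have p0 : (0 < p ^ k p)%N by rewrite expn_gt0 prime_gt0.
by have [y _ <-] := dD p0 Dx; exists y.
Qed.

(** Write x = y + l with y in D, l in L. [divisible_compact_sub] puts y into S. As D lies in N, so
    does l, and its q-component is then q^(k q) z for some z, which is topologically q-torsion as a
    root of that component. So the component is in S, and l is the limit of finite sums of its
    components. *)
Lemma ppower_core_sub (S : set K) : subgroup S -> sequentially_closed S ->
  (forall p z, prime p -> Qp p z -> S (z *+ p ^ k p)) -> N `<=` S.
Proof.
move=> sS seqS hS x Nx.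
have DS : D `<=` S.
  apply: (divisible_compact_sub R hK cD sD dD cK sS seqS) => p pp.
  by exists (k p) => z; exact: hS.
have [y Dy Ly] := LD x; rewrite -(subrK y x); apply: (subgroupD sS); last exact: DS.
have Nl : N (x - y) by apply: (subgroupB ppower_core_subgroup) => //; exact: D_ppower.
apply: (seqS (fun n => \sum_(q < n | prime q) primcomp q (x - y))).
  move=> n; apply: (big_ind S); [exact: (subgroup0 sS)|by move=> a b; exact: (subgroupD sS)|].
  move=> q pq.
  have [z _ ez] : pK q (primcomp q (x - y)).
    exact: (primcomp_closed cK sL pfL pq Ly (@clpK q) (spK q) (Nl q pq)).
  rewrite ez; apply: hS => //; apply: (@Qp_root _ q (k q)); rewrite -ez.
  exact: (primcomp_Qp cK sL pfL).
by apply: (tolimP _ _ _).2 => V nV; exact: (primcomp_sum cK sL pfL Ly nV).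
Qed.

Lemma ppower_core_range : N `<=` range i.
Proof.
apply: ppower_core_sub => // p z pp Qz; rewrite -(prednK (k0 p)) expnSr mulrnA.
exact: (subgroupMn si _ (hk pp Qz)).
Qed.

Let D_range : D `<=` range i.
Proof. by move=> x /D_ppower; exact: ppower_core_range. Qed.

Lemma ppower_core_closure : closure (generated_subgroup
   (\bigcup_(p : primeT) [set x *+ (sval p ^ k (sval p)) | x in td K (sval p)])) = N.
Proof.
set Gen := generated_subgroup _.
have sGen : subgroup Gen.
  split=> [S [sS _]|x y hx hy S hS]; first exact: (subgroup0 sS).
  by have [sS _] := hS; exact: (subgroupB sS (hx S hS) (hy S hS)).
rewrite eqEsubset; split.
  apply: (subset_trans _ (ppower_core_closed)); apply: closureS => x; apply.
  split; first exact: ppower_core_subgroup.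
  move=> _ [[p pp] _ [y /= /quasi_torsion_Qp Qy <-]] q pq.
  have [->|pq'] := eqVneq q p; first by exists y.
  apply: (subgroupMn (spK q)); apply: (Qp_ppower pp pq) Qy; by rewrite eq_sym.
apply: ppower_core_sub; [exact: closure_subgroup|apply: closed_sequentially; exact: closed_closure|].
move=> p z pp Qz; apply: subset_closure => S [_]; apply.
exists (exist _ p pp) => //=; exists z => //; exact: (Qp_quasi_torsion hK pp Qz).
Qed.

Lemma primcomp_range p x : prime p -> L x -> range i x -> range i (primcomp p x).
Proof.
move=> pp Lx rx; apply: (sq (u := fun j => x *+ pmult p j)).
  by move=> j; exact: (subgroupMn si _ rx).
by apply: (tolimP _ _ _).2 => V nV; exact: (primcompP cK sL pfL pp Lx nV).
Qed.

Lemma primcomp_compl_ppower p x : prime p -> L x -> pK p (x - primcomp p x).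
Proof.
move=> pp Lx; apply: clpK.
apply: closureS (primcomp_compl cK sL pfL (k p) pp Lx) => _ [y _ ->].
by exists y.
Qed.

(** A prime q > d is prime to d, so c q lies in the closure of dL; the tails of the sum are
    therefore as small as dL. *)
Lemma primary_sum_lim (c : nat -> K) : (forall q, prime q -> L (c q) /\ Qp q (c q)) ->
  exists l, tolim \oo (fun n => \sum_(q < n | prime q) c q) l.
Proof.
move=> hc; apply: (complete_seq cK) => V nV.
have [W [nW W0 WN fW]] := nb_fold 2 nV; have [d d0 hd] := pfL nW.
pose Cd := closure (mulset L d).
have sCd : subgroup Cd by apply: closure_subgroup; exact: mulset_subgroup.
have tail m n : (d < m)%N -> (m <= n)%N ->
    Cd (\sum_(q < n | prime q) c q - \sum_(q < m | prime q) c q).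
  move=> dm mn; rewrite -!(big_mkord prime c) (big_cat_nat (leq0n m) mn).
  rewrite /= addrAC subrr add0r.
  rewrite big_nat_cond; apply: (big_ind Cd).
  - exact: (subgroup0 sCd).
  - by move=> a b; exact: (subgroupD sCd).
  - move=> q /andP[/andP[mq _] pq]; have [Lq Qq] := hc q pq.
    have cqd : coprime q d.
      by rewrite prime_coprime // gtnNdvd // (leq_trans _ mq).
    apply: closureS (Qp_coprime_divisible pq d0 cqd Qq) => _ [j ->].
    by exists (c q *+ j) => //; exact: (subgroupMn sL _ Lq).
have CdV x : Cd x -> V x.
  move=> /closureBP/(_ W nW)[_ [a La ->] Wa]; apply: fW.
  rewrite -(subrK (a *+ d) x); apply: (@foldD _ _ 1 1); apply: fold1 => //; exact: hd.
exists d.+1 => m n dm dn; apply: CdV.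
have [mn|nm] := leqP m n; last by apply: tail => //; exact: ltnW.
by rewrite -opprB; apply: (subgroupN sCd); exact: tail.
Qed.

(** Chinese remainder property, giving surjectivity onto the product. Remove from each g p its part
    in D, keep only its p-component, and add these over all p: the sum converges, stays in G by
    sequential closedness, and its terms other than the p-th lie in p^(k p) K. *)
Lemma simultaneous_approximation (g : nat -> G) :
  exists h, forall p, prime p -> pK p (i (h - g p)).
Proof.
have /choice[y hy] : forall p, exists y, D y /\ L (i (g p) - y).
  by move=> p; have [y Dy Ly] := LD (i (g p)); exists y.
pose l p := i (g p) - y p; pose c p := primcomp p (l p).
have Ll p : L (l p) by have [] := hy p.
have rl p : range i (l p).
  by apply: (subgroupB si); [exists (g p)|apply: D_range; have [] := hy p].
have hc q : prime q -> L (c q) /\ Qp q (c q).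
  by move=> pq; split; [exact: (primcomp_in cK clL sL pfL)|exact: (primcomp_Qp cK sL pfL)].
have [s hs] := primary_sum_lim hc.
have [h _ eh] : range i s.
  apply: (sq (u := fun n => \sum_(q < n | prime q) c q)).
    move=> n; apply: (big_ind (range i)); [exact: (subgroup0 si)|by move=> a b; exact: (subgroupD si)|].
    by move=> q pq; exact: primcomp_range.
  exact: (tolimP _ _ _).2.
exists h => p pp; rewrite raddfB eh.
have -> : s - i (g p) = (s - c p) - (l p - c p) - y p by rewrite /l; zmod.
apply: (subgroupB (spK p)); last by apply: D_ppower pp; have [] := hy p.
apply: (subgroupB (spK p)); last exact: primcomp_compl_ppower.
apply: (@tolim_closed K nat \oo (fun n => \sum_(q < n | prime q) c q - c p) _ (pK p)) => //.
  exists p.+1 => // n /= pn.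
  rewrite (bigD1 (Ordinal pn)) //= addrAC subrr add0r.
  apply: (big_ind (pK p)); [exact: (subgroup0 (spK p))|by move=> a b; exact: (subgroupD (spK p))|].
  move=> q /andP[pq nqp]; have [_ Qq] := hc q pq.
  by apply: (Qp_ppower pq pp) Qq.
by apply: tolimB => //; exact: tolim_cst.
Qed.

Lemma embedding_nbP (A : set G) : nbhs (0 : G) A ->
  exists2 V, nbhs (0 : K) V & forall g, V (i g) -> A g.
Proof.
rewrite nbhsE => -[O [oO O0] OA]; have [B oB eB] := (emb.2 O).1 oO.
exists B; last by move=> g Bg; apply: OA; rewrite eB.
by apply: open_nbhs_nbhs; split=> //; move: O0; rewrite eB /= raddf0.
Qed.

(** N is the intersection of the p^(k p) K, so by compactness of K nearness to finitely many of them
    already gives nearness to N. This makes the map to the product open. *)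
Lemma ppower_core_near V : nbhs (0 : K) V -> exists m W, nbhs (0 : K) W /\
  forall x, (forall p, prime p -> (p < m)%N -> exists2 z, pK p z & W (x - z)) ->
    exists2 n, N n & V (x - n).
Proof.
move=> nV; apply: contrapT => nex.
pose E m W := [set x | (forall p, prime p -> (p < m)%N -> exists2 z, pK p z & W (x - z)) /\
   forall n, N n -> ~ V (x - n)].
have [|||F [UF hF]] := @ultra_from_base K [set A | exists m W, nbhs (0 : K) W /\ A = E m W].
- by exists (E 0%N setT), 0%N, setT; split=> //; exact: filterT.
- move=> _ _ [m1 [W1 [n1 ->]]] [m2 [W2 [n2 ->]]]; exists (E (maxn m1 m2) (W1 `&` W2)).
    by exists (maxn m1 m2), (W1 `&` W2); split=> //; exact: filterI.
  move=> x [h hx]; split; split=> // p pp pm.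
    have pm' : (p < maxn m1 m2)%N by rewrite leq_max pm.
    by have [z pz [Wz _]] := h p pp pm'; exists z.
  have pm' : (p < maxn m1 m2)%N by rewrite leq_max pm orbT.
  by have [z pz [_ Wz]] := h p pp pm'; exists z.
- move=> _ [m [W [nW ->]]]; apply: contrapT => hE; apply: nex; exists m, W; split=> // x hx.
  apply: contrapT => hn; apply: hE; exists x; split=> // n Nn Vn; apply: hn; by exists n.
have PF : ProperFilter F by exact: ultra_proper.
have FT : F setT by exact: filterT.
have inF m W (nW : nbhs (0 : K) W) : F (E m W) by apply: hF; exists m, W.
have [l _ hl] := @compact_lim K setT _ F id cT UF FT.
have Nl : N l.
  move=> p pp; apply: clpK; apply/closureP => U nU.
  have [W [nW W0 WN fW]] := nb_fold 2 nU.
  have [x [[/(_ p pp (ltnSn p))[z pz Wz] _] Wx]] := filterI_ex PF (inF p.+1 W nW) (hl W nW).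
  exists z => //; apply: fW; have -> : z - l = (x - l) - (x - z) by zmod.
  by apply: (@foldB _ _ 1 1) => //; exact: fold1.
have [x [[_ h] Vx]] := filterI_ex PF (inF 0%N _ nV) (hl V nV).
exact: (h l Nl).
Qed.

Lemma ppower_dense p z V : nbhs (0 : K) V -> pK p z ->
  exists2 h, pK p (i h) & V (i h - z).
Proof.
move=> nV [y _ ->]; have [g Vg] := dense_approx dns y (nbMn (p ^ k p) nV).
exists (g *+ p ^ k p); first by rewrite raddfMn; exists (i g).
by rewrite raddfMn -mulrnBl.
Qed.

(** Split z into a part in D, which lies in G, a p-component, whose multiple by p^(k p - 1) lies in
    G, and a rest lying in p^(k p) K. *)
Lemma ppower_pred_range p z : prime p -> exists2 g, True & pK p (z *+ p ^ (k p).-1 - i g).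
Proof.
move=> pp; have [y Dy Ly] := LD z.
have [g1 _ e1] := D_range (subgroupMn sD (p ^ (k p).-1) Dy).
have Qc : Qp p (primcomp p (z - y)) by exact: (primcomp_Qp cK sL pfL).
have [g2 _ e2] := hk pp Qc.
exists (g1 + g2) => //; rewrite raddfD e1 e2.
have -> : z *+ p ^ (k p).-1 - (y *+ p ^ (k p).-1 + primcomp p (z - y) *+ p ^ (k p).-1) =
  (z - y - primcomp p (z - y)) *+ p ^ (k p).-1 by rewrite !mulrnBl; zmod.
by apply: (subgroupMn (spK p)); exact: primcomp_compl_ppower.
Qed.

(** * The quotients B_p and their minimality *)

Section Primary.
Variables (p : nat) (M : zmodClosed G).
Hypotheses (pp : prime p) (hM : [set x | x \in M] = [set g | pK p (i g)]).
Local Notation Q := (topquot M).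
Local Notation pi := (topquot_pi M).

Let inM g : (g \in M) <-> pK p (i g).
Proof. by have /(congr1 (fun S => S g)) /= -> := hM. Qed.

Lemma primary_quotient_exponent (x : Q) : x *+ p ^ k p = 0.
Proof.
have [g <-] := topquot_pi_surj x; rewrite -topquot_piMn; apply: topquot_pi_in.
by apply/inM; rewrite raddfMn; exists (i g).
Qed.

Lemma primary_quotient_bounded : bounded_group Q.
Proof.
exists (p ^ k p)%N; first by rewrite expn_gt0 prime_gt0.
exact: primary_quotient_exponent.
Qed.

Lemma primary_quotient_torsion : ptorsion_group Q p.
Proof. by move=> x; exact: (torsion_prime_power pp (primary_quotient_exponent x)). Qed.

Lemma primary_quotient_hausdorff : hausdorff_space Q.
Proof.
apply: hausdorff_separated => x; have [g <-] := topquot_pi_surj x => xg.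
have : ~ closure (pK p) (i g).
  by move=> /clpK/inM/topquot_pi_in.
move=> /closureBP/existsNP[V /not_implyP[nV hV]].
exists (pi @` [set h | V (i h)]); first exact: topquot_image_nb (embedding_nb emb nV).
move=> [h /= Vh /topquot_pi_eq hg]; apply: hV; exists (i (g - h)).
  by apply/inM; rewrite -opprB rpredN.
by rewrite raddfB opprB addrC subrK.
Qed.

Lemma primary_quotient_minimal_base : minimal_base Q.
Proof.
move=> B gB Bnb Bsep V nV; apply: contrapT => nex.
have [[A0 BA0] BI BB B0] := gB.
have [W0 nW0 hW0] := embedding_nbP (topquot_preimage_nb nV).
(* The points of K approximated by the preimages in G of every member of B. It is a subgroup
   containing p^(k p) K; equality would make B a base of the given topology. *)
pose X := [set x | forall A, B A -> forall U, nbhs (0 : K) U ->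
   exists2 g, A (pi g) & U (i g - x)].
have sX : subgroup X.
  split=> [A BA U nU|x y hx hy A BA U nU].
    exists 0; first by rewrite topquot_pi0; exact: B0.
    by rewrite raddf0 subr0; exact: nb0.
  have [A' BA' hA'] := BB A BA; have [W [nW _ WN fW]] := nb_fold 2 nU.
  have [g1 Ag1 Wg1] := hx A' BA' W nW; have [g2 Ag2 Wg2] := hy A' BA' W nW.
  exists (g1 - g2); first by rewrite topquot_piB; exact: hA'.
  apply: fW; have -> : i (g1 - g2) - (x - y) = (i g1 - x) - (i g2 - y) by rewrite raddfB; zmod.
  by apply: (@foldB _ _ 1 1) => //; exact: fold1.
have pX z : pK p z -> X z.
  move=> pz A BA U nU; have [h ph Uh] := ppower_dense nU pz.
  by exists h => //; rewrite topquot_pi_in; [exact: B0|exact/inM].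
(* A limit in the compact group K of points of G whose images lie in the members of B but outside
   V. *)
have [x [Xx nx]] : exists x, X x /\ ~ pK p x.
  pose E A := [set x | exists g, [/\ A (pi g), ~ V (pi g) & x = i g]].
  have [|||F [UF hF]] := @ultra_from_base K [set C | exists2 A, B A & C = E A].
  - by exists (E A0), A0.
  - move=> _ _ [A1 BA1 ->] [A2 BA2 ->]; have [A BA hA] := BI _ _ BA1 BA2.
    exists (E A); first by exists A.
    by move=> _ [g [/hA[h1 h2] Vg ->]]; split; exists g.
  - move=> _ [A BA ->]; apply: contrapT => hE; apply: nex; exists A => // q.
    have [g <-] := topquot_pi_surj q => Ag; apply: contrapT => Vg; apply: hE.
    by exists (i g), g.
  have PF : ProperFilter F by exact: ultra_proper.
  have FT : F setT by exact: filterT.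
  have inF A (BA : B A) : F (E A) by apply: hF; exists A.
  have [l _ hl] := @compact_lim K setT _ F id cT UF FT.
  exists l; split.
    move=> A BA U nU; have [_ [[g [Ag _ ->]] Ug]] := filterI_ex PF (inF A BA) (hl U nU).
    by exists g.
  move=> pl; have [W [nW _ WN fW]] := nb_fold 2 nW0.
  have [_ [[g [_ Vg ->]] Wg]] := filterI_ex PF (inF A0 BA0) (hl W nW).
  have [h ph Wh] := ppower_dense nW pl; apply: Vg.
  have <- : pi (g - h) = pi g by rewrite topquot_piB (topquot_pi_in ((inM h).2 ph)) subr0.
  apply: hW0; apply: fW; have -> : i (g - h) = (i g - l) - (i h - l) by rewrite raddfB; zmod.
  by apply: (@foldB _ _ 1 1) => //; exact: fold1.
(* The last multiple p^j x outside p^(k p) K. *)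
have [y [Xy ny py]] : exists y, [/\ X y, ~ pK p y & pK p (y *+ p)].
  have ex : exists j, `[< pK p (x *+ p ^ j) >] by exists (k p); apply/asboolP; exists x.
  case: (ex_minnP ex) => -[|j] /asboolP hj jmin.
    by case: nx; move: hj; rewrite expn0 mulr1n.
  exists (x *+ p ^ j); split; first exact: (subgroupMn sX).
    by move=> h; have := jmin j (introT (asboolP _) h); rewrite ltnn.
  by rewrite -mulrnA -expnSr.
have [z _ ez] := py.
have [s _ es] : range i (y - z *+ p ^ (k p).-1).
  apply: (@socle p) => //; rewrite mulrnBl -mulrnA -expnSr (prednK (k0 p)) ez; exact: subrr.
have [g _ pg] := ppower_pred_range z pp.
have Xsg : X (i (s + g)).
  have -> : i (s + g) = y - (z *+ p ^ (k p).-1 - i g) by rewrite raddfD es; zmod.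
  by apply: (subgroupB sX) => //; exact: pX.
(* i (s + g) is a point of G lying in X and congruent to y, so its image is in every member of B and
   is 0 by separation; this would put y into p^(k p) K. *)
have sg0 : pi (s + g) = 0.
  apply: Bsep => A BA; have [A1 BA1 [_ A1D _]] := group_base_add gB BA.
  have [U nU hU] := embedding_nbP (topquot_preimage_nb (Bnb _ BA1)).
  have [h Ah Uh] := Xsg _ BA1 _ (nbN nU).
  have -> : s + g = (s + g - h) + h by rewrite subrK.
  rewrite topquot_piD; apply: A1D => //; apply: hU.
  by move: Uh; rewrite /= opprB -raddfB.
apply: ny; have -> : y = i (s + g) + (z *+ p ^ (k p).-1 - i g) by rewrite raddfD es; zmod.
apply: (subgroupD (spK p)) => //; apply/inM; exact: topquot_pi_eq0.
Qed.

Lemma primary_quotient_minimal : minimal_group Q.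
Proof.
exact: (minimal_base_group primary_quotient_hausdorff primary_quotient_minimal_base).
Qed.
End Primary.

(** * The isomorphism of G / N with the product *)

Section Isomorphism.
Variables (NG : zmodClosed G) (M : primeT -> zmodClosed G).
Hypothesis hNG : [set x | x \in NG] = [set g | N (i g)].
Hypothesis hM : forall q, [set x | x \in M q] = [set g | pK (sval q) (i g)].
Local Notation B := (fun q : primeT => topquot (M q) : topologicalZmodType).

Let inNG g : (g \in NG) <-> N (i g).
Proof. by have /(congr1 (fun S => S g)) /= -> := hNG. Qed.
Let inM q g : (g \in M q) <-> pK (sval q) (i g).
Proof. by have /(congr1 (fun S => S g)) /= -> := hM q. Qed.

Let lift : topquot NG -> G := fun x => sval (cid (topquot_pi_surj x)).
Let liftK x : topquot_pi NG (lift x) = x.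
Proof. exact: (svalP (cid (topquot_pi_surj x))). Qed.
Let phi (x : topquot NG) : topprod B := fun q => topquot_pi (M q) (lift x).

Let pi_NG g h q : topquot_pi NG g = topquot_pi NG h -> topquot_pi (M q) g = topquot_pi (M q) h.
Proof.
move=> /topquot_pi_eq/inNG Ngh; apply: topquot_pi_eqP; apply/inM.
by apply: Ngh; exact: (svalP q).
Qed.

Let phi_pi g q : phi (topquot_pi NG g) q = topquot_pi (M q) g.
Proof. by apply: pi_NG; exact: liftK. Qed.

Let phi_onto b : exists x, phi x = b.
Proof.
have /choice[g hg] : forall p, exists g, forall pp : prime p,
    topquot_pi (M (exist _ p pp)) g = b (exist _ p pp).
  move=> p; have [pp|np] := pselect (prime p); last by exists 0 => pp; case: np.
  have [g hg] := topquot_pi_surj (b (exist _ p pp)); exists g => pp'.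
  by rewrite (bool_irrelevance pp' pp).
have [h hh] := simultaneous_approximation g.
exists (topquot_pi NG h); apply: functional_extensionality_dep => -[p pp].
rewrite phi_pi -(hg p pp); apply: topquot_pi_eqP; apply/inM; exact: hh.
Qed.

Lemma quotient_product_isomorphic : top_isomorphic (topquot NG) (topprod B).
Proof.
apply: (@top_isomorphic_intro _ _ phi).
- move=> x y; apply: functional_extensionality_dep => q.
  transitivity (topquot_pi (M q) (lift x - lift y)).
    by apply: pi_NG; rewrite topquot_piB !liftK.
  exact: topquot_piB.
- move=> x e; rewrite -(liftK x); apply: topquot_pi_in; apply/inNG => p pp.
  apply/(inM (exist _ p pp)); apply: topquot_pi_eq0.
  exact: (congr1 (fun f : topprod B => f (exist _ p pp)) e).
- exact: phi_onto.
- apply/continuousP => A oA; rewrite topquot_openE.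
  have pc : continuous (fun g => (fun q => topquot_pi (M q) g) : topprod B).
    by apply: topprod_continuous => q; exact: topquot_pi_continuous.
  have -> : topquot_pi NG @^-1` (phi @^-1` A) =
      (fun g => (fun q => topquot_pi (M q) g) : topprod B) @^-1` A.
    rewrite eqEsubset; split=> g /=; congr (A _); apply: functional_extensionality_dep => q.
      exact: phi_pi.
    by rewrite phi_pi.
  by move/continuousP: pc; exact.
- move=> V nV; have [W0 nW0 hW0] := embedding_nbP (topquot_preimage_nb nV).
  have [m [W [nW hW]]] := ppower_core_near nW0.
  (* Only the finitely many primes below m are constrained, so this is a neighbourhood in the
     product. *)
  have nB : nbhs (0 : topprod B) [set b : topprod B | forall q : primeT, (sval q < m)%N ->
      (topquot_pi (M q) @` [set g | W (i g)]) (b q)].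
    elim: m {hW} => [|m IH]; first by apply: filterS filterT.
    have [pm|npm] := boolP (prime m); last first.
      apply: filterS IH => b hb [p pp] /=; rewrite ltnS leq_eqVlt => /orP[/eqP e|pm].
        by move: npm; rewrite -e pp.
      by apply: (hb (exist _ p pp)).
    have nm := @topprod_proj_nb _ B (exist _ m pm) _
      (topquot_image_nb (M (exist _ m pm)) (embedding_nb emb nW)).
    apply: filterS2 IH nm => b hb hm [p pp] /=; rewrite ltnS leq_eqVlt => /orP[/eqP e|pm'].
      by subst p; rewrite (bool_irrelevance pp pm).
    by apply: (hb (exist _ p pp)).
  apply: filterS nB => b hb.
  have [x ex] := phi_onto b; rewrite -ex in hb *; pose g := lift x.
  have [|n Nn Wn] := hW (i g).
    move=> p pp pm; have [h Wh eh] := hb (exist _ p pp) pm.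
    exists (i (g - h)); last by rewrite raddfB opprB addrC subrK.
    apply/(inM (exist _ p pp)); apply: topquot_pi_eq; by rewrite eh.
  have [g' _ eg'] := ppower_core_range Nn; exists x => //.
  have g'0 : topquot_pi NG g' = 0 by apply: topquot_pi_in; apply/inNG; rewrite eg'.
  have <- : topquot_pi NG (g - g') = x by rewrite topquot_piB g'0 subr0; exact: liftK.
  by apply: hW0; rewrite raddfB eg'.
Qed.
End Isomorphism.
End Structure.

Theorem theorem2p16 (G Gt : topologicalZmodType) (i : {additive G -> Gt}) :
  hausdorff_space G ->
  is_completion i ->
  sequentially_complete i ->
  minimal_group (topprod (fun _ : nat => G)) ->
  exists k : primeT -> nat,
    (forall p, (1 <= k p)%N) /\
    let N : set Gt := closure (generated_subgroup
      (\bigcup_(p : primeT) [set x *+ (sval p ^ k p) | x in td Gt (sval p)])) in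
    [/\ compact N,
        N `<=` range i &
        exists2 NG : zmodClosed G, [set x | x \in NG] = i @^-1` N &
        exists2 B : primeT -> topologicalZmodType,
          forall p, [/\ bounded_group (B p), ptorsion_group (B p) (sval p) &
                        minimal_group (B p)] &
          top_isomorphic (topquot NG) (topprod B)].
Proof.
move=> hG [hK cK emb dns] sq mP; pose R : realType := Rdefinitions.R.
have mK : minimal_base Gt by exact: (completion_minimal_base hK emb dns mP).
have [L [clL sL pfL LD cT]] := minimal_complete_compact R hK cK mK.
have sT : subgroup [set: Gt] by [].
have pcT V : nbhs (0 : Gt) V -> exists2 d, (0 < d)%N & pc V (mulset [set: Gt] d).
  by move=> nV; exists 1%N => //; apply: pc_sub (pc_compact cT nV).
have cD : compact (divpart [set: Gt]) by exact: (divpart_compact cK pcT).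
have sD : subgroup (divpart [set: Gt]) by exact: divpart_subgroup.
have dD m x : (0 < m)%N -> divpart [set: Gt] x -> exists2 y, divpart [set: Gt] y & y *+ m = x.
  exact: (divpart_divisible hK cK sT pcT).
have socle p x : prime p -> x *+ p = 0 -> range i x by exact: (socle_in hK emb dns mP).
have /choice[k' hk'] : forall p, exists k : nat, prime p -> forall x, Qp p x -> range i (x *+ p ^ k).
  move=> p; have [pp|np] := pselect (prime p); last by exists 0%N.
  by have [n hn] := torsion_bound hK emb dns mP sq pp; exists n.
(* One more than the torsion bound: p^(k p - 1) td_p lies in G already, which the minimality of the
   factors uses. *)
pose k p := (k' p).+1.
have k0 p : (0 < k p)%N by [].
have hk p x : prime p -> Qp p x -> range i (x *+ p ^ (k p).-1) by move=> pp; exact: hk'.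
exists (fun p => k (sval p)); split=> // N.
have eN : N = ppower_core k by apply: (ppower_core_closure R hK cK cT sL pfL cD sD dD LD).
have rN : ppower_core k `<=` range i.
  exact: (ppower_core_range R hK cK cT sq sL pfL cD sD dD LD k0 hk).
have clN : closed (ppower_core k : set Gt) by exact: ppower_core_closed.
have sN : subgroup (ppower_core k : set Gt) by exact: ppower_core_subgroup.
rewrite eN; split=> //; first exact: (subclosed_compact clN cT).
have si (S : set Gt) : subgroup S -> subgroup (i @^-1` S).
  move=> sS; split; first by rewrite /= raddf0; exact: subgroup0.
  by move=> x y Sx Sy; rewrite /= raddfB; exact: (subgroupB sS).
have [NG hNG] := subgroup_zmodClosed (si _ sN).
have /choice[M hM] : forall q : primeT, exists M : zmodClosed G,
    [set x | x \in M] = [set g | ppower_image k (sval q) (i g)].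
  by move=> q; apply: subgroup_zmodClosed; apply: (si (ppower_image k (sval q))); exact: mulset_subgroup.
exists NG => //; exists (fun q => topquot (M q)).
  move=> q; have pq : prime (sval q) by exact: (svalP q).
  split.
  - exact: (primary_quotient_bounded pq (hM q)).
  - exact: (primary_quotient_torsion pq (hM q)).
  - exact: (primary_quotient_minimal R hK cK cT emb dns sq socle sL pfL cD sD dD LD k0 hk pq (hM q)).
exact: (quotient_product_isomorphic R hK cK cT emb sq clL sL pfL cD sD dD LD k0 hk hNG hM).
Qed.
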